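(* Let $M\subset\mathbb{C}^n$ be a complex domain containing the origin, endowed with a rotation invariant Kähler potential $\Phi:M\to\mathbb{R}$, and let $\tilde\Phi$ be the function associated to $\Phi$, so that $\Phi(z)=\tilde\Phi(|z_1|^2,\dots,|z_n|^2)$. Let $\Phi^*$ be the local dual of $\Phi$, defined on $M^*$, and put $\omega=\frac{i}{2}\partial\bar\partial\Phi$ on $M$ and $\omega^*=\frac{i}{2}\partial\bar\partial\Phi^*$ on $M^*$. Assume that there are no non-empty open subset of $M$ and real number $c$ such that $\omega=c\,\omega_0$ on that subset. Let $\lambda>0$. Then there exists a special $\lambda$-symplectic duality $\Psi:U\to U^*$ between $\omega$ and $\omega^*$ (where $U\subset M$ and $U^*\subset M^*$ are connected open neighbourhoods of the origin) if and only if the equations $$\lambda^2\,\frac{\partial\tilde\Phi}{\partial x_k}(x_1,\dots,x_n)\cdot\frac{\partial\tilde\Phi}{\partial x_k}\left(-\lambda\frac{\partial\tilde\Phi}{\partial x_1}(x)\,x_1,\ \dots,\ -\lambda\frac{\partial\tilde\Phi}{\partial x_n}(x)\,x_n\right)=1,\qquad k=1,\dots,n,$$ hold for all $x=(x_1,\dots,x_n)$ in some open neighbourhood of the origin of $\mathbb{R}^n$. Moreover, $\Psi$ is uniquely determined by $\Phi$ and it is rotation invariant.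
   Context: A complex domain is an open connected subset of $\mathbb{C}^n$. $\omega_0=\frac{i}{2}\sum_{j=1}^n dz_j\wedge d\bar z_j$ is the flat Kähler form. A Kähler potential on a complex domain $M$ is a real analytic strictly plurisubharmonic function $\Phi:M\to\mathbb{R}$; then $\frac{i}{2}\partial\bar\partial\Phi$ is a Kähler form. Rotation invariant potentials: put $\tilde M=\{(|z_1|^2,\dots,|z_n|^2) : z\in M\}$. The potential $\Phi$ is rotation invariant if there is $\tilde\Phi:\tilde M\to\mathbb{R}$ with $\Phi(z)=\tilde\Phi(|z_1|^2,\dots,|z_n|^2)$ for all $z\in M$; $\tilde\Phi$ and $\tilde M$ are called the function and the domain associated to $\Phi$ and $M$. Since $\Phi$ is real analytic, $\tilde\Phi$ is given near the origin by a convergent power series in $x_1,\dots,x_n$, and so extends real analytically to an open neighbourhood of the origin in $\mathbb{R}^n$; this extension is still denoted $\tilde\Phi$. Local dual: expand $\Phi$ near the origin as a convergent power series in $z,\bar z$, and let $\Phi(z,-\bar z)$ denote the result of replacing $\bar z$ by $-\bar z$ in it. A local dual $(M^*,\Phi^* )$ of $(M,\Phi)$ consists of a complex domain $M^*\subset\mathbb{C}^n$ containing the origin such that $\Phi^*(z,\bar z)=-\Phi(z,-\bar z)$ is a real valued strictly plurisubharmonic function on $M^*$. For rotation invariant $\Phi$ a local dual exists and is rotation invariant, with $\Phi^*(z)=-\tilde\Phi(-|z_1|^2,\dots,-|z_n|^2)$ near the origin. For $\lambda>0$, a $\lambda$-symplectic duality between $\omega$ and $\omega^*$ is a diffeomorphism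 $\Psi:U\to U^*$ between open neighbourhoods of the origin $U\subset M$, $U^*\subset M^*$ such that $\Psi^*\omega_0=\lambda\,\omega$ and $\Psi^*(\lambda\,\omega^* )=\omega_0$ on $U$. A real analytic map $\Psi=(\Psi_1,\dots,\Psi_n):C\to S$ (not necessarily a diffeomorphism) between complex domains of $\mathbb{C}^n$ containing the origin is special if $\Psi_j(z)=\psi_j(z)z_j$, $j=1,\dots,n$, for real valued (real analytic) functions $\psi_j$ on $C$. A special map is rotation invariant if moreover there are real valued functions $\tilde\psi_j$ on $\tilde C=\{(|z_1|^2,\dots,|z_n|^2):z\in C\}$ with $\psi_j(z)=\tilde\psi_j(|z_1|^2,\dots,|z_n|^2)$ for all $z\in C$.
   Formalization: ''Ψ is uniquely determined by Φ'' is proved up to one constant sign ±1 per component (on the intersection of domains), since literal uniqueness fails: for Φ=log(1+|z|²), λ=1, both Ψ=±z/√(1+|z|²) are special dualities. *)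

(* Defs.v *)
From HB Require Import structures.
From mathcomp Require Import all_boot all_order all_algebra finmap.
From mathcomp Require Import complex.
From mathcomp Require Import all_classical all_reals all_analysis.

Set Implicit Arguments.
Unset Strict Implicit.
Unset Printing Implicit Defensive.

Import Order.TTheory GRing.Theory Num.Theory.
Import numFieldNormedType.Exports.

Local Open Scope classical_set_scope.
Local Open Scope ring_scope.
Local Open Scope complex_scope.

(* Unconditional summability over an arbitrary index set. It is used with      *)
(* K = R and K = R[i]; in R[i], 0 < e forces e to be a positive real.          *)
Definition has_sum (K : numDomainType) (I : choiceType) (f : I -> K) (l : K) :=
  forall e : K, 0 < e ->
    exists A : {fset I}, forall B : {fset I}, (A `<=` B)%fset ->
      `|\sum_(i <- B) f i - l| < e.

Section Analytic.
Variables (R : realType) (m : nat).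
Implicit Types (U : set 'rV[R]_m) (f : 'rV[R]_m -> R).

Definition monomial (h : 'rV[R]_m) (p : {ffun 'I_m -> nat}) : R :=
  \prod_(i < m) h 0 i ^+ p i.

Definition real_analytic_at f (a : 'rV[R]_m) :=
  exists c : {ffun 'I_m -> nat} -> R,
    \forall x \near a, has_sum (fun p => c p * monomial (x - a) p) (f x).

Definition real_analytic_on U f := forall a, U a -> real_analytic_at f a.

Definition partial (i : 'I_m) f : 'rV[R]_m -> R :=
  'D_(delta_mx 0 i : 'rV[R]_m) f.

(* All iterated partial derivatives exist and are (Frechet) differentiable on  *)
(* U; for U open this is C^oo regularity on U.                                 *)
Definition smooth_on U f :=
  forall (s : seq 'I_m) (x : 'rV[R]_m), U x -> differentiable (foldr partial f s) x.

End Analytic.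

Definition diffeomorphism_on (R : realType) (m : nat)
    (U V : set 'rV[R]_m) (F : 'rV[R]_m -> 'rV[R]_m) :=
  exists G : 'rV[R]_m -> 'rV[R]_m,
    [/\ forall x, U x -> V (F x) /\ G (F x) = x,
        forall y, V y -> U (G y) /\ F (G y) = y,
        forall i, smooth_on U (fun x => F x 0 i) &
        forall i, smooth_on V (fun y => G y 0 i)].

(* C^n is R^(n+n): the row vector (x_1, ..., x_n, y_1, ..., y_n) stands for    *)
(* (x_1 + i y_1, ..., x_n + i y_n). Points and real tangent vectors have the   *)
(* same type.                                                                  *)
Section ComplexSpace.
Variables (R : realType) (n : nat).
Local Notation V := 'rV[R]_(n + n).
Implicit Types (z u v : V) (Phi : V -> R) (Psi : V -> V).

Definition zcoord z (j : 'I_n) : R[i] :=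
  z 0 (lshift n j) +i* z 0 (rshift n j).

Definition sqmod z : 'rV[R]_n :=
  \row_(j < n) (z 0 (lshift n j) ^+ 2 + z 0 (rshift n j) ^+ 2).

Definition complex_domain (M : set V) := [/\ open M, connected M & M !=set0].

Definition cderive (f : V -> R[i]) (v z : V) : R[i] :=
  ('D_v (fun w => complex.Re (f w)) z) +i* ('D_v (fun w => complex.Im (f w)) z).

Definition d_z (j : 'I_n) (f : V -> R[i]) z : R[i] :=
  2^-1 * (cderive f (delta_mx 0 (lshift n j)) z
          - 'i * cderive f (delta_mx 0 (rshift n j)) z).

Definition d_zbar (j : 'I_n) (f : V -> R[i]) z : R[i] :=
  2^-1 * (cderive f (delta_mx 0 (lshift n j)) z
          + 'i * cderive f (delta_mx 0 (rshift n j)) z).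

Definition levi Phi z (j k : 'I_n) : R[i] :=
  d_z j (d_zbar k (fun w => (Phi w)%:C)) z.

Definition strictly_psh_on (M : set V) Phi :=
  forall z, M z -> forall v, v != 0 ->
    0 < \sum_(j < n) \sum_(k < n) levi Phi z j k * zcoord v j * (zcoord v k)^*.

Definition kahler_potential (M : set V) Phi :=
  real_analytic_on M Phi /\ strictly_psh_on M Phi.

Definition form2 := V -> V -> V -> R[i].

Definition dz_dzbar (j k : 'I_n) u v : R[i] :=
  zcoord u j * (zcoord v k)^* - zcoord v j * (zcoord u k)^*.

Definition omega0 : form2 := fun _ u v =>
  ('i / 2) * \sum_(j < n) dz_dzbar j j u v.

Definition kahler_form Phi : form2 := fun z u v =>
  ('i / 2) * \sum_(j < n) \sum_(k < n) levi Phi z j k * dz_dzbar j k u v.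

Definition pullback Psi (w : form2) : form2 := fun z u v =>
  w (Psi z) ('d Psi z u) ('d Psi z v).

Definition scale_form (c : R) (w : form2) : form2 := fun z u v => c%:C * w z u v.

Definition form_eq_on (U : set V) (w w' : form2) :=
  forall z, U z -> forall u v, w z u v = w' z u v.

(* Phit represents both the function on the set of all (|z_1|^2, ..., |z_n|^2) *)
(* with z in M, and its real analytic extension to a neighbourhood of 0.       *)
Definition associated_function (M : set V) Phi (Phit : 'rV[R]_n -> R) :=
  (forall z, M z -> Phi z = Phit (sqmod z)) /\
  (exists W : set 'rV[R]_n, [/\ open W, W 0 & real_analytic_on W Phit]).

Definition polar_term (a : {ffun 'I_n -> nat} * {ffun 'I_n -> nat} -> R[i])
    (z w : 'I_n -> R[i]) (pq : {ffun 'I_n -> nat} * {ffun 'I_n -> nat}) : R[i] :=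
  a pq * (\prod_(j < n) z j ^+ pq.1 j) * (\prod_(j < n) w j ^+ pq.2 j).

(* Phid(z) = - Phi(z, - zbar) near the origin, where Phi(z, w) is the power    *)
(* series with Phi(z, zbar) = Phi(z). Away from the origin Phid is the real    *)
(* analytic continuation to Md, where that power series need not converge.     *)
Definition local_dual Phi (Md : set V) (Phid : V -> R) :=
  [/\ complex_domain Md, Md 0, kahler_potential Md Phid &
      exists a : {ffun 'I_n -> nat} * {ffun 'I_n -> nat} -> R[i],
        (\forall z \near (0 : V),
           has_sum (polar_term a (zcoord z) (fun j => (zcoord z j)^*)) (Phi z)%:C) /\
        (\forall z \near (0 : V),
           has_sum (polar_term a (zcoord z) (fun j => - (zcoord z j)^*))
             (- Phid z)%:C)].

Definition nowhere_flat (M : set V) Phi :=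
  ~ exists (U : set V) (c : R),
      [/\ open U, U !=set0, U `<=` M &
          form_eq_on U (kahler_form Phi) (scale_form c omega0)].

Definition symplectic_duality (lambda : R) (M : set V) Phi (Md : set V)
    (Phid : V -> R) (U Ud : set V) Psi :=
  [/\ [/\ open U, U 0 & U `<=` M],
      [/\ open Ud, Ud 0 & Ud `<=` Md],
      diffeomorphism_on U Ud Psi,
      form_eq_on U (pullback Psi omega0) (scale_form lambda (kahler_form Phi)) &
      form_eq_on U (pullback Psi (scale_form lambda (kahler_form Phid))) omega0].

Definition special_factors (C : set V) Psi (psi : 'I_n -> V -> R) :=
  forall j, real_analytic_on C (psi j) /\
    forall z, C z -> zcoord (Psi z) j = (psi j z)%:C * zcoord z j.

Definition special_map (C S : set V) Psi :=
  [/\ complex_domain C /\ C 0, complex_domain S /\ S 0,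
      forall z, C z -> S (Psi z),
      forall i, real_analytic_on C (fun z => Psi z 0 i) &
      exists psi, special_factors C Psi psi].

Definition rotation_invariant_map (C : set V) Psi :=
  exists (psi : 'I_n -> V -> R) (psit : 'I_n -> 'rV[R]_n -> R),
    special_factors C Psi psi /\
    forall j z, C z -> psi j z = psit j (sqmod z).

(* The domains U and Ud are connected because special_map asks for complex     *)
(* domains.                                                                    *)
Definition special_symplectic_duality (lambda : R) (M : set V) Phi (Md : set V)
    (Phid : V -> R) (U Ud : set V) Psi :=
  symplectic_duality lambda M Phi Md Phid U Ud Psi /\ special_map U Ud Psi.

End ComplexSpace.

(* Main.v *)
Require Import Defs.
From HB Require Import structures.
From mathcomp Require Import all_boot all_order all_algebra finmap.
From mathcomp Require Import complex.
From mathcomp Require Import all_classical all_reals all_analysis.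
From mathcomp Require Import ring lra.
Set Implicit Arguments.
Unset Strict Implicit.
Unset Printing Implicit Defensive.
Import Order.TTheory GRing.Theory Num.Theory.
Import numFieldNormedType.Exports.
Local Open Scope classical_set_scope.
Local Open Scope ring_scope.

(** Write [x = (|z_1|^2, ..., |z_n|^2)], [q] for the function associated to the
potential and [q_j] for its partial derivatives. In polar coordinates
[z_j = r_j exp (i t_j)] the Kaehler form of the potential is
[1/2 \sum_j d (q_j(x) r_j^2) /\ d t_j], the flat form is the case [q_j = 1], and
the dual potential has [q_j(- x)] in place of [q_j(x)]. A special map preserves
the angles up to sign and replaces [r_j^2] by [psi_j^2 r_j^2]. So both conditions
of a special duality compare two-forms [1/2 \sum_j d (Q_j r_j^2) /\ d t_j]
([omega_form] below), and such a form vanishes near the origin only if each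
[Q_j r_j^2] does: contracting it with the radial field and the [j]-th rotation
field gives the radial derivative of [Q_j r_j^2] ([omega_form_eq0]). The first
condition then reads [psi_j^2 = lambda q_j(x)], and the second one reads
[lambda q_j(- |Psi|^2) psi_j^2 = 1]; together they are the stated equations,
first at the points [x] with positive coordinates, then, both sides being
analytic, near the origin ([orthant_identity], [duality_equations]).

Conversely the equations say that [x |-> (- lambda q_j(x) x_j)_j] is an involution
near the origin. Hence the maps with factors [sqrt (lambda q_j(x))] and
[sqrt (lambda q_j(- x))] are inverse to each other, and the comparison of forms
read backwards shows that the first one is a duality ([special_duality_exists]).

Uniqueness and rotation invariance concern all of the connected domain [U], not
only a neighbourhood of the origin. The identity theorem extends the formula for
[psi_j^2] to [U] in the form [psi_j^2 |z_j|^2 = lambda g_j], where [g_j] is half the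
radial derivative of the potential in the [j]-th variable and depends only on the
moduli ([special_factor_moment], [moment_invariant]). Since [Psi] is a
diffeomorphism, [psi_j] has no zero ([special_factor_neq0]); its sign is constant.

The dual potential is identified without any uniqueness of expansions in
[z, conj z]: as [(z, - conj z) = i (- i z, conj (- i z))], the substitution acts on
the part of degree [k] as [i ^ k] ([local_dual_near0]).

The analytic tools come from one lemma on unconditional sums, [has_sum_regroup],
which collects the terms of an absolutely summable family. It gives products and
substitution of power series; expanding [f (a + h + k)] in [h] and [k] then gives
derivatives of all orders, and the segment argument of
[real_analytic_segment_zero] gives the identity theorem. *)

(** * Unconditional sums *)

Section HasSum.
Context {R : realType}.
Implicit Types I J : choiceType.

Definition abs_bounded I (a : I -> R) (N : R) :=
  forall A : {fset I}, \sum_(i <- A) `|a i| <= N.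

Lemma sum_fset_sub_le I (f : I -> R) (A B : {fset I}) :
  (forall i, 0 <= f i) -> (A `<=` B)%fset ->
  \sum_(i <- A) f i <= \sum_(i <- B) f i.
Proof.
move=> f0 AB; rewrite [leRHS](big_fsetID _ (mem A)) /=.
rewrite (_ : [fset x in B | x \in A]%fset = A); last first.
  by apply/fsetP => i; rewrite !inE /= andbC; apply: andb_idr => /(fsubsetP AB).
by rewrite lerDl sumr_ge0.
Qed.

Lemma abs_bounded_ge0 I (a : I -> R) N : abs_bounded a N -> 0 <= N.
Proof. by move=> /(_ fset0); rewrite big_nil. Qed.

Lemma abs_bounded_le I (a b : I -> R) N :
  (forall i, `|b i| <= `|a i|) -> abs_bounded a N -> abs_bounded b N.
Proof. by move=> ba aN A; apply: le_trans (aN A); apply: ler_sum. Qed.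

Lemma abs_boundedD I (a b : I -> R) N N' :
  abs_bounded a N -> abs_bounded b N' -> abs_bounded (fun i => a i + b i) (N + N').
Proof.
move=> aN bN A; apply: le_trans (lerD (aN A) (bN A)).
by rewrite -big_split; apply: ler_sum => i _; apply: ler_normD.
Qed.

Lemma has_sum_unique I (a : I -> R) l l' : has_sum a l -> has_sum a l' -> l = l'.
Proof.
move=> h h'; apply/eqP; rewrite -subr_eq0 -normr_le0; apply/ler_addgt0Pl => e e0.
have e20 : 0 < e / 2 by rewrite divr_gt0.
have [A hA] := h _ e20; have [A' hA'] := h' _ e20.
have := hA (A `|` A')%fset (fsubsetUl _ _).
have := hA' (A `|` A')%fset (fsubsetUr _ _).
set s := \sum_(i <- _) _ => H1 H2; rewrite addr0.
rewrite (_ : l - l' = (s - l') - (s - l)); last by ring.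
by rewrite (le_trans (ler_normB _ _))// [leRHS]splitr lerD// ltW.
Qed.

Lemma eq_has_sum I (a b : I -> R) l : a =1 b -> has_sum a l -> has_sum b l.
Proof. by move=> /funext ->. Qed.

Lemma has_sumD I (a b : I -> R) l l' :
  has_sum a l -> has_sum b l' -> has_sum (fun i => a i + b i) (l + l').
Proof.
move=> ha hb e e0; have e20 : 0 < e / 2 by rewrite divr_gt0.
have [A hA] := ha _ e20; have [B hB] := hb _ e20.
exists (A `|` B)%fset => C; rewrite fsubUset => /andP[AC BC].
rewrite big_split /= opprD addrACA (le_lt_trans (ler_normD _ _))//.
by rewrite [ltRHS]splitr ltrD// ?hA ?hB.
Qed.

Lemma has_sum0 I : has_sum (fun _ : I => 0 : R) 0.
Proof. by move=> e e0; exists fset0 => B _; rewrite big1// subrr normr0. Qed.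

Lemma has_sumZ I (a : I -> R) l c : has_sum a l -> has_sum (fun i => c * a i) (c * l).
Proof.
move=> ha e e0; have d0 : 0 < e / (`|c| + 1) by rewrite divr_gt0// ltr_wpDl.
have [A hA] := ha _ d0; exists A => B AB.
rewrite -mulr_sumr -mulrBr normrM.
have := hA B AB; rewrite ltr_pdivlMr ?ltr_wpDl// => /(le_lt_trans _); apply.
by rewrite mulrC ler_wpM2l// lerDl.
Qed.

Lemma has_sumN I (a : I -> R) l : has_sum a l -> has_sum (fun i => - a i) (- l).
Proof.
by move=> /(has_sumZ (-1)); rewrite mulN1r; apply: eq_has_sum => i; rewrite mulN1r.
Qed.

Lemma has_sumB I (a b : I -> R) l l' :
  has_sum a l -> has_sum b l' -> has_sum (fun i => a i - b i) (l - l').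
Proof. by move=> ha hb; apply: has_sumD => //; apply: has_sumN. Qed.

Lemma has_sum_finite I (a : I -> R) (A : {fset I}) :
  (forall i, i \notin A -> a i = 0) -> has_sum a (\sum_(i <- A) a i).
Proof.
move=> aA e e0; exists A => B AB.
by rewrite -(big_fset_incl _ AB) ?subrr ?normr0// => i _; apply: aA.
Qed.

Lemma has_sum_single I (a : I -> R) i0 :
  (forall i, i != i0 -> a i = 0) -> has_sum a (a i0).
Proof.
move=> ai; have := @has_sum_finite _ a [fset i0]%fset; rewrite big_seq_fset1.
by apply => i; rewrite inE; apply: ai.
Qed.

Lemma has_sum_norm_le I (a : I -> R) l N : abs_bounded a N -> has_sum a l -> `|l| <= N.
Proof.
move=> aN ha; apply/ler_addgt0Pl => e e0; have [A /(_ A (fsubset_refl _)) hA] := ha _ e0.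
rewrite -(subKr (\sum_(i <- A) a i) l) (le_trans (ler_normB _ _))// addrC lerD//.
  exact: ltW.
by apply: le_trans (aN A); apply: ler_norm_sum.
Qed.

Lemma has_sum_ge0_bound I (a : I -> R) l : (forall i, 0 <= a i) -> has_sum a l ->
  abs_bounded a l.
Proof.
move=> a0 ha A; under eq_bigr => i _ do rewrite ger0_norm//.
apply/ler_addgt0Pl => e e0; have [B /(_ (A `|` B)%fset (fsubsetUr _ _)) hB] := ha _ e0.
apply: (le_trans (sum_fset_sub_le a0 (fsubsetUl A B))).
by rewrite -lerBlDr (le_trans (ler_norm _))// ltW.
Qed.

(** Completeness enters here: the positive and the negative parts have sums, namely
the suprema of their finite partial sums. *)
Lemma abs_bounded_has_sum I (a : I -> R) N : abs_bounded a N -> exists l, has_sum a l.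
Proof.
suff pos (b : I -> R) M : (forall i, 0 <= b i) -> abs_bounded b M -> exists l, has_sum b l.
  move=> aN.
  have p0 i : 0 <= Num.max (a i) 0 by rewrite le_max lexx orbT.
  have n0 i : 0 <= Num.max (- a i) 0 by rewrite le_max lexx orbT.
  have le_p i : `|Num.max (a i) 0| <= `|a i|.
    by rewrite ger0_norm// ge_max normr_ge0 ler_norm.
  have le_n i : `|Num.max (- a i) 0| <= `|a i|.
    by rewrite ger0_norm// ge_max normr_ge0 -normrN ler_norm.
  have [p hp] := pos _ N p0 (abs_bounded_le le_p aN).
  have [q hq] := pos _ N n0 (abs_bounded_le le_n aN).
  exists (p - q); apply: eq_has_sum (has_sumB hp hq) => i /=.
  have [a0|a0] := leP 0 (a i).
    by rewrite (max_idPr _) ?subr0// oppr_le0.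
  by rewrite (max_idPl _) ?sub0r ?opprK// oppr_ge0 ltW.
move=> b0 bM.
pose S := [set s | exists A : {fset I}, s = \sum_(i <- A) b i].
have bE A : \sum_(i <- A) b i = \sum_(i <- A) `|b i|.
  by apply: eq_bigr => i _; rewrite ger0_norm.
have hS : has_sup S.
  split; first by exists 0; exists fset0; rewrite big_nil.
  by exists M => _ [A ->]; rewrite bE.
exists (sup S) => e e0.
have [_ [A ->] hA] := sup_adherent e0 hS.
exists A => B AB; rewrite distrC ger0_norm; last first.
  by rewrite subr_ge0; apply: sup_ubound; [case: hS | exists B].
by rewrite ltrBlDr -ltrBlDl (lt_le_trans hA)// sum_fset_sub_le.
Qed.

(** Unconditional convergence is absolute: the finite sums that avoid a suitable
finite set are bounded by 2, in particular those over terms of one sign. *)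
Lemma has_sum_abs_bounded I (a : I -> R) l : has_sum a l -> exists N, abs_bounded a N.
Proof.
move=> ha; have [A hA] := ha _ (@ltr01 R).
have bd (C : {fset I}) : [disjoint C & A]%fset -> `|\sum_(i <- C) a i| <= 2.
  move=> dCA; have h1 := hA A (fsubset_refl _); have h2 := hA _ (fsubsetUr C A).
  have E : \sum_(i <- C) a i = (\sum_(i <- (C `|` A)%fset) a i - l) - (\sum_(i <- A) a i - l).
    rewrite (big_fsetID _ (mem A) (C `|` A)%fset) /=.
    rewrite (_ : [fset x in C `|` A | x \in A]%fset = A); last first.
      by apply/fsetP => i; rewrite !inE /=; case: (i \in A); rewrite ?andbT ?andbF ?orbT.
    rewrite (_ : [fset x in C `|` A | x \notin A]%fset = C); first by ring.
    apply/fsetP => i; rewrite !inE /=; case: (boolP (i \in A)) => iA; rewrite ?andbT ?andbF ?orbF//.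
    apply/esym; apply/negbTE/negP => iC.
    by move/fdisjointP: dCA => /(_ i iC); rewrite iA.
  rewrite E (le_trans (ler_normB _ _))// (_ : 2 = 1 + 1 :> R)// lerD// ltW//.
exists (\sum_(i <- A) `|a i| + 4) => C.
rewrite (big_fsetID _ (mem A)) /= lerD//.
  by apply: sum_fset_sub_le => //; apply/fsubsetP => i; rewrite !inE => /andP[].
set D := [fset x in C | x \notin A]%fset.
rewrite (big_fsetID _ (fun i => 0 <= a i) D) /= (_ : 4 = 2 + 2 :> R); last by ring.
have dis (E : {fset I}) : (E `<=` D)%fset -> [disjoint E & A]%fset.
  by move=> /fsubsetP ED; apply/fdisjointP => i /ED; rewrite !inE => /andP[].
apply: lerD.
  set E := [fset x in D | _]%fset.
  have -> : \sum_(i <- E) `|a i| = \sum_(i <- E) a i.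
    by apply: eq_fbigr => i; rewrite !inE => /andP[_ ai] _; rewrite ger0_norm.
  apply: le_trans (ler_norm _) (bd _ _); apply: dis.
  by apply/fsubsetP => i; rewrite !inE => /andP[].
set E := [fset x in D | _]%fset.
have -> : \sum_(i <- E) `|a i| = - \sum_(i <- E) a i.
  rewrite -sumrN; apply: eq_fbigr => i; rewrite !inE -ltNge => /andP[_ ai] _.
  by rewrite ltr0_norm.

apply: le_trans (ler_norm _) _; rewrite normrN; apply: bd; apply: dis.
by apply/fsubsetP => i; rewrite !inE => /andP[].
Qed.

Lemma has_sum_bij I J (g : I -> J) (g' : J -> I) (a : J -> R) l :
  cancel g g' -> cancel g' g -> has_sum a l -> has_sum (a \o g) l.
Proof.
move=> gK g'K ha e e0; have [A hA] := ha e e0.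
exists [fset g' j | j in A]%fset => B AB.
have -> : \sum_(i <- B) (a \o g) i = \sum_(j <- [fset g i | i in B]%fset) a j.
  by rewrite big_imfset //= => x y _ _; apply: (can_inj gK).
apply: hA; apply/fsubsetP => j jA; rewrite -[j]g'K in_imfset//=.
by apply: (fsubsetP AB); rewrite in_imfset.
Qed.

Definition fset_prod I J (A : {fset I}) (C : {fset J}) : {fset I * J} :=
  [fset ((i, j) : I * J) | i in A, j in C]%fset.

Lemma mem_fset_prod I J (A : {fset I}) (C : {fset J}) p :
  (p \in fset_prod A C) = (p.1 \in A) && (p.2 \in C).
Proof.
apply/imfset2P/andP => [[i iA [j jC ->]]|[pA pC]]; first by [].
by exists p.1 => //; exists p.2 => //; case: p {pA pC}.
Qed.

Lemma sum_fset_prod I J (A : {fset I}) (C : {fset J}) (f : I * J -> R) :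
  \sum_(p <- fset_prod A C) f p = \sum_(i <- A) \sum_(j <- C) f (i, j).
Proof. by rewrite big_imfset2 //= => -[x y] [x' y'] _ _ /= [-> ->]. Qed.

Lemma fset_prod_sup I J (B : {fset I * J}) :
  (B `<=` fset_prod [fset p.1 | p in B] [fset p.2 | p in B])%fset.
Proof.
by apply/fsubsetP => p pB; rewrite mem_fset_prod !in_imfset.
Qed.

Lemma abs_bounded_prod I J (f : I * J -> R) N :
  (forall (A : {fset I}) (C : {fset J}),
     \sum_(i <- A) \sum_(j <- C) `|f (i, j)| <= N) -> abs_bounded f N.
Proof.
move=> fN B; apply: le_trans (fN [fset p.1 | p in B]%fset [fset p.2 | p in B]%fset).
rewrite -(sum_fset_prod _ _ (fun p => `|f p|)).
by apply: sum_fset_sub_le => //; apply: fset_prod_sup.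
Qed.

(** Finitely many rows can be approximated simultaneously by one finite set of
columns, so summing by rows never leaves the neighbourhood of the total. *)
Lemma has_sum_rows I J (f : I * J -> R) (g : I -> R) l :
  has_sum f l -> (forall i, has_sum (fun j => f (i, j)) (g i)) -> has_sum g l.
Proof.
move=> hf hg e e0; have e20 : 0 < e / 2 by rewrite divr_gt0.
have [A hA] := hf _ e20; exists [fset p.1 | p in A]%fset => B AB.
pose d := e / 2 / ((size (B : seq I))%:R + 1).
have n0 : 0 < (size (B : seq I))%:R + 1 :> R by rewrite ltr_wpDl.
have d0 : 0 < d by rewrite divr_gt0.
have [c hc] : {c : I -> {fset J} & forall i (C : {fset J}), (c i `<=` C)%fset ->
    `|\sum_(j <- C) f (i, j) - g i| < d}.
  exists (fun i => projT1 (cid (hg i d d0))) => i.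
  exact: (projT2 (cid (hg i d d0))).
pose C := ([fset p.2 | p in A] `|` \bigcup_(i <- B) c i)%fset.
have cC i : i \in B -> (c i `<=` C)%fset.
  by move=> iB; apply: fsubset_trans (bigfcup_sup _ iB isT) (fsubsetUr _ _).
have AP : (A `<=` fset_prod B C)%fset.
  apply/fsubsetP => p pA; rewrite mem_fset_prod; apply/andP; split.
    by apply: (fsubsetP AB); rewrite in_imfset.
  by rewrite inE in_imfset.
have := hA _ AP; rewrite sum_fset_prod => h1.
rewrite (_ : _ - l = \sum_(i <- B) (g i - \sum_(j <- C) f (i, j)) +
   (\sum_(i <- B) \sum_(j <- C) f (i, j) - l)); last first.
  by rewrite sumrB; ring.
rewrite (le_lt_trans (ler_normD _ _))// [ltRHS]splitr ler_ltD//.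
rewrite (le_trans (ler_norm_sum _ _ _))//.
apply: (@le_trans _ _ (\sum_(i <- B) d)).
  rewrite big_seq [leRHS]big_seq; apply: ler_sum => i iB.
  by rewrite distrC ltW// hc// cC.
have -> : e / 2 = d * ((size (B : seq I))%:R + 1) by rewrite divfK// lt0r_neq0.
rewrite big_const_seq count_predT iter_addr_0 -[d *+ _]mulr_natr.
by apply: ler_wpM2l; rewrite ?(ltW d0)// lerDl.
Qed.

Lemma has_sum_cols I J (f : I * J -> R) (g : J -> R) l :
  has_sum f l -> (forall j, has_sum (fun i => f (i, j)) (g j)) -> has_sum g l.
Proof.
move=> hf; apply: (@has_sum_rows _ _ (fun p : J * I => f (p.2, p.1))).
exact: (@has_sum_bij _ _ (fun p : J * I => (p.2, p.1)) (fun p : I * J => (p.2, p.1)) f l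
  (fun p => let: (x, y) := p in erefl) (fun p => let: (x, y) := p in erefl) hf).
Qed.

(** Collecting the terms of a family along a map [k] of its indices. The point is
uniformity: the collected coefficients do not depend on the multiplier [w], so
that one lemma yields Cauchy products, substitution of power series into power
series, and the splitting of a power series by degree. *)
Lemma has_sum_regroup I J (k : I -> J) (a : I -> R) (W : J -> R) (N : R) :
  (forall j, 0 < W j) -> abs_bounded (fun i => a i * W (k i)) N ->
  exists D : J -> R,
    [/\ forall j, has_sum (fun i => if k i == j then a i else 0) (D j),
        abs_bounded (fun j => D j * W j) N &
        forall (w : J -> R) l, (forall j, `|w j| <= W j) ->
          has_sum (fun i => a i * w (k i)) l <-> has_sum (fun j => D j * w j) l].
Proof.
move=> W0 aN.
have /choice[D hD] : forall j, exists d, has_sum (fun i => if k i == j then a i else 0) d.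
  move=> j; apply: (@abs_bounded_has_sum _ _ (N / W j)) => A.
  rewrite ler_pdivlMr// mulr_suml; apply: le_trans (aN A); apply: ler_sum => i _.
  case: eqP => [<-|_]; first by rewrite normrM (gtr0_norm (W0 _)).
  by rewrite normr0 mul0r.
have key (w : J -> R) : (forall j, `|w j| <= W j) -> exists l, [/\ `|l| <= N,
    has_sum (fun i => a i * w (k i)) l & has_sum (fun j => D j * w j) l].
  move=> wW; pose F (p : I * J) := if k p.1 == p.2 then a p.1 * w p.2 else 0.
  have FN : abs_bounded F N.
    apply: abs_bounded_prod => A C; apply: le_trans (aN A); apply: ler_sum => i _.
    have [kC|kC] := boolP (k i \in C); last first.
      rewrite big_seq big1// => j jC; rewrite /F /=; case: eqP => [E|_]; last by rewrite normr0.
      by rewrite E jC in kC.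
    rewrite (big_fsetD1 (k i))//= big_seq big1 ?addr0 => [|j].
      by rewrite /F /= eqxx !normrM ler_wpM2l// (gtr0_norm (W0 _)).
    by rewrite !inE /F /= eq_sym => /andP[/negbTE -> _]; rewrite normr0.
  have [l hl] := abs_bounded_has_sum FN.
  exists l; split; first exact: has_sum_norm_le hl.
    apply: has_sum_rows hl _ => i.
    have <- : F (i, k i) = a i * w (k i) by rewrite /F /= eqxx.
    apply: (has_sum_single (a := fun j => F (i, j))).
    by move=> j; rewrite /F /= eq_sym => /negbTE ->.
  apply: has_sum_cols hl _ => j; rewrite mulrC.
  apply: eq_has_sum (has_sumZ (w j) (hD j)) => i; rewrite /F /=.
  by case: eqP => _; rewrite ?mulr0// mulrC.
exists D; split => //.
  (* The multiplier [sg (D j) * W j] turns the collected sum into the norm. *)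
  have wW j : `|Num.sg (D j) * W j| <= W j.
    rewrite normrM (gtr0_norm (W0 j))//; apply: ler_piMl; first exact: ltW.
    by rewrite normr_sg lern1 leq_b1.
  have [l [lN _ hl]] := key _ wW.
  have DE j : D j * (Num.sg (D j) * W j) = `|D j * W j|.
    by rewrite mulrA [D j * _]mulrC -normrEsg normrM (gtr0_norm (W0 j)).
  move=> A; apply: le_trans (lN); apply: le_trans (ler_norm _).
  have := @has_sum_ge0_bound _ (fun j => `|D j * W j|) l (fun j => normr_ge0 _).
  move=> /(_ (eq_has_sum DE hl) A); congr (_ <= _).
  by apply: eq_bigr => j _; rewrite normr_id.
move=> w l wW; have [l' [_ h1 h2]] := key w wW.
split => h; first by rewrite (has_sum_unique h h1).
by rewrite (has_sum_unique h h2).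
Qed.

End HasSum.

(** * Power series in finitely many variables *)

Section HasSumMul.
Context {R : realType}.
Implicit Types I J : choiceType.

Lemma abs_bounded_mul I J (a : I -> R) (b : J -> R) N N' :
  abs_bounded a N -> abs_bounded b N' ->
  abs_bounded (fun p : I * J => a p.1 * b p.2) (N * N').
Proof.
move=> aN bN; apply: abs_bounded_prod => A C /=.
rewrite (eq_bigr (fun i => `|a i| * \sum_(j <- C) `|b j|)) => [|i _]; last first.
  by rewrite mulr_sumr; apply: eq_bigr => j _; rewrite normrM.
by rewrite -mulr_suml ler_pM ?sumr_ge0.
Qed.

Lemma has_sum_mul I J (a : I -> R) (b : J -> R) l l' : has_sum a l -> has_sum b l' ->
  has_sum (fun p : I * J => a p.1 * b p.2) (l * l').
Proof.
move=> ha hb; have [N aN] := has_sum_abs_bounded ha.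
have [N' bN'] := has_sum_abs_bounded hb.
have [m hm] := abs_bounded_has_sum (abs_bounded_mul aN bN').
have h1 : has_sum (fun i => l' * a i) m.
  by apply: has_sum_rows hm _ => i /=; rewrite mulrC; apply: has_sumZ.
by rewrite mulrC -(has_sum_unique h1 (has_sumZ l' ha)).
Qed.

End HasSumMul.

Section PowerSeries.
Context {R : realType}.
Implicit Types (T S : finType) (r N : R).

Definition mono T (h : T -> R) (q : {ffun T -> nat}) : R := \prod_t h t ^+ q t.
Definition deg T (q : {ffun T -> nat}) : nat := (\sum_t q t)%N.
Definition add_exponent T (p q : {ffun T -> nat}) := [ffun t => (p t + q t)%N].

Lemma mono_add_exponent T (h : T -> R) p q : mono h (add_exponent p q) = mono h p * mono h q.
Proof. by rewrite /mono -big_split; apply: eq_bigr => t _; rewrite ffunE exprD. Qed.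

Lemma deg_add_exponent T (p q : {ffun T -> nat}) : deg (add_exponent p q) = (deg p + deg q)%N.
Proof. by rewrite /deg -big_split; apply: eq_bigr => t _; rewrite ffunE. Qed.

Lemma mono_mul T (h k : T -> R) q : mono (fun t => h t * k t) q = mono h q * mono k q.
Proof. by rewrite /mono -big_split; apply: eq_bigr => t _; rewrite exprMn. Qed.

Lemma mono_cst T (r : R) (q : {ffun T -> nat}) : mono (fun=> r) q = r ^+ deg q.
Proof. by rewrite /mono /deg expr_sum. Qed.

Lemma mono_norm T (h : T -> R) q : `|mono h q| = mono (fun t => `|h t|) q.
Proof. by rewrite /mono normr_prod; apply: eq_bigr => t _; rewrite normrX. Qed.

Lemma mono_norm_le T (h k : T -> R) q : (forall t, `|h t| <= k t) -> `|mono h q| <= mono k q.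
Proof.
move=> hk; rewrite mono_norm; apply: ler_prod => t _.
by rewrite exprn_ge0//= lerXn2r// nnegrE// (le_trans _ (hk t)).
Qed.

Lemma mono_le T (h : T -> R) r q : (forall t, `|h t| <= r) -> `|mono h q| <= r ^+ deg q.
Proof. by move=> hr; rewrite -mono_cst; apply: mono_norm_le. Qed.

(** The function [g] of [T]-indexed variables is the sum, on the closed polydisc
of radius [r], of a power series of norm [\sum_q |d q| r ^ |q|] at most [N]. For
fixed [r] these norms are submultiplicative, which is all that substitution needs. *)
Definition power_series T r N (g : (T -> R) -> R) :=
  exists d : {ffun T -> nat} -> R,
    abs_bounded (fun q => d q * r ^+ deg q) N /\
    forall h, (forall t, `|h t| <= r) -> has_sum (fun q => d q * mono h q) (g h).

Lemma power_series_ext T r N (f g : (T -> R) -> R) :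
  (forall h, (forall t, `|h t| <= r) -> f h = g h) -> power_series r N f -> power_series r N g.
Proof.
by move=> fg [d [dN hd]]; exists d; split => // h hr; rewrite -fg//; apply: hd.
Qed.

Lemma power_series_le T r N r' N' (g : (T -> R) -> R) :
  0 <= r' -> r' <= r -> N <= N' -> power_series r N g -> power_series r' N' g.
Proof.
move=> r0 rr NN [d [dN hd]]; exists d; split.
  move=> A; apply: le_trans NN; move: A; apply: abs_bounded_le dN => q.
  by rewrite !normrM ler_wpM2l// !normrX !ger0_norm ?lerXn2r// ?nnegrE// (le_trans r0).
by move=> h hr; apply: hd => t; apply: le_trans rr.
Qed.

Lemma mono0 T q : mono (fun _ : T => 0 : R) q = (q == [ffun=> 0%N])%:R.
Proof.
rewrite mono_cst; case: eqP => [->|q0].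
  by rewrite /deg big1 ?expr0// => t _; rewrite ffunE.
have [t qt] : exists t, q t != 0%N.
  apply/existsP; rewrite -[X in is_true X]negbK negb_exists; apply/negP => /forallP h.
  by apply: q0; apply/ffunP => t; rewrite ffunE; apply/eqP; have := h t; rewrite negbK.
by rewrite /deg (bigD1 t)//= expr0n addn_eq0 (negbTE qt).
Qed.

Lemma mono_zeroq T (h : T -> R) : mono h [ffun=> 0%N] = 1.
Proof. by rewrite /mono big1// => t _; rewrite ffunE expr0. Qed.

Lemma deg0_eq T (q : {ffun T -> nat}) : (deg q == 0)%N = (q == [ffun=> 0%N]).
Proof.
apply/idP/eqP => [|->]; last by rewrite /deg big1// => t _; rewrite ffunE.
rewrite /deg sum_nat_eq0 => /forallP h; apply/ffunP => t; rewrite ffunE.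
by apply/eqP; apply: (implyP (h t)).
Qed.

(** Without constant term every monomial contributes at least one factor [s]. *)
Lemma power_series_shrink T r N (g : (T -> R) -> R) (s : R) :
  0 < s -> s <= 1 -> 0 <= r -> power_series r N g -> g (fun=> 0) = 0 ->
  power_series (s * r) (s * N) g.
Proof.
move=> s0 s1 r0 [d [dN hd]] g0; exists d; split; last first.
  by move=> h hr; apply: hd => t; apply: le_trans (hr t) _; rewrite ler_piMl.
have d0 : d [ffun=> 0%N] = 0.
  have : has_sum (fun q => d q * mono (fun=> 0) q) (g (fun=> 0)).
    by apply: hd => t; rewrite normr0.
  have : has_sum (fun q => d q * mono (fun=> 0) q) (d [ffun=> 0%N] * mono (fun _ : T => 0) [ffun=> 0%N]).
    apply: (@has_sum_single _ _ (fun q => d q * mono (fun=> 0) q)).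
    by move=> q /negbTE q0; rewrite mono0 q0 mulr0.
  by rewrite mono0 eqxx mulr1 => h1 h2; rewrite (has_sum_unique h1 h2).
move=> A; apply: le_trans (ler_wpM2l (ltW s0) (dN A)); rewrite mulr_sumr.
apply: ler_sum => q _; have [/eqP q0|q0] := boolP (deg q == 0)%N.
  by move/eqP: q0; rewrite deg0_eq => /eqP ->; rewrite d0 !mul0r normr0 mulr0.
rewrite exprMn !normrM !normrX (ger0_norm r0) (gtr0_norm s0).
rewrite mulrCA; apply: ler_wpM2r; first by rewrite mulr_ge0 ?exprn_ge0.
rewrite -[leRHS](expr1 s); apply: ler_wiXn2l => //; first exact: ltW.
by rewrite lt0n.
Qed.

Lemma power_series_const T r (c : R) : power_series r `|c| (fun _ : T -> R => c).
Proof.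
exists (fun q => c * (q == [ffun=> 0%N])%:R); split.
  move=> A; have h : has_sum (fun q : {ffun T -> nat} =>
      `|c * (q == [ffun=> 0%N])%:R * r ^+ deg q|) `|c|.
    have := @has_sum_single R _ (fun q : {ffun T -> nat} =>
      `|c * (q == [ffun=> 0%N])%:R * r ^+ deg q|) [ffun=> 0%N].
    rewrite eqxx mulr1 (eqP (_ : deg _ == 0)%N) ?deg0_eq// expr0 mulr1; apply.
    by move=> q /negbTE ->; rewrite mulr0 mul0r normr0.
  have := has_sum_ge0_bound (fun=> normr_ge0 _) h A.
  by congr (_ <= _); apply: eq_bigr => q _; rewrite normr_id.
move=> h _.
have := @has_sum_single R _ (fun q : {ffun T -> nat} =>
      c * (q == [ffun=> 0%N])%:R * mono h q) [ffun=> 0%N].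
rewrite eqxx mono_zeroq !mulr1.
by apply => q /negbTE ->; rewrite mulr0 mul0r.
Qed.

(** The exponent of the monomial that consists of the single variable [t]. *)
Definition unit_exponent T (t : T) : {ffun T -> nat} := [ffun t' => nat_of_bool (t' == t)].

Lemma deg_unit_exponent T (t : T) : deg (unit_exponent t) = 1%N.
Proof.
rewrite /deg (bigD1 t)//= ffunE eqxx big1 ?addn0// => t' /negbTE.
by rewrite ffunE => ->.
Qed.

Lemma mono_unit_exponent T (h : T -> R) t : mono h (unit_exponent t) = h t.
Proof.
rewrite /mono (bigD1 t)//= ffunE eqxx expr1 big1 ?mulr1// => t' /negbTE.
by rewrite ffunE => ->.
Qed.

Lemma power_series_var T r (t : T) : 0 <= r -> power_series r r (fun h => h t).
Proof.
move=> r0; exists (fun q => (q == unit_exponent t)%:R); split.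
  move=> A; have h : has_sum (fun q : {ffun T -> nat} =>
      `|(q == unit_exponent t)%:R * r ^+ deg q|) r.
    have := @has_sum_single R _ (fun q : {ffun T -> nat} =>
      `|(q == unit_exponent t)%:R * r ^+ deg q|) (unit_exponent t).
    rewrite eqxx mul1r deg_unit_exponent expr1 ger0_norm//; apply.
    by move=> q /negbTE ->; rewrite mul0r normr0.
  have := has_sum_ge0_bound (fun=> normr_ge0 _) h A.
  by congr (_ <= _); apply: eq_bigr => q _; rewrite normr_id.
move=> h _.
have := @has_sum_single R _ (fun q : {ffun T -> nat} =>
      (q == unit_exponent t)%:R * mono h q) (unit_exponent t).
by rewrite eqxx mul1r mono_unit_exponent; apply => q /negbTE ->; rewrite mul0r.
Qed.

Lemma power_seriesD T r N N' (f g : (T -> R) -> R) :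
  power_series r N f -> power_series r N' g -> power_series r (N + N') (fun h => f h + g h).
Proof.
move=> [d [dN hd]] [e [eN he]]; exists (fun q => d q + e q); split.
  by apply: abs_bounded_le (abs_boundedD dN eN) => q; rewrite mulrDl.
move=> h hr; apply: eq_has_sum (has_sumD (hd h hr) (he h hr)) => q.
by rewrite mulrDl.
Qed.

Lemma power_seriesM T r N N' (f g : (T -> R) -> R) : 0 < r ->
  power_series r N f -> power_series r N' g -> power_series r (N * N') (fun h => f h * g h).
Proof.
move=> r0 [d [dN hd]] [e [eN he]].
have W0 (q : {ffun T -> nat}) : 0 < r ^+ deg q by rewrite exprn_gt0.
have B : abs_bounded (fun p : {ffun T -> nat} * {ffun T -> nat} =>
    (d p.1 * e p.2) * r ^+ deg (add_exponent p.1 p.2)) (N * N').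
  apply: abs_bounded_le (abs_bounded_mul dN eN) => -[p q] /=.
  by rewrite deg_add_exponent exprD mulrACA.
have [D [_ DN hD]] := has_sum_regroup W0 B.
exists D; split => // h hr; apply/hD.
  by move=> q; apply: mono_le.
apply: eq_has_sum (has_sum_mul (hd h hr) (he h hr)) => -[p q] /=.
by rewrite mono_add_exponent mulrACA.
Qed.

Lemma power_seriesX T r N (f : (T -> R) -> R) n : 0 < r ->
  power_series r N f -> power_series r (N ^+ n) (fun h => f h ^+ n).
Proof.
move=> r0 hf; elim: n => [|n IH].
  by have := power_series_const T r 1; rewrite normr1.
under eq_fun do rewrite exprS; rewrite exprS; exact: power_seriesM.
Qed.

Lemma power_series_prod T r (I : Type) (s : seq I) (N : I -> R) (f : I -> (T -> R) -> R) :
  0 < r -> (forall i, power_series r (N i) (f i)) ->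
  power_series r (\prod_(i <- s) N i) (fun h => \prod_(i <- s) f i h).
Proof.
move=> r0 hf; elim: s => [|i s IH].
  rewrite big_nil; apply: (@power_series_ext _ _ _ (fun=> 1)).
    by move=> h _; rewrite big_nil.
  by have := power_series_const T r 1; rewrite normr1.
rewrite big_cons; apply: power_series_ext (power_seriesM r0 (hf i) IH).
by move=> h _; rewrite big_cons.
Qed.

(** Substitution: the expansion of each monomial [g ^ p] has norm at most
[r' ^ |p|], so the double family obtained from [f] is absolutely summable and can
be collected by the monomials of the inner variables. *)
Lemma power_series_comp T S r r' N (f : (S -> R) -> R) (g : S -> (T -> R) -> R) :
  0 < r -> power_series r' N f -> (forall s, power_series r r' (g s)) ->
  power_series r N (fun h => f (fun s => g s h)).
Proof.
move=> r0 [c [cN hc]] hg.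
have hmono (p : {ffun S -> nat}) : power_series r (r' ^+ deg p) (fun h => mono (fun s => g s h) p).
  by rewrite -mono_cst; apply: power_series_prod => // s; apply: power_seriesX.
pose D p := projT1 (cid (hmono p)).
have DN p : abs_bounded (fun q => D p q * r ^+ deg q) (r' ^+ deg p).
  exact: (projT2 (cid (hmono p))).1.
have Dsum p : forall h, (forall t, `|h t| <= r) ->
    has_sum (fun q => D p q * mono h q) (mono (fun s => g s h) p).
  exact: (projT2 (cid (hmono p))).2.
have W0 (q : {ffun T -> nat}) : 0 < r ^+ deg q by rewrite exprn_gt0.
pose a (pq : {ffun S -> nat} * {ffun T -> nat}) := c pq.1 * D pq.1 pq.2.
have aN : abs_bounded (fun pq => a pq * r ^+ deg pq.2) N.
  apply: abs_bounded_prod => A C; apply: le_trans (cN A); apply: ler_sum => p _.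
  rewrite normrM; have r'p : 0 <= r' ^+ deg p by exact: abs_bounded_ge0 (DN p).
  rewrite [X in _ <= _ * X]ger0_norm//; apply: le_trans (ler_wpM2l (normr_ge0 _) (DN p C)).
  by rewrite mulr_sumr; apply: ler_sum => q _; rewrite /a /= -mulrA normrM.
have [E [_ EN hE]] := has_sum_regroup W0 aN.
exists E; split => // h hr.
have mW q : `|mono h q| <= r ^+ deg q by apply: mono_le.
have gr s : `|g s h| <= r'.
  have [d [dN hd]] := hg s.
  apply: has_sum_norm_le (hd h hr); apply: abs_bounded_le dN => q.
  by rewrite !normrM ler_wpM2l// (gtr0_norm (W0 _)).
have aN' : abs_bounded (fun pq => a pq * mono h pq.2) N.
  by apply: abs_bounded_le aN => pq; rewrite !normrM ler_wpM2l// (gtr0_norm (W0 _)).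
have [l hl] := abs_bounded_has_sum aN'.
suff h1 : has_sum (fun p => c p * mono (fun s => g s h) p) l.
  by rewrite (has_sum_unique (hc _ gr) h1); apply/hE.
apply: has_sum_rows hl _ => p; apply: eq_has_sum (has_sumZ (c p) (Dsum p h hr)) => q.
by rewrite /a /= mulrA.
Qed.

End PowerSeries.

Section FirstOrder.
Context {R : realType}.
Implicit Types (T A B : finType) (r N : R).

Lemma has_sum_sum (I : choiceType) T (a : T -> I -> R) (l : T -> R) :
  (forall t, has_sum (a t) (l t)) -> has_sum (fun i => \sum_t a t i) (\sum_t l t).
Proof.
move=> ha; elim: (index_enum T) => [|t s IH].
  by rewrite big_nil; apply: eq_has_sum (has_sum0 I) => i; rewrite big_nil.
by rewrite big_cons; apply: eq_has_sum (has_sumD (ha t) IH) => i; rewrite big_cons.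
Qed.

Lemma deg1_eq T (q : {ffun T -> nat}) : deg q = 1%N -> exists t, q = unit_exponent t.
Proof.
move=> /eqP /sum_nat_eq1[t [_ qt qt0]]; exists t; apply/ffunP => t'; rewrite ffunE.
by case: eqP => [->//|/eqP /qt0 ->].
Qed.

Lemma unit_exponent_inj T : injective (@unit_exponent T).
Proof.
by move=> s t /ffunP /(_ s); rewrite !ffunE eqxx; case: eqP.
Qed.

Lemma unit_exponent_neq0 T (t : T) : unit_exponent t <> [ffun=> 0%N].
Proof. by move=> /ffunP /(_ t); rewrite !ffunE eqxx. Qed.

Definition join_fun A B (h : A -> R) (k : B -> R) (x : A + B) : R :=
  match x with inl a => h a | inr b => k b end.
Definition left_exponent A B (q : {ffun A + B -> nat}) := [ffun a => q (inl a)].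
Definition right_exponent A B (q : {ffun A + B -> nat}) := [ffun b => q (inr b)].

Lemma mono_join_fun A B (h : A -> R) (k : B -> R) q :
  mono (join_fun h k) q = mono h (left_exponent q) * mono k (right_exponent q).
Proof.
by rewrite /mono big_sumType; congr (_ * _); apply: eq_bigr => t _; rewrite ffunE.
Qed.

Lemma deg_left_exponent_right_exponent A B (q : {ffun A + B -> nat}) :
  deg q = (deg (left_exponent q) + deg (right_exponent q))%N.
Proof.
by rewrite /deg big_sumType; congr (_ + _)%N; apply: eq_bigr => t _; rewrite ffunE.
Qed.

Lemma exp_le_scale r (s : R) n : 0 < r -> 0 <= s -> s <= r -> (2 <= n)%N ->
  s ^+ n <= r ^+ n * (s / r) ^+ 2.
Proof.
move=> r0 s0 sr n2; have -> : s ^+ n = r ^+ n * (s / r) ^+ n.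
  by rewrite -exprMn mulrC divfK// gt_eqF.
rewrite ler_wpM2l ?exprn_ge0 ?(ltW r0)// ler_wiXn2l ?divr_ge0 ?(ltW r0)//.
by rewrite ler_pdivrMr// mul1r.
Qed.

(** First order expansion in the variables indexed by [B], with an error that is
quadratic uniformly in the variables indexed by [A]. *)
Lemma power_series_expand A B r N (f : (A + B -> R) -> R) :
  0 < r -> power_series r N f ->
  exists F : B -> (A -> R) -> R,
    (forall b, power_series r (N / r) (F b)) /\
    forall h k s, (forall a, `|h a| <= r) -> (forall b, `|k b| <= s) -> s <= r -> 0 <= s ->
      `|f (join_fun h k) - f (join_fun h (fun=> 0)) - \sum_b k b * F b h| <= N * (s / r) ^+ 2.
Proof.
move=> r0 [d [dN hd]].
pose e b (q : {ffun A + B -> nat}) := if right_exponent q == unit_exponent b then d q else 0.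
pose F b h := xget 0 [set l | has_sum (fun q => e b q * mono h (left_exponent q)) l].
have W0 (q : {ffun A -> nat}) : 0 < r ^+ deg q by rewrite exprn_gt0.
have eN b : abs_bounded (fun q => e b q * r ^+ deg (left_exponent q)) (N / r).
  move=> S; rewrite ler_pdivlMr// mulr_suml; apply: le_trans (dN S).
  apply: ler_sum => q _; rewrite /e; case: eqP => [rq|_]; last by rewrite mul0r normr0 mul0r.
  rewrite deg_left_exponent_right_exponent rq deg_unit_exponent addn1 exprSr mulrA.
  by rewrite [leRHS]normrM (gtr0_norm r0).
have Fsum b h : (forall a, `|h a| <= r) -> has_sum (fun q => e b q * mono h (left_exponent q)) (F b h).
  move=> hr; have B1 : abs_bounded (fun q => e b q * mono h (left_exponent q)) (N / r).
    apply: abs_bounded_le (eN b) => q; rewrite !normrM ler_wpM2l// (gtr0_norm (W0 _)).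
    exact: mono_le.
  have [l hl] := abs_bounded_has_sum B1.
  by rewrite /F; case: xgetP => [l' _ //|/(_ l)].
exists F; split.
  move=> b; have [D [_ DN hD]] := has_sum_regroup W0 (eN b).
  exists D; split => // h hr; apply/hD; last exact: Fsum.
  by move=> q; apply: mono_le.
move=> h k s hr ks sr s0.
have jr (k' : B -> R) : (forall b, `|k' b| <= r) -> forall x, `|join_fun h k' x| <= r.
  by move=> kr [a|b] /=; auto.
have h1 := hd _ (jr k (fun b => le_trans (ks b) sr)).
have h2 : has_sum (fun q => d q * mono (join_fun h (fun=> 0)) q) (f (join_fun h (fun=> 0))).
  by apply: hd; apply: jr => b; rewrite normr0 ltW.
have h3 := has_sum_sum (fun b => has_sumZ (k b) (Fsum b h hr)).
apply: has_sum_norm_le (has_sumB (has_sumB h1 h2) h3) => S.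
apply: (@le_trans _ _ (\sum_(q <- S) `|d q * r ^+ deg q| * (s / r) ^+ 2)); last first.
  by rewrite -mulr_suml ler_wpM2r// exprn_ge0// divr_ge0// ltW.
apply: ler_sum => q _.
case: (leqP 2 (deg (right_exponent q))) => [q2|].
  rewrite [X in _ - X]big1 => [|b _]; last first.
    by rewrite /e; case: eqP => [E|_]; [rewrite E deg_unit_exponent in q2 | rewrite mul0r mulr0].
  rewrite !mono_join_fun mono0 -deg0_eq (gtn_eqF (ltnW q2)) !mulr0 !subr0.
  rewrite !normrM -mulrA ler_wpM2l// (gtr0_norm (_ : 0 < r ^+ deg q)) ?exprn_gt0//.
  rewrite deg_left_exponent_right_exponent exprD -mulrA ler_pM//; first exact: mono_le.
  by apply: le_trans (mono_le _ ks) _; apply: exp_le_scale.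
case E : (deg (right_exponent q)) => [|[|//]] _.
  have q0 : right_exponent q = [ffun=> 0%N] by apply/eqP; rewrite -deg0_eq E.
  rewrite [X in _ - X]big1 => [|b _]; last first.
    by rewrite /e q0; case: eqP => [/esym/unit_exponent_neq0//|_]; rewrite mul0r mulr0.
  rewrite !mono_join_fun q0 !mono_zeroq subr0 subrr normr0 mulr_ge0// exprn_ge0// divr_ge0//.
  exact: ltW.
have [b qb] := deg1_eq E.
rewrite (bigD1 b)//= big1 => [|b' b'b]; last first.
  rewrite /e qb; case: eqP => [/unit_exponent_inj bb|_]; last by rewrite mul0r mulr0.
  by rewrite bb eqxx in b'b.
rewrite /e qb eqxx !mono_join_fun mono0 qb mono_unit_exponent -deg0_eq deg_unit_exponent !mulr0 subr0 addr0.
rewrite (_ : _ - _ = 0); last by ring.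
by rewrite normr0 mulr_ge0// exprn_ge0// divr_ge0// ltW.
Qed.

(** The same expansion for a single variable, where the coefficients may
themselves be parametrised by the index type of a larger series. *)
Lemma has_sum_expand1 (I : choiceType) (k : I -> nat) (a : I -> R) r N (f : R -> R) f1 :
  0 < r -> abs_bounded (fun i => a i * r ^+ k i) N ->
  (forall s, `|s| <= r -> has_sum (fun i => a i * s ^+ k i) (f s)) ->
  has_sum (fun i => if k i == 1%N then a i else 0) f1 ->
  forall s, `|s| <= r -> `|f s - f 0 - s * f1| <= N * (`|s| / r) ^+ 2.
Proof.
move=> r0 aN fa hf1 s sr.
have h0 : has_sum (fun i => a i * 0 ^+ k i) (f 0) by apply: fa; rewrite normr0 ltW.
apply: has_sum_norm_le (has_sumB (has_sumB (fa s sr) h0) (has_sumZ s hf1)) => A.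
apply: (@le_trans _ _ (\sum_(q <- A) `|a q * r ^+ k q| * (`|s| / r) ^+ 2)); last first.
  by rewrite -mulr_suml ler_wpM2r// exprn_ge0// divr_ge0// ltW.
apply: ler_sum => i _; have p0 : 0 <= `|a i * r ^+ k i| * (`|s| / r) ^+ 2.
  by rewrite mulr_ge0// exprn_ge0// divr_ge0// ltW.
move: p0; case: (k i) => [|[|n]] /= p0.
- by rewrite !expr0 mulr0 subr0 subrr normr0.
- by rewrite !expr1 mulr0 subr0 mulrC subrr normr0.
rewrite expr0n !mulr0 !subr0 !(normrM (a i)) !normrX (gtr0_norm r0) -mulrA ler_wpM2l//.
by rewrite exp_le_scale.
Qed.

(** Divide by the lowest power that is present and let the argument tend to 0. *)
Lemma has_sum_exp_eq0 (a : nat -> R) r N :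
  0 < r -> abs_bounded (fun k => a k * r ^+ k) N ->
  (forall e, 0 < e -> exists s, [/\ s != 0, `|s| < e & has_sum (fun k => a k * s ^+ k) 0]) ->
  forall k, a k = 0.
Proof.
move=> r0 aN hz k; elim/ltn_ind: k => k IH.
apply/eqP; rewrite -normr_le0; apply/ler_addgt0Pl => e e0; rewrite addr0.
have N0 : 0 <= N by exact: abs_bounded_ge0 aN.
have rk0 : 0 < r ^+ k.+1 by rewrite exprn_gt0.
have e'0 : 0 < Num.min r (e * r ^+ k.+1 / (N + 1)).
  by rewrite lt_min r0 divr_gt0 ?mulr_gt0// ltr_wpDl.
have [s [s0 sm hs]] := hz _ e'0.
move: sm; rewrite lt_min => /andP[sr]; rewrite ltr_pdivlMr ?ltr_wpDl// => se.
have ns0 : 0 < `|s| by rewrite normr_gt0.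
pose b j := if j == k then a j * s ^+ j else 0.
have hb : has_sum b (a k * s ^+ k).
  rewrite (_ : a k * s ^+ k = b k); last by rewrite /b eqxx.
  by apply: has_sum_single => j; rewrite /b => /negbTE ->.
have := has_sum_norm_le (_ : abs_bounded _ (N * (`|s| / r) ^+ k.+1)) (has_sumB hs hb).
rewrite sub0r normrN normrM normrX => H.
have {H} : `|a k| * `|s| ^+ k <= N * (`|s| / r) ^+ k.+1.
  apply: H => A; apply: (@le_trans _ _ (\sum_(j <- A) `|a j * r ^+ j| * (`|s| / r) ^+ k.+1)); last first.
    by rewrite -mulr_suml ler_wpM2r// exprn_ge0// divr_ge0// ltW.
  apply: ler_sum => j _; rewrite /b; case: (ltngtP j k) => [jk|kj|->].
  - by rewrite IH// !mul0r subrr normr0 mul0r.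
  - rewrite subr0 !normrM !normrX (gtr0_norm r0) -mulrA ler_wpM2l//.
    have -> : `|s| ^+ j = r ^+ j * (`|s| / r) ^+ j.
      by rewrite -exprMn mulrC divfK// gt_eqF.
    rewrite ler_wpM2l ?exprn_ge0 ?(ltW r0)// ler_wiXn2l ?divr_ge0 ?(ltW r0)//.
    by rewrite ler_pdivrMr// mul1r ltW.
  - by rewrite subrr normr0 mulr_ge0// exprn_ge0// divr_ge0// ltW.
have sk0 : 0 < `|s| ^+ k by rewrite exprn_gt0.
rewrite (_ : N * _ = N * `|s| / r ^+ k.+1 * `|s| ^+ k); last first.
  by rewrite expr_div_n exprSr; ring.
rewrite ler_pM2r// ler_pdivlMr//.
move=> H; rewrite -(ler_pM2r rk0); apply: le_trans H _; apply: le_trans (ltW se).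
by rewrite mulrC ler_wpM2l// lerDl.
Qed.

End FirstOrder.

(** ** The binomial series of the square root *)

Section Sqrt.
Context {R : realType}.

Lemma mem_fset_iota n k : (k \in [fset i | i in iota 0 n]%fset) = (k < n)%N.
Proof.
apply/imfsetP/idP => [[i /= ii ->]|kn]; first by move: ii; rewrite mem_iota.
by exists k => //=; rewrite mem_iota.
Qed.

Lemma sum_fset_iota n (f : nat -> R) :
  \sum_(i <- [fset i | i in iota 0 n]%fset) f i = \sum_(i < n) f i.
Proof.
rewrite big_imfset//= undup_id ?iota_uniq//.
by rewrite -[n in iota 0 n]subn0 -/(index_iota 0 n) big_mkord.
Qed.

Fixpoint sqrt_coef (k : nat) : R :=
  if k is k'.+1 then sqrt_coef k' * (2^-1 - k'%:R) / k%:R else 1.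

Lemma sqrt_coefS k : sqrt_coef k.+1 * k.+1%:R = sqrt_coef k * (2^-1 - k%:R).
Proof. by rewrite /= divfK// pnatr_eq0. Qed.

Lemma sqrt_coef_le k : `|sqrt_coef k| <= 1.
Proof.
elim: k => [|k IH] /=; first by rewrite normr1.
rewrite !normrM normfV (ger0_norm (ler0n _ _)) ler_pdivrMr ?ltr0n// mul1r.
apply: le_trans (ler_piMl (normr_ge0 _) IH) _.
have k0 := ler0n R k; rewrite -[k.+1%:R]natr1 ler_norml; lra.
Qed.

Definition sqrt_square k : R := \sum_(i < k.+1) sqrt_coef i * sqrt_coef (k - i).

Lemma sqrt_square_weighted k :
  \sum_(i < k.+1) i%:R * (sqrt_coef i * sqrt_coef (k - i)) = 2^-1 * k%:R * sqrt_square k.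
Proof.
set T := LHS; suff : T + T = k%:R * sqrt_square k by move=> ?; lra.
rewrite {1}/T (reindex_inj rev_ord_inj) /= /T -big_split /= /sqrt_square mulr_sumr.
apply: eq_bigr => i _; rewrite subSS.
have ik : (i <= k)%N by rewrite -ltnS.
by rewrite subKn// [sqrt_coef (k - i) * _]mulrC -mulrDl -natrD subnK.
Qed.

(** The square has only its first two coefficients: up to the symmetry of the
convolution the recursion reads [(k + 1) c_(k+1) = (1 - k) c_k]. *)
Lemma sqrt_square_rec k : k.+1%:R * sqrt_square k.+1 = (1 - k%:R) * sqrt_square k.
Proof.
have -> : k.+1%:R * sqrt_square k.+1 =
    2 * \sum_(i < k.+2) i%:R * (sqrt_coef i * sqrt_coef (k.+1 - i)).
  by rewrite sqrt_square_weighted; field.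
rewrite big_ord_recl mul0r add0r.
rewrite (eq_bigr (fun i : 'I_k.+1 => 2^-1 * (sqrt_coef i * sqrt_coef (k - i))
   - i%:R * (sqrt_coef i * sqrt_coef (k - i)))) => [|i _]; last first.
  rewrite lift0 subSS mulrA [_ * sqrt_coef _.+1]mulrC sqrt_coefS; ring.
by rewrite sumrB -mulr_sumr sqrt_square_weighted -/(sqrt_square k); field.
Qed.

Lemma sqrt_squareE k : sqrt_square k = (k <= 1)%:R.
Proof.
elim: k => [|k IH]; first by rewrite /sqrt_square big_ord1 /= mulr1.
have := sqrt_square_rec k; rewrite IH => H.
have k0 : k.+1%:R != 0 :> R by rewrite pnatr_eq0.
apply: (mulfI k0); rewrite H; case: k {IH H k0} => [|[|k]] /=; first by rewrite subr0.
  by rewrite subrr mul0r mulr0.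
by rewrite !mulr0.
Qed.

Lemma geometric_bound : abs_bounded (fun k => sqrt_coef k * 2^-1 ^+ k) 2.
Proof.
have g n : \sum_(k < n) (2^-1 : R) ^+ k <= 2 - 2 * 2^-1 ^+ n.
  by elim: n => [|n IH]; [rewrite big_ord0 expr0; lra | rewrite big_ord_recr/= exprS; lra].
move=> A; pose n := (\max_(k <- A) k).+1.
apply: (@le_trans _ _ (\sum_(k <- A) 2^-1 ^+ k)).
  apply: ler_sum => k _; have W : 0 <= (2^-1 : R) ^+ k by rewrite exprn_ge0.
  by rewrite normrM (ger0_norm W) ler_piMl// sqrt_coef_le.
have AI : (A `<=` [fset k | k in iota 0 n])%fset.
  apply/fsubsetP => k kA; rewrite mem_fset_iota ltnS.
  exact: leq_bigmax_seq.
apply: le_trans (sum_fset_sub_le _ AI) _; first by move=> i; rewrite exprn_ge0.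
rewrite sum_fset_iota.
by apply: le_trans (g n) _; rewrite gerBl mulr_ge0// exprn_ge0.
Qed.

(** The sum squares to [1 + s]. The radius [1/8] keeps it within [1/2] of 1, which
selects the positive root. *)
Lemma sqrt_coef_has_sum (s : R) : `|s| <= 8^-1 ->
  has_sum (fun k => sqrt_coef k * s ^+ k) (Num.sqrt (1 + s)).
Proof.
move=> s8; have s2 : `|s| <= 2^-1 by lra.
have W0 k : 0 < (2^-1 : R) ^+ k by rewrite exprn_gt0.
have hsW k : `|s ^+ k| <= 2^-1 ^+ k by rewrite normrX lerXn2r// nnegrE.
have B1 : abs_bounded (fun k => sqrt_coef k * s ^+ k) 2.
  by apply: abs_bounded_le geometric_bound => k; rewrite !normrM ler_wpM2l// (gtr0_norm (W0 k)).
have [x hx] := abs_bounded_has_sum B1.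
suff [x0 x2] : 0 <= x /\ x ^+ 2 = 1 + s.
  by rewrite -x2 sqrtr_sqr ger0_norm.
split.
  have h1 : has_sum (fun k : nat => if k == 0%N then 1 else 0 : R) 1.
    by apply: (@has_sum_single _ _ (fun k : nat => if k == 0%N then 1 else 0 : R) 0%N) => k /negbTE ->.
  have : `|x - 1| <= 2 * (4^-1).
    apply: has_sum_norm_le (has_sumB hx h1) => A.
    apply: le_trans (ler_wpM2r (_ : 0 <= 4^-1) (geometric_bound A)); last by rewrite invr_ge0.
    rewrite mulr_suml; apply: ler_sum => -[|k] _.
      by rewrite /= !expr0 mulr1 subrr normr0 mulr_ge0// invr_ge0.
    rewrite subr0 !(normrM (sqrt_coef _)) -mulrA ler_wpM2l// normrX (gtr0_norm (W0 _)) !exprS.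
    rewrite mulrAC; apply: ler_pM => //.
      by apply: le_trans s8 _; lra.
    by rewrite lerXn2r// nnegrE.
  by rewrite ler_norml => /andP[]; lra.
have B2 : abs_bounded (fun p : nat * nat => sqrt_coef p.1 * sqrt_coef p.2 * 2^-1 ^+ (p.1 + p.2)) (2 * 2).
  apply: abs_bounded_le (abs_bounded_mul geometric_bound geometric_bound) => -[i j] /=.
  by rewrite exprD mulrACA.
have [D [hD _ DE]] := has_sum_regroup W0 B2.
have {}hD k : D k = (k <= 1)%:R.
  rewrite -sqrt_squareE.
  have h : has_sum (fun i => if (i <= k)%N then sqrt_coef i * sqrt_coef (k - i) else 0) (D k).
    apply: has_sum_rows (hD k) _ => i /=; case: leqP => ik.
      have -> : sqrt_coef i * sqrt_coef (k - i) =
        if (i + (k - i))%N == k then sqrt_coef i * sqrt_coef (k - i) else 0 by rewrite subnKC ?eqxx.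
      apply: (@has_sum_single _ _ (fun j => if (i + j)%N == k then sqrt_coef i * sqrt_coef j else 0)).
      by move=> j; case: ((i + j)%N =P k) => // <-; rewrite addKn eqxx.
    apply: eq_has_sum (has_sum0 _) => j; case: eqP => // E.
    by rewrite -E ltnNge leq_addr in ik.
  have := @has_sum_finite _ _ (fun i => if (i <= k)%N then sqrt_coef i * sqrt_coef (k - i) else 0)
    [fset i | i in iota 0 k.+1]%fset.
  have HA i : i \notin [fset i | i in iota 0 k.+1]%fset ->
      (if (i <= k)%N then sqrt_coef i * sqrt_coef (k - i) else 0) = 0 :> R.
    by rewrite mem_fset_iota ltnS => /negbTE ->.
  move=> /(_ HA) /(has_sum_unique h) ->; rewrite sum_fset_iota.
  by apply: eq_bigr => i _; rewrite -ltnS ltn_ord.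
have h2 : has_sum (fun k => D k * s ^+ k) (x * x).
  apply/DE => //; apply: eq_has_sum (has_sum_mul hx hx) => -[i j] /=.
  by rewrite exprD mulrACA.
have := @has_sum_finite _ _ (fun k => D k * s ^+ k) [fset 0%N; 1%N]%fset.
have HA i : i \notin [fset 0%N; 1%N]%fset -> D i * s ^+ i = 0.
  by rewrite !inE hD; case: i => [|[|i]]//=; rewrite mul0r.
move=> /(_ HA) /(has_sum_unique h2); rewrite expr2 => ->.
by rewrite big_fsetU1 ?inE// big_seq_fset1 !hD /= !mul1r expr0 expr1.
Qed.

Lemma power_series_sqrt : exists N,
  power_series 8^-1 N (fun h : unit -> R => Num.sqrt (1 + h tt)).
Proof.
exists 2; exists (fun q => sqrt_coef (q tt)).
have degE (q : {ffun unit -> nat}) : deg q = q tt.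
  by rewrite /deg (bigD1 tt)//= big1 ?addn0// => -[].
pose g (q : {ffun unit -> nat}) := q tt.
pose g' (n : nat) := [ffun _ : unit => n].
have gK : cancel g g' by move=> q; apply/ffunP => -[]; rewrite ffunE.
have g'K : cancel g' g by move=> n; rewrite /g ffunE.
split.
  move=> A.
  have := geometric_bound [fset g q | q in A]%fset; rewrite big_imfset /=; last first.
    by move=> p q _ _; apply: (can_inj gK).
  apply: le_trans; apply: ler_sum => q _; rewrite degE !normrM ler_wpM2l// !normrX.
  by rewrite lerXn2r ?nnegrE// !ger0_norm ?invr_ge0// lef_pV2 ?posrE// ler_nat.
move=> h /(_ tt) /sqrt_coef_has_sum hs.
apply: eq_has_sum (has_sum_bij gK g'K hs) => q /=.
by rewrite /mono (bigD1 tt)//= big1 ?mulr1// => -[].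
Qed.

End Sqrt.

(** * Real analytic functions *)

Section Neighbourhoods.
Context {R : realType}.
Variable m : nat.
Implicit Types (a x y : 'rV[R]_m) (h : 'I_m -> R).

Lemma coord_le_norm x i : `|x 0 i| <= `|x|.
Proof.
rewrite [leRHS]/Num.norm/= mx_normrE.
exact: (le_bigmax _ (fun p : 'I_1 * 'I_m => `|x p.1 p.2|) (0, i)).
Qed.

Lemma norm_row_le x (r : R) : 0 <= r -> (forall i, `|x 0 i| <= r) -> `|x| <= r.
Proof.
move=> r0 xr; rewrite /Num.norm/= mx_normrE; apply: bigmax_le => //= -[i j] _ /=.
by rewrite (ord1 i).
Qed.

Lemma row_coord x : \row_i x 0 i = x.
Proof. by apply/rowP => i; rewrite mxE. Qed.

Lemma near_rowP a (P : 'rV[R]_m -> Prop) :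
  (\forall x \near a, P x) <->
  exists r, 0 < r /\ forall h, (forall i, `|h i| <= r) -> P (a + \row_i h i).
Proof.
split.
  move=> /nbhs_ballP[e /= e0 eP]; exists (e / 2); split; first by rewrite divr_gt0.
  move=> h he; apply: eP; rewrite -ball_normE /= opprD addrA subrr sub0r normrN.
  apply: (@le_lt_trans _ _ (e / 2)); last by rewrite ltr_pdivrMr// ltr_pMr// ltr1n.
  by apply: norm_row_le => [|i]; rewrite ?divr_ge0 ?(ltW e0)// mxE.
move=> [r [r0 rP]]; apply/nbhs_ballP; exists r => //= x.
rewrite -ball_normE /= distrC => xr; rewrite -(subrKC a x) -(row_coord (x - a)).
by apply: rP => i; apply: le_trans (coord_le_norm _ _) (ltW xr).
Qed.

Lemma near_normP a (P : 'rV[R]_m -> Prop) :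
  (\forall x \near a, P x) <-> exists r, 0 < r /\ forall x, `|x - a| < r -> P x.
Proof.
split.
  move=> /nbhs_ballP[r /= r0 rP]; exists r; split => // x xr; apply: rP.
  by rewrite -ball_normE /= distrC.
move=> [r [r0 rP]]; apply/nbhs_ballP; exists r => // x.
by rewrite -ball_normE /= distrC => /rP.
Qed.

Lemma near_norm0P (P : 'rV[R]_m -> Prop) :
  (\forall x \near (0 : 'rV[R]_m), P x) <-> exists r, 0 < r /\ forall x, `|x| < r -> P x.
Proof.
rewrite near_normP; split => -[r [r0 rP]]; exists r; split => // x.
  by move=> xr; apply: rP; rewrite subr0.
by rewrite subr0; apply: rP.
Qed.

(** Power series expansions give quadratic error terms, so this criterion suffices
for differentiability. *)
Lemma quadratic_differentiable (f : 'rV[R]_m -> R) x (c : 'I_m -> R) (C d : R) :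
  0 < d -> 0 <= C ->
  (forall y, `|y| <= d -> `|f (x + y) - f x - \sum_i y 0 i * c i| <= C * `|y| ^+ 2) ->
  differentiable f x /\ forall v, 'd f x v = \sum_i v 0 i * c i.
Proof.
move=> d0 C0 fxy; pose L (v : 'rV[R]_m) : R := (v *m \col_i c i) 0 0.
have LE v : L v = \sum_i v 0 i * c i.
  by rewrite /L mxE; apply: eq_bigr => i _; rewrite mxE.
have Llin : linear L by move=> k u v; rewrite /L mulmxDl -scalemxAl !mxE.
pose Lm := GRing.isLinear.Build R 'rV[R]_m R *:%R L Llin.
pose LL : {linear 'rV[R]_m -> R} := HB.pack L Lm.
have Lc : continuous L.
  have -> : L = \sum_(i < m) (c i *: (fun v : 'rV[R]_m => v 0 i)).
    by apply/funext => v; rewrite LE fct_sumE; apply: eq_bigr => i _; rewrite mulrC.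
  move=> v; apply: differentiable_continuous; apply: differentiable_sum => i.
  exact/differentiableZ/differentiable_coord.
have H : f \o shift x = cst (f x) + LL +o_ (0 : 'rV[R]_m) id.
  apply/eqaddoP => e e0; apply/nbhs_ballP.
  exists (Num.min d (e / (C + 1))) => /=; first by rewrite lt_min d0 divr_gt0// ltr_wpDl.
  move=> y; rewrite -ball_normE /= sub0r normrN lt_min => /andP[yd ye].
  rewrite /= !fctE /= [y + x]addrC opprD addrA LE.
  apply: le_trans (fxy _ (ltW yd)) _; rewrite expr2 mulrA ler_wpM2r//.
  move: ye; rewrite ltr_pdivlMr ?ltr_wpDl// => /ltW; apply: le_trans.
  by rewrite mulrC ler_wpM2l// lerDl.
have dE := @diff_unique R _ _ f LL x Lc H.
split; last by move=> v; rewrite dE -LE.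
by apply/diff_locallyP; rewrite dE.
Qed.

End Neighbourhoods.

Section RealAnalytic.
Context {R : realType}.
Implicit Types m : nat.

Lemma real_analytic_atP m (f : 'rV[R]_m -> R) a :
  real_analytic_at f a <->
  exists r N, 0 < r /\ power_series r N (fun h : 'I_m -> R => f (a + \row_i h i)).
Proof.
have monoE h p : monomial ((a + \row_i h i) - a) p = mono h p.
  by apply: eq_bigr => i _; rewrite addrAC subrr add0r mxE.
split.
  move=> [c /near_rowP[r [r0 hr]]].
  have hs : has_sum (fun q => c q * mono (fun=> r) q) (f (a + \row_i r)).
    have := hr (fun=> r); rewrite gtr0_norm// => /(_ (fun=> lexx _)).
    by apply: eq_has_sum => p; rewrite (monoE (fun=> r)).
  have [N cN] := has_sum_abs_bounded hs.
  exists r, N; split => //; exists c; split.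
    by apply: abs_bounded_le cN => q; rewrite mono_cst.
  by move=> h /hr; apply: eq_has_sum => p; rewrite monoE.
move=> [r [N [r0 [c [_ hc]]]]]; exists c; apply/near_rowP; exists r; split => // h /hc.
by apply: eq_has_sum => p; rewrite monoE.
Qed.

(** Finitely many analytic functions have expansions on a common polydisc, and
after subtracting their values the norms can be made as small as needed. *)
Lemma real_analytic_common m (S : finType) (g : S -> 'rV[R]_m -> R) a (e : R) :
  0 < e -> (forall s, real_analytic_at (g s) a) ->
  exists r, 0 < r /\
    forall s, power_series r e (fun h : 'I_m -> R => g s (a + \row_i h i) - g s a).
Proof.
move=> e0 hg.
have [r hr] : {r : S -> R & forall s, exists N, 0 < r s /\
    power_series (r s) N (fun h : 'I_m -> R => g s (a + \row_i h i))}.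
  have h s : exists r N, 0 < r /\ power_series r N (fun h : 'I_m -> R => g s (a + \row_i h i)).
    by apply/real_analytic_atP.
  by exists (fun s => projT1 (cid (h s))) => s; exact: (projT2 (cid (h s))).
have [N hN] : {N : S -> R & forall s, 0 < r s /\
    power_series (r s) (N s) (fun h : 'I_m -> R => g s (a + \row_i h i))}.
  by exists (fun s => projT1 (cid (hr s))) => s; exact: (projT2 (cid (hr s))).
pose r0 := \big[Num.min/1]_s r s.
pose M := \sum_s (`|N s| + `|g s a|).
have M0 : 0 <= M by apply: sumr_ge0 => s _; rewrite addr_ge0.
have r00 : 0 < r0 by apply: lt_bigmin => // s _; case: (hN s).
have hs s : power_series r0 M (fun h : 'I_m -> R => g s (a + \row_i h i) - g s a).
  apply: (@power_series_le _ _ r0 (`|N s| + `|- g s a|)) => //; first exact: ltW.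
    by rewrite normrN /M (bigD1 s)//= lerDl sumr_ge0// => t _; rewrite addr_ge0.
  apply: power_seriesD; last exact: power_series_const.
  apply: power_series_le (hN s).2; [exact: ltW|exact: bigmin_le|exact: ler_norm].
pose t := Num.min 1 (e / (M + 1)).
have t0 : 0 < t by rewrite lt_min ltr01 divr_gt0// ltr_wpDl.
have t1 : t <= 1 by rewrite ge_min lexx.
exists (t * r0); split; first by rewrite mulr_gt0.
move=> s; have z : g s (a + \row_(i < m) 0) - g s a = 0.
  by rewrite (_ : \row_i 0 = 0) ?addr0 ?subrr//; apply/rowP => i; rewrite !mxE.
apply: power_series_le (power_series_shrink t0 t1 (ltW r00) (hs s) z) => //.
  by rewrite mulr_ge0// ltW.
have : t <= e / (M + 1) by rewrite ge_min lexx orbT.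
rewrite ler_pdivlMr ?ltr_wpDl//; apply: le_trans.
by rewrite ler_wpM2l ?(ltW t0)// lerDl.
Qed.

(** Analytic functions may be substituted into any convergent power series, whose
variables need not be indexed by an ordinal. *)
Lemma real_analytic_subst m (S : finType) r N (F : (S -> R) -> R)
    (g : S -> 'rV[R]_m -> R) a :
  0 < r -> power_series r N F -> (forall s, real_analytic_at (g s) a) ->
  real_analytic_at (fun x => F (fun s => g s x - g s a)) a.
Proof.
move=> r0 hF hg; have [r' [r'0 hr']] := real_analytic_common r0 hg.
apply/real_analytic_atP; exists r', N; split => //.
exact: (power_series_comp r'0 hF hr').
Qed.

Lemma real_analytic_comp m k (f : 'rV[R]_k -> R) (g : 'I_k -> 'rV[R]_m -> R) a :
  (forall i, real_analytic_at (g i) a) -> real_analytic_at f (\row_i g i a) ->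
  real_analytic_at (fun x => f (\row_i g i x)) a.
Proof.
move=> hg /real_analytic_atP[r [N [r0 hf]]].
have := real_analytic_subst r0 hf hg; congr real_analytic_at.
by apply/funext => x; congr f; apply/rowP => i; rewrite !mxE addrC subrK.
Qed.

Lemma real_analytic_cst m (c : R) (a : 'rV[R]_m) : real_analytic_at (fun=> c) a.
Proof.
by apply/real_analytic_atP; exists 1, `|c|; split => //; apply: power_series_const.
Qed.

Lemma real_analytic_coord m (i : 'I_m) (a : 'rV[R]_m) :
  real_analytic_at (fun x : 'rV[R]_m => x 0 i) a.
Proof.
apply/real_analytic_atP; exists 1, (`|a 0 i| + 1); split => //.
apply: power_series_ext (power_seriesD (power_series_const _ _ _)
  (power_series_var i ler01)) => h _.
by rewrite !mxE.
Qed.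

Lemma real_analyticD m (f g : 'rV[R]_m -> R) a : real_analytic_at f a ->
  real_analytic_at g a -> real_analytic_at (fun x => f x + g x) a.
Proof.
move=> /real_analytic_atP[r [N [r0 hf]]] /real_analytic_atP[r' [N' [r'0 hg]]].
have m0 : 0 < Num.min r r' by rewrite lt_min r0.
apply/real_analytic_atP; exists (Num.min r r'), (N + N'); split => //.
by apply: power_seriesD; [apply: power_series_le hf | apply: power_series_le hg] => //;
  rewrite ?ge_min ?lexx ?orbT// ltW.
Qed.

Lemma real_analyticM m (f g : 'rV[R]_m -> R) a : real_analytic_at f a ->
  real_analytic_at g a -> real_analytic_at (fun x => f x * g x) a.
Proof.
move=> /real_analytic_atP[r [N [r0 hf]]] /real_analytic_atP[r' [N' [r'0 hg]]].
have m0 : 0 < Num.min r r' by rewrite lt_min r0.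
apply/real_analytic_atP; exists (Num.min r r'), (N * N'); split => //.
by apply: power_seriesM => //; [apply: power_series_le hf | apply: power_series_le hg] => //;
  rewrite ?ge_min ?lexx ?orbT// ltW.
Qed.

Lemma real_analyticZ m c (f : 'rV[R]_m -> R) a :
  real_analytic_at f a -> real_analytic_at (fun x => c * f x) a.
Proof. by apply: real_analyticM; apply: real_analytic_cst. Qed.

Lemma real_analyticB m (f g : 'rV[R]_m -> R) a : real_analytic_at f a ->
  real_analytic_at g a -> real_analytic_at (fun x => f x - g x) a.
Proof.
move=> hf hg; have := real_analyticD hf (real_analyticZ (-1) hg).
by congr real_analytic_at; apply/funext => x; rewrite mulN1r.
Qed.

Lemma real_analytic_sqrt m (f : 'rV[R]_m -> R) a : 0 < f a ->
  real_analytic_at f a -> real_analytic_at (fun x => Num.sqrt (f x)) a.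
Proof.
move=> fa hf; have [N hs] := @power_series_sqrt R.
have hg (s : unit) : real_analytic_at (fun x => (f a)^-1 * f x) a by apply: real_analyticZ.
have r0 : 0 < 8^-1 :> R by rewrite invr_gt0.
have := real_analyticZ (Num.sqrt (f a)) (real_analytic_subst r0 hs hg).
congr real_analytic_at; apply/funext => x; rewrite -sqrtrM ?(ltW fa)//; congr Num.sqrt.
by field; rewrite gt_eqF.
Qed.

(** An analytic function expands in both variables of [f (a + h + k)]; the part
that is linear in [k] exhibits the partial derivatives as power series in [h]. *)
Lemma real_analytic_diff_series m (f : 'rV[R]_m -> R) a : real_analytic_at f a ->
  exists r N (F : 'I_m -> ('I_m -> R) -> R), [/\ 0 < r,
    forall i, power_series r N (F i) &
    forall h, (forall i, `|h i| <= r) -> differentiable f (a + \row_i h i) /\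
      forall v, 'd f (a + \row_i h i) v = \sum_i v 0 i * F i h].
Proof.
move=> /real_analytic_atP[r [N [r0 hf]]].
have r20 : 0 < r / 2 by rewrite divr_gt0.
have hvar (i : 'I_m) : power_series (r / 2) r
    (fun h : 'I_m + 'I_m -> R => h (inl i) + h (inr i)).
  by rewrite [X in power_series _ X](splitr r); apply: power_seriesD; apply: power_series_var; apply: ltW.
have [F [hF HF]] := power_series_expand r20 (power_series_comp r20 hf hvar).
exists (r / 2), (N / (r / 2)), F; split => // h hr.
have N0 : 0 <= N by case: hf => d [dN _]; exact: abs_bounded_ge0 dN.
apply: (@quadratic_differentiable _ _ _ _ _ (N / (r / 2) ^+ 2) (r / 2)) => //.
  by rewrite divr_ge0// exprn_ge0// ltW.
move=> y yr; have := HF h (fun i => y 0 i) `|y| hr (fun i => coord_le_norm y i) yr (normr_ge0 y).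
rewrite expr_div_n mulrA [X in _ <= X]mulrAC; congr (`|f _ - f _ - _| <= _).
  by apply/rowP => i; rewrite !mxE /= addrA.
by apply/rowP => i; rewrite !mxE /= addr0.
Qed.

Lemma real_analytic_differentiable m (f : 'rV[R]_m -> R) a :
  real_analytic_at f a -> differentiable f a.
Proof.
move=> /real_analytic_diff_series[r [N [F [r0 _ HF]]]].
have [i|] := HF (fun=> 0); first by rewrite normr0 ltW.
by rewrite (_ : \row_i 0 = 0) ?addr0//; apply/rowP => i; rewrite !mxE.
Qed.

Lemma diff_partial m (f : 'rV[R]_m -> R) x v : differentiable f x ->
  'd f x v = \sum_i v 0 i * partial i f x.
Proof.
move=> df; rewrite {1}(matrix_sum_delta v) big_ord1 linear_sum; apply: eq_bigr => i _.
by rewrite linearZ /= /partial deriveE.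
Qed.

Lemma real_analytic_partial m (f : 'rV[R]_m -> R) i a :
  real_analytic_at f a -> real_analytic_at (partial i f) a.
Proof.
move=> /real_analytic_diff_series[r [N [F [r0 hF HF]]]].
apply/real_analytic_atP; exists r, N; split => //; apply: power_series_ext (hF i) => h hr.
have [df dE] := HF h hr; rewrite /partial deriveE// dE (bigD1 i)//= mxE !eqxx mul1r.
rewrite big1 ?addr0// => j /negbTE ji; by rewrite mxE ji andbF mul0r.
Qed.

Lemma real_analytic_smooth m (U : set 'rV[R]_m) f : real_analytic_on U f -> smooth_on U f.
Proof.
move=> fU s x Ux; apply: real_analytic_differentiable; elim: s => [|i s IH] /=.
  exact: fU.
exact: real_analytic_partial.
Qed.

Lemma real_analytic_near_differentiable m (f : 'rV[R]_m -> R) a :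
  real_analytic_at f a -> \forall x \near a, differentiable f x.
Proof.
move=> /real_analytic_diff_series[r [N [F [r0 _ HF]]]]; apply/near_rowP.
by exists r; split => // h /HF[].
Qed.

End RealAnalytic.

(** ** Isolated zeros and the identity theorem *)

Section Identity.
Context {R : realType}.
Variable m : nat.
Implicit Types (f : 'rV[R]_m -> R) (a b v x y : 'rV[R]_m).

(** On a line through its centre an analytic function is a power series in one
variable, so zeros that accumulate at the centre force it to vanish nearby. *)
Lemma real_analytic_line_zero f a v : real_analytic_at f a ->
  exists r, 0 < r /\
    ((forall e, 0 < e -> exists s, [/\ s != 0, `|s| < e & f (a + s *: v) = 0]) ->
     forall s, `|s| <= r -> f (a + s *: v) = 0).
Proof.
move=> /real_analytic_atP[r [N [r0 hf]]].
have v1 : 0 < `|v| + 1 by rewrite ltr_wpDl.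
pose r' := r / (`|v| + 1); have r'0 : 0 < r' by rewrite divr_gt0.
have hg i : power_series r' r (fun h : unit -> R => h tt * v 0 i).
  apply: power_series_le (power_seriesM r'0 (power_series_var tt (ltW r'0))
    (power_series_const _ _ (v 0 i))) => //; first exact: ltW.
  rewrite /r' mulrAC ler_pdivrMr// ler_wpM2l ?(ltW r0)//.
  by rewrite (le_trans (coord_le_norm _ _))// lerDl.
have [d [dN hd]] := power_series_comp r'0 hf hg.
have W0 (k : nat) : 0 < r' ^+ k by rewrite exprn_gt0.
have dN' : abs_bounded (fun q : {ffun unit -> nat} => d q * r' ^+ q tt) N.
  by apply: abs_bounded_le dN => q; rewrite /deg (bigD1 tt)//= big1 ?addn0// => -[].
have [D [_ DN hD]] := has_sum_regroup W0 dN'.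
have hs s : `|s| <= r' -> has_sum (fun k => D k * s ^+ k) (f (a + s *: v)).
  move=> sr; apply/hD; first by move=> k; rewrite normrX lerXn2r// nnegrE// ltW.
  rewrite (_ : s *: v = \row_i (s * v 0 i)); last by apply/rowP => i; rewrite !mxE.
  apply: eq_has_sum (hd (fun=> s) (fun=> sr)) => q.
  by rewrite /mono (bigD1 tt)//= big1 ?mulr1// => -[].
exists r'; split => // hz s sr.
have D0 : forall k, D k = 0.
  apply: (has_sum_exp_eq0 r'0 DN) => e e0.
  have [|u [u0 ue fu]] := hz (Num.min e r'); first by rewrite lt_min e0.
  move: ue; rewrite lt_min => /andP[ue ur].
  by exists u; split => //; rewrite -fu; apply: hs; apply: ltW.
apply: has_sum_unique (hs s sr) _; apply: eq_has_sum (has_sum0 _) => k.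
by rewrite D0 mul0r.
Qed.

(** At the last parameter up to which [f] vanishes, the zeros accumulate, so [f]
vanishes a little further. Only expansions centred on the segment are used. *)
Lemma real_analytic_segment_zero f b v (d : R) :
  (forall t, 0 <= t <= 1 -> real_analytic_at f (b + t *: v)) -> 0 < d ->
  (forall t, 0 <= t <= d -> f (b + t *: v) = 0) -> f (b + v) = 0.
Proof.
move=> fan d0 fd.
pose S := [set t | 0 <= t <= 1 /\ forall u, 0 <= u <= t -> f (b + u *: v) = 0].
have Sd : S (Num.min d 1).
  split; first by rewrite le_min ltW//= ge_min lexx orbT ler01.
  by move=> u /andP[u0]; rewrite le_min => /andP[ud _]; apply: fd; rewrite u0.
have hS : has_sup S by split; [exists (Num.min d 1) | exists 1 => t [/andP[]]].
pose s := sup S.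
have s0 : 0 < s.
  apply: (@lt_le_trans _ _ (Num.min d 1)); first by rewrite lt_min d0 ltr01.
  by apply: sup_ubound => //; case: hS.
have s1 : s <= 1 by apply: (ge_sup hS.1) => t [/andP[]].
have below u : 0 <= u -> u < s -> f (b + u *: v) = 0.
  move=> u0 us; have su : 0 < s - u by rewrite subr_gt0.
  have [t [_ tz] ut] := sup_adherent su hS.
  by apply: tz; rewrite u0 ltW//; move: ut; rewrite -/s; lra.
have [r [r0 hr]] := real_analytic_line_zero v (fan s (introT andP (conj (ltW s0) s1))).
have lineE w : b + s *: v + w *: v = b + (s + w) *: v by rewrite scalerDl addrA.
(* The zeros that accumulate at [s] have the parameters [s - min (e, s) / 2]. *)
have near_s w : `|w| <= r -> f (b + (s + w) *: v) = 0.
  rewrite -lineE; apply: hr => e e0; exists (- (Num.min e s / 2)).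
  have m0 : 0 < Num.min e s by rewrite lt_min e0.
  have [me ms] : Num.min e s <= e /\ Num.min e s <= s by rewrite !ge_min !lexx orbT.
  split; first by rewrite oppr_eq0 gt_eqF// divr_gt0.
    by rewrite normrN gtr0_norm ?divr_gt0//; lra.
  by rewrite lineE; apply: below; lra.
have Sr : S (Num.min (s + r) 1).
  split; first by rewrite le_min ge_min lexx orbT !andbT ler01 andbT; lra.
  move=> u /andP[u0]; rewrite le_min => /andP[ur _].
  have [us|su] := ltP u s; first exact: below.
  by rewrite -(subrKC s u); apply: near_s; rewrite ger0_norm; lra.
have := sup_ubound hS.2 Sr; rewrite -/s ge_min.
have -> : (s + r <= s) = false by apply/negbTE; rewrite -ltNge; lra.
move=> /= s1'; have [_ /(_ 1)] := Sr; rewrite scale1r; apply.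
by rewrite ler01 le_min lexx andbT; lra.
Qed.

Lemma real_analytic_ball_zero f a b (r : R) :
  (forall x, `|x - a| < r -> real_analytic_at f x) -> `|b - a| < r ->
  (\forall x \near b, f x = 0) -> forall x, `|x - a| < r -> f x = 0.
Proof.
move=> fan br /near_rowP[d [d0 fb]] x xr; rewrite -(subrKC b x).
have n0 : 0 < `|x - b| + 1 by rewrite ltr_wpDl.
apply: (@real_analytic_segment_zero _ _ _ (d / (`|x - b| + 1))); last first.
- move=> t /andP[t0 td]; have -> : t *: (x - b) = \row_i (t * (x - b) 0 i).
    by apply/rowP => i; rewrite !mxE.
  apply: fb => i; rewrite normrM ger0_norm//.
  move: td; rewrite ler_pdivlMr//; apply: le_trans; rewrite ler_wpM2l//.
  by rewrite (le_trans (coord_le_norm _ _))// lerDl.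
- by rewrite divr_gt0.
move=> t /andP[t0 t1]; apply: fan.
have -> : b + t *: (x - b) - a = (1 - t) *: (b - a) + t *: (x - a).
  by apply/rowP => i; rewrite !mxE; ring.
rewrite (le_lt_trans (ler_normD _ _))// !normrZ (ger0_norm t0) ger0_norm ?subr_ge0//.
have [->|t'] := eqVneq t 0; first by rewrite subr0 mul1r mul0r addr0.
have tp : 0 < t by rewrite lt_neqAle eq_sym t'.
apply: (@le_lt_trans _ _ ((1 - t) * r + t * `|x - a|)).
  by rewrite lerD2r ler_wpM2l ?subr_ge0// ltW.
have : t * `|x - a| < t * r by rewrite ltr_pM2l.
lra.
Qed.

Lemma real_analytic_identity (U : set 'rV[R]_m) f a :
  open U -> connected U -> real_analytic_on U f -> U a ->
  (\forall x \near a, f x = 0) -> forall x, U x -> f x = 0.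
Proof.
move=> oU cU fU Ua fa.
pose Z := interior [set x | f x = 0].
have UZ x : U x -> closure Z x -> Z x.
  move=> Ux clx; have /nbhs_ballP[r /= r0 rU] : nbhs x U by exact: open_nbhs_nbhs.
  have [b [Zb xb]] := clx _ (nbhsx_ballx x r r0).
  apply/nbhs_ballP; exists r => // y; rewrite -ball_normE /= distrC => yr.
  apply: (@real_analytic_ball_zero f x b r) => //.
    by move=> z zr; apply: fU; apply: rU; rewrite -ball_normE /= distrC.
  by move: xb; rewrite -ball_normE /= distrC.
suff <- : U `&` Z = U by move=> x [_ /interior_subset].
apply: cU; first by exists a.
- by exists Z => //; exact: open_interior.
exists (closure Z); first exact: closed_closure.
by apply/seteqP; split => x [Ux zx]; split => //; [exact: subset_closure | exact: UZ].
Qed.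

End Identity.

(** ** Symmetry of second derivatives *)

Section Symmetry.
Context {R : realType}.
Variable m : nat.
Implicit Types (f : 'rV[R]_m -> R) (a v x : 'rV[R]_m) (i j : 'I_m).

Lemma derive_quadratic f x v (l C r : R) : 0 < r ->
  (forall s, `|s| <= r -> `|f (x + s *: v) - f x - s * l| <= C * `|s| ^+ 2) ->
  'D_v f x = l.
Proof.
move=> r0 H; apply: cvg_lim => //; apply/cvgrPdist_le => e e0.
apply/nbhs_ballP; exists (Num.min r (e / (`|C| + 1))) => /=.
  by rewrite lt_min r0 divr_gt0// ltr_wpDl.
move=> s; rewrite /ball /= sub0r normrN lt_min => /andP[sr se] s0.
have sn0 : 0 < `|s| by rewrite normr_gt0.
rewrite -[l](mulKf s0) -[s^-1 *: _]/(s^-1 * _) -mulrBr normrM normfV ler_pdivrMl//.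
rewrite distrC [s *: v + x]addrC; apply: le_trans (H s (ltW sr)) _.
rewrite expr2 mulrCA ler_wpM2l//.
move: se; rewrite ltr_pdivlMr ?ltr_wpDl// => /ltW; apply: le_trans.
by rewrite mulrC ler_wpM2l// (le_trans (ler_norm C))// lerDl.
Qed.

(** Multiplying by [mono (pair_indicator i j)] discards the monomials that involve
other variables than the two of index [i] and [j]. *)
Definition pair_indicator i j (l : 'I_m) : R := ((l == i) || (l == j))%:R.

(** The right-hand side is symmetric in [i] and [j]. It is found by expanding in
the first variable at every point of the second axis, then in the second one. *)
Lemma mixed_partial_has_sum f a r N d i j : i != j -> 0 < r ->
  abs_bounded (fun q : {ffun 'I_m -> nat} => d q * r ^+ deg q) N ->
  (forall h, (forall i, `|h i| <= r) -> has_sum (fun q => d q * mono h q) (f (a + \row_i h i))) ->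
  has_sum (fun q : {ffun 'I_m -> nat} =>
      if (q i == 1%N) && (q j == 1%N) then d q * mono (pair_indicator i j) q else 0)
    (partial j (partial i f) a).
Proof.
move=> ij r0 dN hd.
pose b (q : {ffun 'I_m -> nat}) := d q * mono (pair_indicator i j) q.
pose at_ k (s : R) (l : 'I_m) := if l == k then s else 1.
have mono_at k s (q : {ffun 'I_m -> nat}) : mono (at_ k s) q = s ^+ q k.
  rewrite /mono (bigD1 k)//= /at_ eqxx big1 ?mulr1// => l /negbTE ->.
  by rewrite expr1n.
pose pt s t := (a + t *: (delta_mx 0 j : 'rV[R]_m)) + s *: (delta_mx 0 i : 'rV[R]_m).
pose co s t l := pair_indicator i j l * at_ i s l * at_ j t l.
have coE s t l : co s t l = if l == i then s else if l == j then t else 0.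
  rewrite /co /pair_indicator /at_; case: (eqVneq l i) => [->|_] /=.
    by rewrite (negbTE ij) mul1r mulr1.
  by case: (eqVneq l j) => _; rewrite ?mul1r ?mul0r.
have co_le s t l : `|s| <= r -> `|t| <= r -> `|co s t l| <= r.
  by move=> sr tr; rewrite coE; do 2 case: ifP => // _; rewrite normr0 ltW.
have mono_co s t (q : {ffun 'I_m -> nat}) :
    mono (co s t) q = mono (pair_indicator i j) q * s ^+ q i * t ^+ q j.
  by rewrite /co !mono_mul !mono_at.
have bsum s t : `|s| <= r -> `|t| <= r ->
    has_sum (fun q : {ffun 'I_m -> nat} => b q * t ^+ q j * s ^+ q i) (f (pt s t)).
  move=> sr tr; have -> : pt s t = a + \row_l co s t l.
    apply/rowP => l; rewrite !mxE eqxx /= coE -addrA; congr (_ + _).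
    case: (eqVneq l i) => [->|_]; first by rewrite (negbTE ij) mulr0 mulr1 add0r.
    by case: (eqVneq l j) => _; rewrite ?mulr1 !mulr0 addr0.
  apply: eq_has_sum (hd _ (fun l => co_le s t l sr tr)) => q.
  by rewrite mono_co /b; ring.
have rr : `|r| <= r by rewrite gtr0_norm.
have bN : abs_bounded (fun q : {ffun 'I_m -> nat} => b q * r ^+ q j * r ^+ q i) N.
  apply: abs_bounded_le dN => q.
  have -> : b q * r ^+ q j * r ^+ q i = d q * mono (co r r) q by rewrite mono_co /b; ring.
  rewrite !normrM ler_wpM2l// (gtr0_norm (_ : 0 < r ^+ _)) ?exprn_gt0//.
  by apply: mono_le => l; apply: co_le.
have b1N : abs_bounded (fun q : {ffun 'I_m -> nat} => (if q i == 1%N then b q else 0) * r ^+ q j) (N / r).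
  move=> A; rewrite ler_pdivlMr// mulr_suml; apply: le_trans (bN A).
  apply: ler_sum => q _; case: eqP => [->|_]; last by rewrite mul0r normr0 mul0r.
  by rewrite expr1 [leRHS]normrM (gtr0_norm r0).
have B1 t : `|t| <= r -> has_sum (fun q : {ffun 'I_m -> nat} => (if q i == 1%N then b q else 0) * t ^+ q j)
    (partial i f (a + t *: (delta_mx 0 j : 'rV[R]_m))).
  move=> tr.
  have tN : abs_bounded (fun q : {ffun 'I_m -> nat} => b q * t ^+ q j * r ^+ q i) N.
    apply: abs_bounded_le bN => q; rewrite !normrM ler_wpM2r// ler_wpM2l//.
    by rewrite !normrX (gtr0_norm r0) lerXn2r// nnegrE// ltW.
  have [l hl] : exists l, has_sum (fun q : {ffun 'I_m -> nat} => if q i == 1%N then b q * t ^+ q j else 0) l.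
    apply: (@abs_bounded_has_sum _ _ _ (N / r)); apply: abs_bounded_le b1N => q.
    case: eqP => _; last by rewrite normr0.
    by rewrite !normrM ler_wpM2l// !normrX (gtr0_norm r0) lerXn2r// nnegrE// ltW.
  have E := has_sum_expand1 r0 tN (fun s sr => bsum s t sr tr) hl.
  rewrite /partial (@derive_quadratic _ _ _ l (N / r ^+ 2) r) //.
    by apply: eq_has_sum hl => q; case: eqP => _; rewrite ?mul0r.
  move=> s /E; rewrite /pt scale0r addr0 expr_div_n.
  by rewrite (_ : N * _ = N / r ^+ 2 * `|s| ^+ 2)// mulrCA mulrC.
have [l hl] : exists l, has_sum (fun q : {ffun 'I_m -> nat} =>
    if q j == 1%N then (if q i == 1%N then b q else 0) else 0) l.
  apply: (@abs_bounded_has_sum _ _ _ (N / r / r)) => A.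
  rewrite ler_pdivlMr// mulr_suml; apply: le_trans (b1N A).
  apply: ler_sum => q _; case: (q j =P 1%N) => [->|_]; last by rewrite normr0 mul0r.
  by rewrite expr1 [leRHS]normrM (gtr0_norm r0).
have E := has_sum_expand1 r0 b1N B1 hl.
rewrite {1}/partial (@derive_quadratic _ _ _ l (N / r / r ^+ 2) r) //.
  by apply: eq_has_sum hl => q; case: eqP => _ //=; rewrite ?andbF ?andbT.
move=> s /E; rewrite scale0r addr0 expr_div_n.
by rewrite (_ : N / r * _ = N / r / r ^+ 2 * `|s| ^+ 2)// mulrCA mulrC.
Qed.

Lemma partialC f a i j : real_analytic_at f a ->
  partial j (partial i f) a = partial i (partial j f) a.
Proof.
have [->//|ij] := eqVneq i j.
move=> /real_analytic_atP[r [N [r0 [d [dN hd]]]]].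
apply: has_sum_unique (mixed_partial_has_sum ij r0 dN hd) _.
have ji : j != i by rewrite eq_sym.
apply: eq_has_sum (mixed_partial_has_sum ji r0 dN hd) => q.
rewrite andbC (_ : pair_indicator j i = pair_indicator i j)//.
by apply/funext => l; rewrite /pair_indicator orbC.
Qed.

End Symmetry.

(** * Differentials of scalar and row valued maps *)

Section Differentials.
Context {R : realType}.
Implicit Types m k : nat.

Lemma near_eq_diff (V W : normedModType R) (f g : V -> W) x :
  (\forall y \near x, f y = g y) -> differentiable f x ->
  differentiable g x /\ 'd g x = 'd f x :> (V -> W).
Proof.
move=> fg df; have [dfc fE] : continuous ('d f x) /\ f \o shift x = cst (f x) + 'd f x +o_ 0 id.
  by split; [exact: diff_continuous | exact: diff_locally].
have H : g \o shift x = cst (g x) + 'd f x +o_ (0 : V) id.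
  have gx : g x = f x by rewrite (nbhs_singleton fg).
  move/eqaddoP : fE => fE; apply/eqaddoP => e e0; rewrite gx.
  have := fE e e0; apply: filter_app; near=> y; rewrite /= !fctE /=.
  have -> // : g (y + x) = f (y + x).
  by apply/esym; near: y; have := fg; rewrite (near_shift 0 x) subr0.
have dE := diff_unique dfc H; split => //.
by apply/diff_locallyP; rewrite dE.
Unshelve. all: by end_near. Qed.

(** A constant of its own, so that algebraic identities treat the values of a
differential as atoms. *)
Definition differential m (f : 'rV[R]_m -> R) (x v : 'rV[R]_m) : R := 'd f x v.

Definition has_diff m (f : 'rV[R]_m -> R) x (L : 'rV[R]_m -> R) :=
  differentiable f x /\ forall v, differential f x v = L v.

Lemma has_diff_near m (f g : 'rV[R]_m -> R) x L :
  (\forall y \near x, f y = g y) -> has_diff f x L -> has_diff g x L.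
Proof.
by move=> fg [df fL]; have [dg gE] := near_eq_diff fg df; split => // v; rewrite /differential gE; apply: fL.
Qed.

Lemma eq_has_diff m (f : 'rV[R]_m -> R) x L L' : L =1 L' -> has_diff f x L -> has_diff f x L'.
Proof. by move=> LL [df fL]; split => // v; rewrite fL. Qed.

Lemma has_diffD m (f g : 'rV[R]_m -> R) x L L' : has_diff f x L -> has_diff g x L' ->
  has_diff (fun y => f y + g y) x (fun v => L v + L' v).
Proof.
move=> [df fL] [dg gL]; split; first exact: (differentiableD df dg).
move=> v; rewrite /differential -[fun y => _]/(f + g) diffD//=.
by congr (_ + _); [exact: fL | exact: gL].
Qed.

Lemma has_diffM m (f g : 'rV[R]_m -> R) x L L' : has_diff f x L -> has_diff g x L' ->
  has_diff (fun y => f y * g y) x (fun v => f x * L' v + g x * L v).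
Proof.
move=> [df fL] [dg gL]; split; first exact: (differentiableM df dg).
move=> v; rewrite /differential -[fun y => _]/(f * g) diffM//=.
by congr (_ * _ + _ * _); [exact: gL | exact: fL].
Qed.

Lemma has_diff_cst m c (x : 'rV[R]_m) : has_diff (fun=> c) x (fun=> 0).
Proof.
split; first exact: differentiable_cst.
by move=> v; rewrite /differential -[fun=> c]/(cst c) diff_cst.
Qed.

Lemma has_diffZ m c (f : 'rV[R]_m -> R) x L : has_diff f x L ->
  has_diff (fun y => c * f y) x (fun v => c * L v).
Proof.
move=> hf; apply: eq_has_diff (has_diffM (has_diff_cst c x) hf) => v /=.
by rewrite mulr0 addr0.
Qed.

Lemma has_diff_coord m (i : 'I_m) x : has_diff (fun y : 'rV[R]_m => y 0 i) x (fun v => v 0 i).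
Proof.
split; first exact: differentiable_coord.
move=> v; rewrite /differential -deriveE; last exact: differentiable_coord.
apply: (@derive_quadratic _ _ _ _ _ _ 0 1) => // s _.
by rewrite !mxE mul0r normr_le0; apply/eqP; ring.
Qed.

Lemma has_diffE m (f : 'rV[R]_m -> R) x : differentiable f x -> has_diff f x (differential f x).
Proof. by []. Qed.

Lemma partial_has_diff m (f : 'rV[R]_m -> R) x L i : has_diff f x L ->
  partial i f x = L (delta_mx 0 i).
Proof. by move=> [df fL]; rewrite /partial deriveE//; apply: fL. Qed.

Lemma row_differentiable (V : normedModType R) k (F : V -> 'rV[R]_k) x :
  (forall i, differentiable (fun y => F y 0 i) x) ->
  differentiable F x /\ forall v i, ('d F x v) 0 i = 'd (fun y => F y 0 i) x v.
Proof.
move=> dF.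
have FE : F = \sum_(i < k) (fun y => F y 0 i *: (delta_mx 0 i : 'rV[R]_k)).
  apply/funext => y; rewrite fct_sumE {1}(matrix_sum_delta (F y)) big_ord1.
  by apply: eq_bigr.
have df : differentiable F x.
  by rewrite FE; apply: differentiable_sum => i; exact: differentiableZl.
split => // v i.
have [dc cE] := has_diff_coord i (F x).
rewrite -[fun y => F y 0 i]/((fun M : 'rV[R]_k => M 0 i) \o F) (diff_comp df dc); exact/esym/cE.
Qed.

Lemma has_diff_comp m k (q : 'rV[R]_k -> R) (F : 'rV[R]_m -> 'rV[R]_k) x L :
  (forall i, has_diff (fun y => F y 0 i) x (L i)) -> differentiable q (F x) ->
  has_diff (fun y => q (F y)) x (fun v => \sum_i L i v * partial i q (F x)).
Proof.
move=> hF dq; have [dF FE] := row_differentiable (fun i => (hF i).1).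
rewrite -[fun y => q (F y)]/(q \o F); split; first exact: differentiable_comp.
move=> v; rewrite /differential diff_comp//= diff_partial//; apply: eq_bigr => i _.
by rewrite FE; congr (_ * _); exact: (hF i).2.
Qed.

Lemma real_analytic_row_continuous m k (F : 'rV[R]_m -> 'rV[R]_k) x :
  (forall i, real_analytic_at (fun y => F y 0 i) x) -> {for x, continuous F}.
Proof.
move=> hF; apply: differentiable_continuous; apply: (row_differentiable _).1 => i.
exact: real_analytic_differentiable.
Qed.

End Differentials.

(** * Rotation invariant potentials and special maps *)

Section Geometry.
Context {R : realType}.
Variable n : nat.
Local Notation V := 'rV[R]_(n + n).
Local Notation zx z j := (z 0 (lshift n j)).
Local Notation zy z j := (z 0 (rshift n j)).
Implicit Types (z w u v : V) (Phi : V -> R) (q : 'rV[R]_n -> R) (Q : 'I_n -> V -> R).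

Definition cross u v (j : 'I_n) : R := zx u j * zy v j - zy u j * zx v j.
Definition dot u v (j : 'I_n) : R := zx u j * zx v j + zy u j * zy v j.

(** In polar coordinates [z_a = r_a exp (i t_a)] this is the two-form
[1/2 \sum_a d (Q_a r_a^2) /\ d t_a]; both the Kaehler form of a rotation invariant
potential and its pullback under a special map have this shape. *)
Definition omega_form Q z u v : R :=
  \sum_a (Q a z * cross u v a + 2^-1 * differential (Q a) z v * cross u z a
          + 2^-1 * differential (Q a) z u * cross z v a).

Lemma has_diff_sqmod j z : has_diff (fun w => sqmod w 0 j) z (fun v => 2 * dot z v j).
Proof.
have hx := has_diff_coord (lshift n j) z; have hy := has_diff_coord (rshift n j) z.
apply: (@has_diff_near _ _ (fun w => zx w j * zx w j + zy w j * zy w j)).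
  by near=> w; rewrite mxE !expr2.
apply: eq_has_diff (has_diffD (has_diffM hx hx) (has_diffM hy hy)) => v.
by rewrite /dot; ring.
Unshelve. all: by end_near. Qed.

Lemma real_analytic_sqmod j z : real_analytic_at (fun w : V => sqmod w 0 j) z.
Proof.
have := real_analyticD
  (real_analyticM (real_analytic_coord (lshift n j) z) (real_analytic_coord (lshift n j) z))
  (real_analyticM (real_analytic_coord (rshift n j) z) (real_analytic_coord (rshift n j) z)).
by congr real_analytic_at; apply/funext => w; rewrite mxE !expr2.
Qed.

Lemma sqmod_continuous z : {for z, continuous (@sqmod R n)}.
Proof. by apply: real_analytic_row_continuous => i; apply: real_analytic_sqmod. Qed.

Lemma real_analytic_comp_sqmod q z : real_analytic_at q (sqmod z) ->
  real_analytic_at (fun w => q (sqmod w)) z.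
Proof.
move=> hq; have := @real_analytic_comp _ _ _ q (fun j w => sqmod w 0 j) z
  (fun j => real_analytic_sqmod j z).
rewrite row_coord => /(_ hq); congr real_analytic_at.
by apply/funext => w; rewrite row_coord.
Qed.

Lemma has_diff_comp_sqmod q z : differentiable q (sqmod z) ->
  has_diff (fun w => q (sqmod w)) z (fun v => \sum_b 2 * dot z v b * partial b q (sqmod z)).
Proof. exact: (has_diff_comp (fun j => has_diff_sqmod j z)). Qed.

Lemma sum_delta (F : 'I_n -> R) j (c : 'I_n -> R) :
  (forall b, b != j -> c b = 0) -> \sum_b c b * F b = c j * F j.
Proof.
by move=> cb; rewrite (bigD1 j)//= big1 ?addr0// => b bj; rewrite cb// mul0r.
Qed.

Lemma dot_ex z (j b : 'I_n) : dot z (delta_mx 0 (lshift n j)) b = (b == j)%:R * zx z j.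
Proof.
rewrite /dot !mxE !eqxx /= eq_lshift eq_rlshift mulr0 addr0.
by case: eqP => [->|_]; rewrite ?mulr1 ?mul1r ?mulr0 ?mul0r.
Qed.

Lemma dot_ey z (j b : 'I_n) : dot z (delta_mx 0 (rshift n j)) b = (b == j)%:R * zy z j.
Proof.
rewrite /dot !mxE !eqxx /= eq_lrshift eq_rshift mulr0 add0r.
by case: eqP => [->|_]; rewrite ?mulr1 ?mul1r ?mulr0 ?mul0r.
Qed.

Lemma partial_comp_sqmod q z j : differentiable q (sqmod z) ->
  partial (lshift n j) (fun w => q (sqmod w)) z = 2 * zx z j * partial j q (sqmod z) /\
  partial (rshift n j) (fun w => q (sqmod w)) z = 2 * zy z j * partial j q (sqmod z).
Proof.
move=> dq; rewrite !(partial_has_diff _ (has_diff_comp_sqmod dq)).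
split; rewrite (bigD1 j)//= big1 ?addr0 => [|b /negbTE bj].
- by rewrite dot_ex eqxx mul1r.
- by rewrite dot_ex bj !mul0r mulr0 mul0r.
- by rewrite dot_ey eqxx mul1r.
- by rewrite dot_ey bj !mul0r mulr0 mul0r.
Qed.

Lemma half_complex (a b : R) : 2^-1 * (a +i* b)%C = ((2^-1 * a) +i* (2^-1 * b))%C.
Proof.
have h : (2 : R[i]) != 0 by rewrite pnatr_eq0.
apply: (mulfI h); rewrite mulrA divff// mul1r mulr_natl mulr2n.
by apply/eqP; rewrite eq_complex /=; apply/andP; split; apply/eqP; lra.
Qed.

Lemma cderive_real Phi v w : cderive (fun w => (Phi w)%:C%C) v w = ('D_v Phi w)%:C%C.
Proof. by rewrite /cderive /= derive_cst. Qed.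

Lemma d_zbar_real Phi k w : d_zbar k (fun w => (Phi w)%:C%C) w =
  ((2^-1 * partial (lshift n k) Phi w) +i* (2^-1 * partial (rshift n k) Phi w))%C.
Proof.
rewrite /d_zbar !cderive_real -half_complex; congr (_ * _).
by apply/eqP; rewrite eq_complex /=; apply/andP; split; apply/eqP; rewrite /partial; ring.
Qed.

(** This is [q_jk(x) conj z_j z_k + delta_jk q_k(x)], split into real and imaginary
parts. *)
Lemma levi_sqmod Phi q z j k :
  (\forall w \near z, Phi w = q (sqmod w)) -> real_analytic_at q (sqmod z) ->
  levi Phi z j k =
   ((partial j (partial k q) (sqmod z) * (zx z j * zx z k + zy z j * zy z k)
       + (j == k)%:R * partial k q (sqmod z)) +i*
    (partial j (partial k q) (sqmod z) * (zx z j * zy z k - zy z j * zx z k)))%C.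
Proof.
move=> Pq hq; set qj := partial j _ _; set q1 := partial k q (sqmod z).
have dqn : \forall w \near z, differentiable q (sqmod w).
  exact: (sqmod_continuous (real_analytic_near_differentiable hq)).
have fE : \forall w \near z, d_zbar k (fun w => (Phi w)%:C%C) w =
    ((zx w k * partial k q (sqmod w)) +i* (zy w k * partial k q (sqmod w)))%C.
  near=> w; have Pw : \forall y \near w, Phi y = q (sqmod y).
    by near: w; exact: (near_join Pq).
  have dqw : differentiable q (sqmod w) by near: w.
  have [Ex Ey] := partial_comp_sqmod k dqw.
  rewrite d_zbar_real {1 2}/partial !(near_eq_derive _ Pw) -!/(partial _ _ _) Ex Ey.
  by congr (_ +i* _)%C; field.
have hq1 := real_analytic_partial k hq.
have hk := has_diff_comp_sqmod (real_analytic_differentiable hq1).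
have hX := has_diffM (has_diff_coord (lshift n k) z) hk.
have hY := has_diffM (has_diff_coord (rshift n k) z) hk.
have cE v : cderive (d_zbar k (fun w => (Phi w)%:C%C)) v z =
  ((zx z k * (\sum_b 2 * dot z v b * partial b (partial k q) (sqmod z)) + q1 * zx v k) +i*
   (zy z k * (\sum_b 2 * dot z v b * partial b (partial k q) (sqmod z)) + q1 * zy v k))%C.
  rewrite /cderive; congr (_ +i* _)%C.
    rewrite (@near_eq_derive _ _ _ _ (fun w => zx w k * partial k q (sqmod w))).
      rewrite deriveE; [exact: hX.2 | exact: hX.1].
    by near=> w; have -> := near fE w.
  rewrite (@near_eq_derive _ _ _ _ (fun w => zy w k * partial k q (sqmod w))).
    rewrite deriveE; [exact: hY.2 | exact: hY.1].
  by near=> w; have -> := near fE w.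
rewrite /levi /d_z !cE.
have Sx : \sum_b 2 * dot z (delta_mx 0 (lshift n j)) b * partial b (partial k q) (sqmod z)
    = 2 * zx z j * qj.
  rewrite (sum_delta _ (j := j)) ?dot_ex ?eqxx ?mul1r// => b /negbTE bj.
  by rewrite dot_ex bj mul0r mulr0.
have Sy : \sum_b 2 * dot z (delta_mx 0 (rshift n j)) b * partial b (partial k q) (sqmod z)
    = 2 * zy z j * qj.
  rewrite (sum_delta _ (j := j)) ?dot_ey ?eqxx ?mul1r// => b /negbTE bj.
  by rewrite dot_ey bj mul0r mulr0.
rewrite Sx Sy !mxE !eqxx /= eq_lshift eq_rshift eq_lrshift eq_rlshift [k == j]eq_sym.
rewrite [X in 2^-1 * X](_ : _ = ((2 * (qj * (zx z j * zx z k + zy z j * zy z k)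
       + (j == k)%:R * q1)) +i* (2 * (qj * (zx z j * zy z k - zy z j * zx z k))))%C).
  by rewrite half_complex !mulKf// pnatr_eq0.
by apply/eqP; rewrite eq_complex /=; apply/andP; split; apply/eqP; ring.
Unshelve. all: by end_near. Qed.

End Geometry.

Section Forms.
Context {R : realType}.
Variable n : nat.
Local Notation V := 'rV[R]_(n + n).
Local Notation zx z j := (z 0 (lshift n j)).
Local Notation zy z j := (z 0 (rshift n j)).
Implicit Types (z w u v : V) (Phi : V -> R) (q : 'rV[R]_n -> R) (Q P : 'I_n -> V -> R).

Lemma sum_complex (I : Type) (s : seq I) (a b : I -> R) :
  \sum_(i <- s) (a i +i* b i)%C = ((\sum_(i <- s) a i) +i* (\sum_(i <- s) b i))%C.
Proof.
elim: s => [|i s IH]; first by rewrite !big_nil.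
by rewrite !big_cons IH.
Qed.

Lemma half_i_complex (a b : R) :
  ('i / 2)%C * (a +i* b)%C = ((- (2^-1 * b)) +i* (2^-1 * a))%C.
Proof.
rewrite -mulrA half_complex.
by apply/eqP; rewrite eq_complex /=; apply/andP; split; apply/eqP; ring.
Qed.

Lemma dz_dzbarE j k u v : dz_dzbar j k u v =
  ((zx u j * zx v k + zy u j * zy v k - (zx v j * zx u k + zy v j * zy u k)) +i*
   (zy u j * zx v k - zx u j * zy v k - (zy v j * zx u k - zx v j * zy u k)))%C.
Proof.
rewrite /dz_dzbar /zcoord.
by apply/eqP; rewrite eq_complex /=; apply/andP; split; apply/eqP; ring.
Qed.

Lemma dif_cst (c : R) z v : differential (fun _ : V => c) z v = 0.
Proof. exact: (has_diff_cst c z).2. Qed.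

Lemma omega0E z u v : omega0 z u v = (omega_form (fun _ _ => 1) z u v)%:C%C.
Proof.
rewrite /omega0; under eq_bigr do rewrite dz_dzbarE.
rewrite sum_complex half_i_complex /omega_form; congr (_ +i* _)%C.
  rewrite mulr_sumr -sumrN; apply: eq_bigr => j _.
  by rewrite !dif_cst /cross; field.
by rewrite big1 ?mulr0// => j _; ring.
Qed.

Lemma sum_antisym (F : 'I_n -> 'I_n -> R) :
  (forall j k, F k j = - F j k) -> \sum_j \sum_k F j k = 0.
Proof.
move=> FN; set S := LHS; suff : S = - S by move=> ?; lra.
rewrite {1}/S exchange_big /= /S -sumrN; apply: eq_bigr => j _.
by rewrite -sumrN; apply: eq_bigr => k _.
Qed.

Lemma sum_symmetrized (F G : 'I_n -> 'I_n -> R) :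
  (forall j k, F j k + F k j = G j k + G k j) ->
  \sum_j \sum_k F j k = \sum_j \sum_k G j k.
Proof.
move=> FG; apply/eqP; rewrite -subr_eq0 -sumrB; apply/eqP.
under eq_bigr => j _ do rewrite -sumrB.
by apply: sum_antisym => j k; have := FG j k; lra.
Qed.

(** The real part of the hermitian sum cancels because the second derivatives of
[q] commute; the imaginary part matches [omega_form] only after symmetrising both
double sums. *)
Lemma kahler_form_sqmod Phi q z u v :
  (\forall w \near z, Phi w = q (sqmod w)) -> real_analytic_at q (sqmod z) ->
  kahler_form Phi z u v =
    (omega_form (fun a w => partial a q (sqmod w)) z u v)%:C%C.
Proof.
move=> Pq hq; rewrite /kahler_form.
pose H j k := partial j (partial k q) (sqmod z).
have HC j k : H j k = H k j by exact: partialC.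
pose A j k := H j k * (zx z j * zx z k + zy z j * zy z k) + (j == k)%:R * partial k q (sqmod z).
pose B j k := H j k * (zx z j * zy z k - zy z j * zx z k).
pose P j k := zx u j * zx v k + zy u j * zy v k - (zx v j * zx u k + zy v j * zy u k).
pose M j k := zy u j * zx v k - zx u j * zy v k - (zy v j * zx u k - zx v j * zy u k).
have AC j k : A j k = A k j.
  rewrite /A HC eq_sym; case: eqP => [->|_]; first by ring.
  by rewrite !mul0r; ring.
rewrite (eq_bigr (fun j => ((\sum_k (A j k * P j k - B j k * M j k)) +i*
   (\sum_k (A j k * M j k + B j k * P j k)))%C)) => [|j _]; last first.
  rewrite -sum_complex; apply: eq_bigr => k _; rewrite (levi_sqmod j k Pq hq) dz_dzbarE.
  by apply/eqP; rewrite eq_complex /=; apply/andP; split; apply/eqP; rewrite /A /B /P /M /H; ring.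
rewrite sum_complex half_i_complex; congr (_ +i* _)%C; last first.
  rewrite sum_antisym ?mulr0// => j k; rewrite -(AC j k) /B (HC k j) /P /M; ring.
have dq a v' : differential (fun w => partial a q (sqmod w)) z v' =
    \sum_b 2 * dot z v' b * H b a.
  by rewrite (has_diff_comp_sqmod (real_analytic_differentiable (real_analytic_partial a hq))).2.
pose G a b := H a b * (dot z v b * cross u z a + dot z u b * cross z v a)
  + (a == b)%:R * (partial a q (sqmod z) * cross u v a).
have -> : omega_form (fun a w => partial a q (sqmod w)) z u v = \sum_a \sum_b G a b.
  apply: eq_bigr => a _; rewrite !dq /G big_split /=.
  rewrite [X in _ = _ + X](bigD1 a)//= eqxx mul1r [X in _ = _ + (_ + X)]big1 ?addr0; last first.
    by move=> b /negbTE ba; rewrite eq_sym ba mul0r.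
  rewrite !mulr_sumr !mulr_suml -addrA addrC -big_split; congr (_ + _).
  by apply: eq_bigr => b _ /=; rewrite (HC b a); field.
rewrite mulr_sumr -sumrN.
under eq_bigr => j _ do rewrite mulr_sumr -sumrN.
apply: sum_symmetrized => j k; rewrite /G /A /B /P /M (HC k j) [k == j]eq_sym /cross /dot.
by case: eqP => [->|_]; rewrite ?mul1r ?mul0r ?addr0; field.
Qed.

Lemma omega_formB P Q z u v :
  (forall a, differentiable (P a) z) -> (forall a, differentiable (Q a) z) ->
  omega_form (fun a w => P a w - Q a w) z u v = omega_form P z u v - omega_form Q z u v.
Proof.
move=> dP dQ; rewrite /omega_form -sumrB; apply: eq_bigr => a _.
have E x : differential (fun w => P a w - Q a w) z x = differential (P a) z x - differential (Q a) z x.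
  have -> : (fun w => P a w - Q a w) = (fun w => P a w + -1 * Q a w).
    by apply/funext => w; rewrite mulN1r.
  by rewrite (has_diffD (has_diffE (dP a)) (has_diffZ (-1) (has_diffE (dQ a)))).2 mulN1r.
rewrite !E; move: (differential (P a) z u) (differential (P a) z v) => pu pv.
move: (differential (Q a) z u) (differential (Q a) z v) => qu qv.
by ring.
Qed.

Lemma omega_formZ Q c z u v : (forall a, differentiable (Q a) z) ->
  omega_form (fun a w => c * Q a w) z u v = c * omega_form Q z u v.
Proof.
move=> dQ; rewrite /omega_form mulr_sumr; apply: eq_bigr => a _.
rewrite !(has_diffZ c (has_diffE (dQ a))).2.
by move: (differential (Q a) z u) (differential (Q a) z v) => qu qv; ring.
Qed.

Lemma eq_omega_form P Q z u v : (forall a, \forall w \near z, P a w = Q a w) ->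
  (forall a, differentiable (P a) z) -> omega_form P z u v = omega_form Q z u v.
Proof.
move=> PQ dP; apply: eq_bigr => a _.
have [_ E] := has_diff_near (PQ a) (has_diffE (dP a)).
by rewrite !E (nbhs_singleton (PQ a)).
Qed.

Lemma special_coord (c : R) z w j :
  zcoord w j = c%:C%C * zcoord z j <-> zx w j = c * zx z j /\ zy w j = c * zy z j.
Proof.
rewrite /zcoord; split.
  by move=> /eqP; rewrite eq_complex /= !mul0r subr0 addr0 => /andP[/eqP -> /eqP ->].
move=> [-> ->]; apply/eqP; rewrite eq_complex /=.
by apply/andP; split; apply/eqP; ring.
Qed.

(** A special map preserves the angles, so it only rescales [Q_a r_a^2]. *)
Lemma pullback_omega_form (Psi : V -> V) (psi : 'I_n -> V -> R) Q z u v :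
  (forall j, \forall w \near z, zcoord (Psi w) j = (psi j w)%:C%C * zcoord w j) ->
  (forall j, differentiable (psi j) z) -> (forall a, differentiable (Q a) (Psi z)) ->
  [/\ differentiable Psi z,
      forall x j, zx ('d Psi z x) j = psi j z * zx x j + zx z j * differential (psi j) z x /\
                  zy ('d Psi z x) j = psi j z * zy x j + zy z j * differential (psi j) z x &
      omega_form Q (Psi z) ('d Psi z u) ('d Psi z v) =
      omega_form (fun a w => Q a (Psi w) * psi a w ^+ 2) z u v].
Proof.
move=> hPsi dpsi dQ.
have hx j : has_diff (fun w => zx (Psi w) j) z
    (fun x => psi j z * zx x j + zx z j * differential (psi j) z x).
  apply: has_diff_near (has_diffM (has_diffE (dpsi j)) (has_diff_coord (lshift n j) z)).
  near=> w; suff /special_coord[-> _] : zcoord (Psi w) j = (psi j w)%:C%C * zcoord w j by [].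
  by near: w; exact: hPsi.
have hy j : has_diff (fun w => zy (Psi w) j) z
    (fun x => psi j z * zy x j + zy z j * differential (psi j) z x).
  apply: has_diff_near (has_diffM (has_diffE (dpsi j)) (has_diff_coord (rshift n j) z)).
  near=> w; suff /special_coord[_ ->] : zcoord (Psi w) j = (psi j w)%:C%C * zcoord w j by [].
  by near: w; exact: hPsi.
have [dPsi dE] : differentiable Psi z /\ forall x i, ('d Psi z x) 0 i = 'd (fun y => Psi y 0 i) z x.
  by apply: row_differentiable => i; case: (split_ordP i) => j ->; [exact: (hx j).1|exact: (hy j).1].
have dx x j : zx ('d Psi z x) j = psi j z * zx x j + zx z j * differential (psi j) z x.
  by rewrite dE; exact: (hx j).2.
have dy x j : zy ('d Psi z x) j = psi j z * zy x j + zy z j * differential (psi j) z x.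
  by rewrite dE; exact: (hy j).2.
split => //; apply: eq_bigr => a _.
have dQP : has_diff (Q a \o Psi) z (fun x => differential (Q a) (Psi z) ('d Psi z x)).
  split; first exact: (differentiable_comp dPsi (dQ a)).
  by move=> x; exact: (congr1 (fun F : V -> R => F x) (diff_comp dPsi (dQ a))).
have := has_diffM dQP (has_diffM (has_diffE (dpsi a)) (has_diffE (dpsi a))).
have -> : (fun y => (Q a \o Psi) y * (psi a y * psi a y)) = (fun y => Q a (Psi y) * psi a y ^+ 2).
  by apply/funext => y; rewrite expr2.
move=> [_ E]; rewrite !E /cross !dx !dy /=.
have /special_coord[-> ->] := nbhs_singleton (hPsi a).
move: (differential (psi a) z u) (differential (psi a) z v) => pu pv.
move: (differential (Q a) _ _) (differential (Q a) _ _) => qu qv.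
move: (Q a (Psi z)) (psi a z) => q0 p0.
by field.
Unshelve. all: by end_near. Qed.

End Forms.

Section OmegaZero.
Context {R : realType}.
Variable n : nat.
Local Notation V := 'rV[R]_(n + n).
Local Notation zx z j := (z 0 (lshift n j)).
Local Notation zy z j := (z 0 (rshift n j)).
Implicit Types (z w u v : V).

(** The value at [z] of the vector field that generates rotations of the [j]-th
coordinate. *)
Definition rotated z j : V :=
  - zy z j *: delta_mx 0 (lshift n j) + zx z j *: delta_mx 0 (rshift n j).

Lemma rotated_x z j a : zx (rotated z j) a = - ((a == j)%:R * zy z j).
Proof. by rewrite !mxE !eqxx /= eq_lshift eq_lrshift mulr0 addr0 mulNr mulrC. Qed.

Lemma rotated_y z j a : zy (rotated z j) a = (a == j)%:R * zx z j.
Proof. by rewrite !mxE !eqxx /= eq_rlshift eq_rshift mulr0 add0r mulrC. Qed.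

Lemma omega_form_rotated (f : 'I_n -> V -> R) z j :
  omega_form f z z (rotated z j) = (f j z + 2^-1 * differential (f j) z z) * sqmod z 0 j.
Proof.
rewrite /omega_form (bigD1 j)//= big1 ?addr0 => [|a /negbTE aj].
  by rewrite /cross rotated_x rotated_y eqxx mxE !mul1r; ring.
by rewrite /cross rotated_x rotated_y aj !mul0r; ring.
Qed.

Lemma sqmodZ (t : R) z j : sqmod (t *: z) 0 j = t ^+ 2 * sqmod z 0 j.
Proof. by rewrite !mxE; ring. Qed.

(** Evaluated on the position vector and on a rotation field, [omega_form f]
is, up to a factor, the radial derivative of [f_j |z_j|^2], which therefore keeps
its value at the origin, namely zero. *)
Lemma omega_form_eq0 (f : 'I_n -> V -> R) (r : R) :
  (forall z, `|z| < r -> forall j, differentiable (f j) z) ->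
  (forall z, `|z| < r -> forall u v, omega_form f z u v = 0) ->
  forall z, `|z| < r -> forall j, sqmod z 0 j != 0 -> f j z = 0.
Proof.
move=> df f0 z zr j zj.
have tr t : 0 <= t <= 1 -> `|t *: z| < r.
  move=> /andP[t0 t1]; rewrite normrZ ger0_norm//; apply: le_lt_trans zr.
  exact: ler_piMl.
pose h (t : R) := f j (t *: z); pose g : R -> R := id * id * h.
have dh (t : R) : 0 <= t <= 1 -> is_derive t 1 h (differential (f j) (t *: z) z).
  move=> t01; have dfj := df _ (tr t t01) j.
  have hd : is_diff t h ('d (f j) (t *: z) \o ( *:%R ^~ z)).
    by apply: is_diff_comp; exact: differentiableP.
  have [hdf hE] := hd; apply: DeriveDef; first exact: diff_derivable.
  by rewrite deriveE// hE /= scale1r.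
have dg (t : R) : 0 <= t <= 1 -> is_derive t 1 g (2 * t * (h t + 2^-1 * t * differential (f j) (t *: z) z)).
  move=> t01; have := dh t t01 => dht; apply: is_derive_eq.
  rewrite -[LHS]/((t * t) * differential (f j) (t *: z) z + h t * (t * 1 + t * 1)).
  by move: (differential _ _ _) => D; field.
(* Up to [2 t] this derivative is the first factor in [omega_form_rotated] at [t z];
   the second factor is not 0 because [z_j] is not. *)
have dg0 (t : R) : t \in `]0, 1[ -> is_derive t 1 g 0.
  rewrite in_itv /= => /andP[t0 t1]; have t01 : 0 <= t <= 1 by rewrite !ltW.
  have := dg t t01; suff -> : h t + 2^-1 * t * differential (f j) (t *: z) z = 0 by rewrite mulr0.
  have := f0 _ (tr t t01) (t *: z) (rotated (t *: z) j).
  rewrite omega_form_rotated sqmodZ => /eqP; rewrite mulf_eq0 mulf_eq0 (negbTE zj).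
  by rewrite sqrf_eq0 (gt_eqF t0) !orbF /differential linearZ /= mulrA => /eqP.
have cg : {within `[0, 1], continuous g}.
  apply: derivable_within_continuous => t; rewrite in_itv /= => t01.
  by have [] := dg t t01.
have [c _] := MVT ltr01 dg0 cg; rewrite mul0r => /eqP; rewrite subr_eq0.
by rewrite /g !fctE /= !mul0r !mul1r /h scale1r => /eqP.
Qed.

End OmegaZero.

(** * The local dual of a rotation invariant potential *)

Section Dual.
Context {R : realType}.
Variable n : nat.
Local Notation V := 'rV[R]_(n + n).
Local Notation zx z j := (z 0 (lshift n j)).
Local Notation zy z j := (z 0 (rshift n j)).
Local Notation index2 := ({ffun 'I_n -> nat} * {ffun 'I_n -> nat})%type.
Implicit Types (z w : V).

Lemma has_sum_Re (I : choiceType) (f : I -> R[i]) l : has_sum f l ->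
  has_sum (fun i => complex.Re (f i)) (complex.Re l) /\
  has_sum (fun i => complex.Im (f i)) (complex.Im l).
Proof.
move=> hf; have sumE (s : seq I) : \sum_(i <- s) f i =
    ((\sum_(i <- s) complex.Re (f i)) +i* (\sum_(i <- s) complex.Im (f i)))%C.
  by rewrite -sum_complex; apply: eq_bigr => i _; case: (f i).
have key (e : R) : 0 < e -> exists A : {fset I}, forall B : {fset I}, (A `<=` B)%fset ->
    `|\sum_(i <- B) complex.Re (f i) - complex.Re l| < e /\
    `|\sum_(i <- B) complex.Im (f i) - complex.Im l| < e.
  move=> e0; have e0C : 0 < e%:C%C by rewrite ltcR.
  have [A hA] := hf _ e0C; exists A => B /hA; rewrite sumE.
  set x := (_ - _); have xRe : complex.Re x = \sum_(i <- B) complex.Re (f i) - complex.Re l.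
    by rewrite /x; case: (l).
  have xIm : complex.Im x = \sum_(i <- B) complex.Im (f i) - complex.Im l.
    by rewrite /x; case: (l).
  move=> xe; rewrite -xRe -xIm; split.
    by rewrite -ltcR; apply: le_lt_trans xe; apply: normc_ge_Re.
  rewrite -ltcR; apply: le_lt_trans xe.
  by rewrite normc_def lecR -sqrtr_sqr ler_wsqrtr// lerDr sqr_ge0.
by split => e /key[A hA]; exists A => B /hA[].
Qed.

Lemma polar_termZ a (c : R[i]) (x y : 'I_n -> R[i]) (pq : index2) :
  polar_term a (fun j => c * x j) (fun j => c * y j) pq =
  c ^+ (deg pq.1 + deg pq.2) * polar_term a x y pq.
Proof.
have prodE (p : {ffun 'I_n -> nat}) (u : 'I_n -> R[i]) :
    \prod_j (c * u j) ^+ p j = c ^+ deg p * \prod_j u j ^+ p j.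
  rewrite /deg expr_sum -big_split; apply: eq_bigr => j _; exact: exprMn.
by rewrite /polar_term !prodE exprD; ring.
Qed.

Lemma i_exp k (i := 'i%C : R[i]) : [\/ i ^+ k = 1, i ^+ k = i, i ^+ k = -1 | i ^+ k = - i].
Proof.
have ii : i * i = -1 by rewrite -expr2 sqr_i.
elim: k => [|k]; first by constructor 1.
by rewrite exprS => -[] ->; [constructor 2 | constructor 3 | constructor 4 | constructor 1];
  rewrite ?mulr1 ?mulrN ?ii ?mulr1 ?opprK.
Qed.

(** Multiplication by [- i]. *)
Definition over_i z : V := row_mx (\row_j zy z j) (\row_j - zx z j).

Lemma over_i_coord z j : zx (over_i z) j = zy z j /\ zy (over_i z) j = - zx z j.
Proof. by rewrite row_mxEl row_mxEr !mxE. Qed.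

Lemma sqmod_over_i z : sqmod (over_i z) = sqmod z.
Proof. by apply/rowP => j; have [E1 E2] := over_i_coord z j; rewrite [LHS]mxE E1 E2 mxE; ring. Qed.

Lemma norm_over_i z : `|over_i z| <= `|z|.
Proof.
apply: norm_row_le => // i; case: (split_ordP i) => j ->.
  by rewrite (over_i_coord z j).1 coord_le_norm.
by rewrite (over_i_coord z j).2 normrN coord_le_norm.
Qed.

Lemma zcoordZ (t : R) z j : zcoord (t *: z) j = t%:C%C * zcoord z j.
Proof. by apply/special_coord; rewrite !mxE. Qed.

Lemma small_scalar (e : R) : 0 < e -> exists t, [/\ t != 0, `|t| < e & 0 <= t <= 1].
Proof.
move=> e0; have m0 : 0 < Num.min 1 (e / 2) by rewrite lt_min ltr01 divr_gt0.
have [m1 me] : Num.min 1 (e / 2) <= 1 /\ Num.min 1 (e / 2) <= e / 2.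
  by rewrite !ge_min !lexx orbT.
exists (Num.min 1 (e / 2)); split; first by rewrite gt_eqF.
  by rewrite gtr0_norm//; lra.
by rewrite ltW.
Qed.

(** Since [(z, - conj z) = i (z', conj z')] for [z' = - i z], the substitution
[conj z -> - conj z] multiplies the part of degree [k] of the expansion, taken at
[z'], by [i ^ k]. The potential at [z'] only has even degrees, those of
[q (|z|^2)], and [i ^ (2 k) = (- 1) ^ k]. *)
Lemma local_dual_near0 (Phi Phid : V -> R) (q : 'rV[R]_n -> R) (a : index2 -> R[i]) :
  (\forall z \near (0 : V), has_sum (polar_term a (zcoord z) (fun j => (zcoord z j)^*%C)) (Phi z)%:C%C) ->
  (\forall z \near (0 : V),
     has_sum (polar_term a (zcoord z) (fun j => - (zcoord z j)^*%C)) (- Phid z)%:C%C) ->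
  (\forall z \near (0 : V), Phi z = q (sqmod z)) -> real_analytic_at q 0 ->
  \forall z \near (0 : V), Phid z = - q (- sqmod z).
Proof.
move=> /near_norm0P[r1 [r10 H1]] /near_norm0P[r2 [r20 H2]] /near_norm0P[r3 [r30 H3]].
move=> /real_analytic_atP[r4 [N [r40 [c [cN hc]]]]].
apply/near_norm0P; exists (Num.min (Num.min r1 r2) (Num.min r3 (Num.min 1 (r4 / 2)))).
split; first by rewrite !lt_min r10 r20 r30 ltr01 divr_gt0.
move=> z; rewrite !lt_min => /andP[/andP[z1 z2] /andP[z3 /andP[z4 z5]]].
have sq4 j : `|sqmod z 0 j| <= r4.
  rewrite ger0_norm; last by rewrite mxE addr_ge0 ?sqr_ge0.
  have b2 i : z 0 i ^+ 2 <= `|z|.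
    rewrite -real_normK ?num_real// expr2; apply: le_trans (coord_le_norm z i).
    by rewrite ler_piMr// (le_trans (coord_le_norm z i)) ?ltW.
  by rewrite mxE; have := b2 (lshift n j); have := b2 (rshift n j); lra.
pose z' := over_i z.
pose A := polar_term a (zcoord z') (fun j => (zcoord z' j)^*%C).
pose k (pq : index2) := (deg pq.1 + deg pq.2)%N.
have nz' (t : R) : 0 <= t <= 1 -> `|t *: z'| <= `|z|.
  move=> /andP[t0 t1]; rewrite normrZ ger0_norm//; apply: le_trans (norm_over_i z).
  exact: ler_piMl.
(* Along [t |-> t z'] the terms of total degree [k] scale by [t ^ k]. *)
have HA (t : R) : 0 <= t <= 1 ->
    has_sum (fun pq => complex.Re (A pq) * t ^+ k pq) (q (\row_j (t ^+ 2 * sqmod z 0 j))) /\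
    has_sum (fun pq => complex.Im (A pq) * t ^+ k pq) 0.
  move=> t01; have tz := nz' t t01.
  have := H1 (t *: z') (le_lt_trans tz z1).
  rewrite H3; last exact: le_lt_trans tz z3.
  have -> : sqmod (t *: z') = \row_j (t ^+ 2 * sqmod z 0 j).
    by apply/rowP => j; rewrite sqmodZ sqmod_over_i [RHS]mxE.
  have -> : polar_term a (zcoord (t *: z')) (fun j => (zcoord (t *: z') j)^*%C) =
      (fun pq => (t ^+ k pq)%:C%C * A pq).
    have eC j : (zcoord (t *: z') j)^*%C = t%:C%C * (zcoord z' j)^*%C.
      rewrite zcoordZ /zcoord; apply/eqP; rewrite eq_complex /=.
      by apply/andP; split; apply/eqP; ring.
    apply/funext => pq; rewrite rmorphXn -polar_termZ.
    by congr polar_term; apply/funext => j; [exact: zcoordZ | exact: eC].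
  move=> /has_sum_Re[hR hI]; split.
    by apply: eq_has_sum hR => pq; case: (A pq) => x y /=; ring.
  by apply: eq_has_sum hI => pq; case: (A pq) => x y /=; ring.
have [hR1 hI1] := HA 1 (introT andP (conj ler01 (lexx 1))).
have [N1 bR] := has_sum_abs_bounded hR1; have [N2 bI] := has_sum_abs_bounded hI1.
have one0 (j : nat) : (0 : R) < 1 := ltr01.
have bR1 : abs_bounded (fun pq => complex.Re (A pq) * (fun=> 1 : R) (k pq)) N1.
  by apply: abs_bounded_le bR => pq /=; rewrite expr1n.
have bI1 : abs_bounded (fun pq => complex.Im (A pq) * (fun=> 1 : R) (k pq)) N2.
  by apply: abs_bounded_le bI => pq /=; rewrite expr1n.
have [D [_ DN hD]] := @has_sum_regroup R _ _ k (fun pq => complex.Re (A pq)) (fun=> 1) N1 one0 bR1.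
have [E [_ EN hE]] := @has_sum_regroup R _ _ k (fun pq => complex.Im (A pq)) (fun=> 1) N2 one0 bI1.
pose g (p : {ffun 'I_n -> nat}) := c p * mono (fun j => sqmod z 0 j) p.
have bg : abs_bounded (fun p => g p * (fun=> 1 : R) (2 * deg p)%N) N.
  apply: abs_bounded_le cN => p; rewrite mulr1 /g !normrM ler_wpM2l//.
  by rewrite [leRHS]ger0_norm ?exprn_ge0 ?(ltW r40)//; apply: mono_le.
have [D' [_ DN' hD']] := @has_sum_regroup R _ _ (fun p => (2 * deg p)%N) g (fun=> 1) N one0 bg.
have t1 (t : R) : 0 <= t <= 1 -> forall j, `|t ^+ j| <= 1.
  by move=> /andP[t0 tle] j; rewrite normrX ger0_norm// exprn_ile1.
(* The imaginary parts cancel in every degree, since the potential is real. *)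
have EE : forall j, E j = 0.
  apply: (@has_sum_exp_eq0 R E 1 N2 ltr01).
    by apply: abs_bounded_le EN => j; rewrite expr1n.
  move=> e /small_scalar[t [t0 te t01]]; exists t; split => //.
  by apply/hE; [exact: t1 | exact: (HA t t01).2].
(* In every degree the real parts agree with those of [q (t^2 |z|^2)]. *)
have DD : forall j, D j - D' j = 0.
  apply: (@has_sum_exp_eq0 R (fun j => D j - D' j) 1 (N1 + N) ltr01).
    have := abs_boundedD DN (_ : abs_bounded (fun j => - D' j * 1) N).
    move=> h; apply: abs_bounded_le (h _) => [j|]; first by rewrite expr1n mulrBl mulNr.
    by apply: abs_bounded_le DN' => j; rewrite mulNr normrN.
  move=> e /small_scalar[t [t0 te t01]]; exists t; split => //.
  have h1 : has_sum (fun j => D j * t ^+ j) (q (\row_j (t ^+ 2 * sqmod z 0 j))).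
    by apply/hD; [exact: t1 | exact: (HA t t01).1].
  have h2 : has_sum (fun j => D' j * t ^+ j) (q (\row_j (t ^+ 2 * sqmod z 0 j))).
    apply/hD'; first exact: t1.
    have := hc (fun j => t ^+ 2 * sqmod z 0 j).
    rewrite add0r => /(_ _); have small j : `|t ^+ 2 * sqmod z 0 j| <= r4.
      rewrite normrM; apply: le_trans (sq4 j); apply: ler_piMl => //; exact: t1.
    move=> /(_ small); apply: eq_has_sum => p.
    by rewrite mono_mul mono_cst -exprM /g; ring.
  by have := has_sumB h1 h2; rewrite subrr; apply: eq_has_sum => j; rewrite mulrBl.
pose w1 j := complex.Re ('i ^+ j : R[i])%C; pose w2 j := complex.Im ('i ^+ j : R[i])%C.
have w1_le j : `|w1 j| <= 1.
  by rewrite /w1; case: (i_exp j) => -> /=; rewrite ?normr0 ?normrN ?normr1 ?normr0.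
have w2_le j : `|w2 j| <= 1.
  by rewrite /w2; case: (i_exp j) => -> /=; rewrite ?oppr0 ?normrN ?normr0 ?normr1.
have w1_even j : w1 (2 * j)%N = (-1) ^+ j.
  rewrite /w1 exprM sqr_i -[X in complex.Re (X ^+ _)](rmorphN1 (real_complex R)).
  by rewrite -rmorphXn.
have hq : has_sum (fun p => g p * w1 (2 * deg p)%N) (q (- sqmod z)).
  have := hc (fun j => - sqmod z 0 j); have small j : `|- sqmod z 0 j| <= r4 by rewrite normrN.
  move=> /(_ small); rewrite add0r.
  have -> : \row_j - sqmod z 0 j = - sqmod z by apply/rowP => j; rewrite !mxE.
  apply: eq_has_sum => p; rewrite w1_even.
  have -> : (fun j => - sqmod z 0 j) = (fun j => -1 * sqmod z 0 j).
    by apply/funext => j; rewrite mulN1r.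
  by rewrite mono_mul mono_cst /g; ring.
have hRe : has_sum (fun pq => complex.Re (A pq) * w1 (k pq)) (q (- sqmod z)).
  apply/hD => //; have /hD'-/(_ w1_le) : has_sum (fun p => g p * w1 (2 * deg p)%N) (q (- sqmod z)) := hq.
  by apply: eq_has_sum => j; have /eqP := DD j; rewrite subr_eq0 => /eqP ->.
have hIm : has_sum (fun pq => complex.Im (A pq) * w2 (k pq)) 0.
  by apply/hE => //; apply: eq_has_sum (has_sum0 _) => j; rewrite EE mul0r.
have := H2 z z2 => /has_sum_Re[] /= hP _.
have := has_sumB hRe hIm; rewrite subr0 => hP'.
suff : - Phid z = q (- sqmod z) by move=> <-; rewrite opprK.
apply: has_sum_unique hP _; apply: eq_has_sum hP' => pq.
have -> : polar_term a (zcoord z) (fun j => - (zcoord z j)^*%C) pq = ('i ^+ k pq * A pq)%C.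
  rewrite -polar_termZ; have [E1 E2] : (forall j, zcoord z j = 'i%C * zcoord z' j) /\
      (forall j, - (zcoord z j)^*%C = 'i%C * (zcoord z' j)^*%C).
    split => j; have [E1 E2] := over_i_coord z j; rewrite /zcoord /z' E1 E2;
    by apply/eqP; rewrite eq_complex /=; apply/andP; split; apply/eqP; ring.
  by congr polar_term; apply/funext => j.
by rewrite /w1 /w2; case: (A pq) => x y; case: ('i ^+ _)%C => s t /=; ring.
Qed.

End Dual.

(** * Special symplectic maps *)

Section SpecialMaps.
Context {R : realType}.
Variable n : nat.
Local Notation V := 'rV[R]_(n + n).
Local Notation zx z j := (z 0 (lshift n j)).
Local Notation zy z j := (z 0 (rshift n j)).
Implicit Types (z w u v : V) (Phi : V -> R) (q : 'rV[R]_n -> R) (Psi : V -> V)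
  (psi : 'I_n -> V -> R) (U : set V) (lambda : R).

Lemma open_near (T : topologicalType) (U : set T) x : open U -> U x -> \forall y \near x, U y.
Proof. by move=> oU Ux; apply: open_nbhs_nbhs. Qed.

Lemma sqmod0 : sqmod (0 : V) = 0.
Proof. by apply/rowP => j; rewrite !mxE; ring. Qed.

Lemma near_sqmod q : (\forall x \near (0 : 'rV[R]_n), real_analytic_at q x) ->
  \forall z \near (0 : V), real_analytic_at q (sqmod z).
Proof. by move=> hq; apply: sqmod_continuous; rewrite sqmod0. Qed.

Lemma special_near U Psi psi z : open U -> special_factors U Psi psi -> U z ->
  (forall j, \forall w \near z, zcoord (Psi w) j = (psi j w)%:C%C * zcoord w j) /\
  (forall j, differentiable (psi j) z).
Proof.
move=> oU hs Uz; split => j; last by apply: real_analytic_differentiable; apply: (hs j).1.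
by apply: filterS (open_near oU Uz) => w; apply: (hs j).2.
Qed.

Lemma pullback_omega0 U Psi psi z u v : open U -> special_factors U Psi psi -> U z ->
  pullback Psi (@omega0 R n) z u v = (omega_form (fun a w => psi a w ^+ 2) z u v)%:C%C.
Proof.
move=> oU hs Uz; have [h1 h2] := special_near oU hs Uz.
rewrite /pullback omega0E.
have [|_ _ ->] := @pullback_omega_form _ _ Psi psi (fun _ _ => 1) z u v h1 h2.
  by move=> a; exact: (has_diff_cst _ _).1.
by congr (omega_form _ _ _ _)%:C%C; apply/funext => a; apply/funext => w; rewrite mul1r.
Qed.

Lemma differentiable_sqr (f : V -> R) z : differentiable f z -> differentiable (fun w => f w ^+ 2) z.
Proof.
move=> df; have := (has_diffM (has_diffE df) (has_diffE df)).1.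
by congr (differentiable _ _); apply/funext => w; rewrite expr2.
Qed.

(** The condition [Psi^* omega0 = lambda omega] near the origin says that the
[omega_form] of [psi_j^2 - lambda q_j] vanishes. *)
Lemma special_factor_near0 U Phi q Psi psi lambda :
  open U -> U 0 -> (forall z, U z -> Phi z = q (sqmod z)) ->
  (\forall x \near (0 : 'rV[R]_n), real_analytic_at q x) ->
  special_factors U Psi psi ->
  form_eq_on U (pullback Psi (@omega0 R n)) (scale_form lambda (kahler_form Phi)) ->
  \forall z \near (0 : V), forall j, sqmod z 0 j != 0 ->
    psi j z ^+ 2 = lambda * partial j q (sqmod z).
Proof.
move=> oU U0 Pq hq hs hform.
have : \forall z \near (0 : V), U z /\ real_analytic_at q (sqmod z).
  by near=> z; split; near: z; [exact: (open_near oU U0) | exact: near_sqmod].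
move=> /near_norm0P[r [r0 hr]]; apply/near_norm0P; exists r; split => // z zr j zj.
apply/eqP; rewrite -subr_eq0; apply/eqP.
have dpsi w : `|w| < r -> forall a, differentiable (fun x => psi a x ^+ 2) w.
  move=> wr a; have [Uw _] := hr w wr.
  by apply: differentiable_sqr; apply: (special_near oU hs Uw).2.
have dq w : `|w| < r -> forall a, differentiable (fun x => partial a q (sqmod x)) w.
  move=> wr a; have [_ qw] := hr w wr.
  apply: real_analytic_differentiable; apply: real_analytic_comp_sqmod.
  exact: real_analytic_partial.
have dlq w : `|w| < r -> forall a, differentiable (fun x => lambda * partial a q (sqmod x)) w.
  by move=> wr a; apply: (has_diffZ lambda (has_diffE (dq w wr a))).1.
apply: (@omega_form_eq0 _ _ (fun a w => psi a w ^+ 2 - lambda * partial a q (sqmod w)) r) zj.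
- move=> w wr a.
  have := (has_diffD (has_diffE (dpsi w wr a)) (has_diffZ (-1) (has_diffE (dlq w wr a)))).1.
  by congr (differentiable _ _); apply/funext => x; rewrite mulN1r.
- move=> w wr u v; have [Uw qw] := hr w wr.
  rewrite (omega_formB _ _ (dpsi w wr) (dlq w wr)) (omega_formZ _ _ _ (dq w wr)).
  have := hform w Uw u v; rewrite (pullback_omega0 _ _ oU hs Uw) /scale_form.
  rewrite (kahler_form_sqmod u v _ qw); last first.
    by apply: filterS (open_near oU Uw) => x; apply: Pq.
  by rewrite -rmorphM => /complexI ->; rewrite subrr.
- exact: zr.
Unshelve. all: by end_near. Qed.

Definition radial z j : V :=
  zx z j *: delta_mx 0 (lshift n j) + zy z j *: delta_mx 0 (rshift n j).

(** Half the radial derivative of the potential in the [j]-th coordinate. It equals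
[|z_j|^2 q_j(x)] where [q] is differentiable, but it makes sense on the whole
domain of the potential, where nothing is known about [q] beyond its values. *)
Definition moment Phi j z : R :=
  2^-1 * (zx z j * partial (lshift n j) Phi z + zy z j * partial (rshift n j) Phi z).

Lemma moment_radial Phi j z : differentiable Phi z -> moment Phi j z = 2^-1 * 'D_(radial z j) Phi z.
Proof.
move=> dP; rewrite deriveE// linearD !linearZ /moment; congr (_ * (_ * _ + _ * _));
by rewrite /partial deriveE.
Qed.

Lemma real_analytic_moment Phi j z : real_analytic_at Phi z -> real_analytic_at (moment Phi j) z.
Proof.
move=> hP; apply: real_analyticZ; apply: real_analyticD; apply: real_analyticM;
  by [exact: real_analytic_coord | exact: real_analytic_partial].
Qed.

Lemma moment_sqmod Phi q j z : (\forall w \near z, Phi w = q (sqmod w)) ->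
  differentiable q (sqmod z) -> moment Phi j z = sqmod z 0 j * partial j q (sqmod z).
Proof.
move=> Pq dq; have [Ex Ey] := partial_comp_sqmod j dq.
by rewrite /moment {1 2}/partial !(near_eq_derive _ Pq) -!/(partial _ _ _) Ex Ey mxE; field.
Qed.

(** The equality of two-forms only involves a neighbourhood of the origin; it
propagates to all of [U] because both sides are analytic there. *)
Lemma special_factor_moment U Phi q Psi psi lambda :
  open U -> connected U -> U 0 -> (forall z, U z -> Phi z = q (sqmod z)) ->
  real_analytic_on U Phi ->
  (\forall x \near (0 : 'rV[R]_n), real_analytic_at q x) ->
  special_factors U Psi psi ->
  form_eq_on U (pullback Psi (@omega0 R n)) (scale_form lambda (kahler_form Phi)) ->
  forall z, U z -> forall j, psi j z ^+ 2 * sqmod z 0 j = lambda * moment Phi j z.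
Proof.
move=> oU cU U0 Pq hP hq hs hform z Uz j; apply/eqP; rewrite -subr_eq0; apply/eqP.
apply: (@real_analytic_identity _ _ U
  (fun w => psi j w ^+ 2 * sqmod w 0 j - lambda * moment Phi j w) 0) => //.
  move=> w Uw; apply: real_analyticB; last by apply/real_analyticZ/real_analytic_moment/hP.
  apply: real_analyticM; last exact: real_analytic_sqmod.
  have := real_analyticM ((hs j).1 w Uw) ((hs j).1 w Uw).
  by congr real_analytic_at; apply/funext => x; rewrite expr2.
near=> w.
have Uw : U w by near: w; exact: (open_near oU U0).
have qw : real_analytic_at q (sqmod w) by near: w; exact: near_sqmod.
rewrite (@moment_sqmod _ q); last 2 first.
- by apply: filterS (open_near oU Uw) => x; apply: Pq.
- exact: real_analytic_differentiable.
have [->|sj] := eqVneq (sqmod w 0 j) 0; first by rewrite mulr0 mul0r mulr0 subrr.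
suff -> : psi j w ^+ 2 = lambda * partial j q (sqmod w) by ring.
move: j sj {Uw qw}; near: w.
exact: (special_factor_near0 oU U0 Pq hq hs hform).
Unshelve. all: by end_near. Qed.

(** Where [psi_j] vanishes, the [j]-th component of the differential only takes
real multiples of [z_j], so it cannot be onto. *)
Lemma special_factor_neq0 U Ud Psi psi : open U -> open Ud -> special_factors U Psi psi ->
  diffeomorphism_on U Ud Psi -> forall z, U z -> forall j, psi j z != 0.
Proof.
move=> oU oUd hs [G [hF hG sF sG]] z Uz j; apply/negP => /eqP pz.
have [h1 h2] := special_near oU hs Uz.
have [|dPsi dE _] := @pullback_omega_form _ _ Psi psi (fun _ _ => 1) z 0 0 h1 h2.
  by move=> a; exact: (has_diff_cst _ _).1.
have [UdF GF] := hF z Uz.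
have [dG _] : differentiable G (Psi z) /\ forall v i, ('d G (Psi z) v) 0 i =
    'd (fun y => G y 0 i) (Psi z) v.
  by apply: row_differentiable => i; exact: (sG i [::] _ UdF).
have dPsi' : differentiable Psi (G (Psi z)) by rewrite GF.
have surj w : 'd Psi z ('d G (Psi z) w) = w.
  have E := congr1 (fun F : V -> V => F w) (diff_comp dG dPsi'); rewrite /= GF in E.
  rewrite -E -deriveE; last exact: (differentiable_comp dG dPsi').
  rewrite (@near_eq_derive _ _ _ _ id) ?derive_id//.
  by apply: filterS (open_near oUd UdF) => y /hG[].
have {dE surj} [D [DG [DDG DE]]] : exists D DG : V -> V, (forall w, D (DG w) = w) /\
    forall x, exists c, zx (D x) j = psi j z * zx x j + zx z j * c /\
                        zy (D x) j = psi j z * zy x j + zy z j * c.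
  exists ('d Psi z), ('d G (Psi z)); split => // x; exists (differential (psi j) z x).
  exact: dE.
have {DE} eqc w : exists c, zx w j = zx z j * c /\ zy w j = zy z j * c.
  by have [c] := DE (DG w); rewrite DDG pz !mul0r !add0r; exists c.
have zy0 : zy z j = 0.
  have [c []] := eqc (delta_mx 0 (lshift n j)); rewrite !mxE !eqxx /= eq_rlshift.
  move=> cx /esym/eqP; rewrite mulf_eq0 => /orP[/eqP //|/eqP c0].
  by move: cx; rewrite c0 mulr0 => /eqP; rewrite oner_eq0.
have [c [_]] := eqc (delta_mx 0 (rshift n j)); rewrite !mxE !eqxx /= zy0 mul0r.
by move=> /eqP; rewrite oner_eq0.
Qed.

Lemma connected_sign (U : set V) (f : V -> R) : open U -> connected U -> U 0 ->
  real_analytic_on U f -> (forall z, U z -> f z != 0) ->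
  forall z, U z -> 0 < f z * f 0.
Proof.
move=> oU cU U0 cf f0 z Uz.
have pos_near w : U w -> 0 < f w * f 0 -> \forall x \near w, 0 < f x * f 0.
  move=> Uw fw; have := differentiable_continuous (real_analytic_differentiable
    (real_analyticM (cf w Uw) (real_analytic_cst (f 0) w))).
  by move=> /(_ _ (open_nbhs_nbhs (conj (@open_gt R 0) fw))).
have neg_near w : U w -> f w * f 0 < 0 -> \forall x \near w, f x * f 0 < 0.
  move=> Uw fw; have := differentiable_continuous (real_analytic_differentiable
    (real_analyticM (cf w Uw) (real_analytic_cst (f 0) w))).
  by move=> /(_ _ (open_nbhs_nbhs (conj (@open_lt R 0) fw))).
pose P := interior [set w | 0 < f w * f 0].
pose N := interior [set w | f w * f 0 < 0].
suff UP : U `&` P = U by move: Uz; rewrite -{1}UP => -[_ /interior_subset].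
apply: cU.
- exists 0; split => //; apply: pos_near => //.
  by rewrite -expr2 exprn_even_gt0//= f0.
- by exists P => //; exact: open_interior.
exists (~` N); first by apply: open_closedC; exact: open_interior.
apply/seteqP; split => w [Uw hw]; split => //.
  by move=> /interior_subset /= h; have := interior_subset hw; rewrite /= lt_gtF.
apply: pos_near => //; rewrite lt_neqAle eq_sym mulf_neq0 ?f0//= leNgt.
by apply/negP => h; apply: hw; exact: neg_near.
Qed.

(** Radial displacements of two points with equal moduli again have equal moduli,
so the two difference quotients coincide. *)
Lemma moment_invariant (M : set V) Phi q z z' j : open M -> real_analytic_on M Phi ->
  (forall z, M z -> Phi z = q (sqmod z)) -> M z -> M z' -> sqmod z = sqmod z' ->
  moment Phi j z = moment Phi j z'.
Proof.
move=> oM hP Pq Mz Mz' zz'.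
rewrite (moment_radial _ (real_analytic_differentiable (hP z Mz))).
rewrite (moment_radial _ (real_analytic_differentiable (hP z' Mz'))).
have lineE w : 'D_(radial w j) Phi w = 'D_1 (fun h : R => Phi (h *: radial w j + w)) 0.
  rewrite /derive; set d := (fun _ : R => _); set d' := (fun _ : R => _).
  set d'' := (X in _ = lim (X @ _)); suff -> : d' = d'' by [].
  apply/funext => h; rewrite /d /d' /d'' /d /=.
  by rewrite scale0r add0r addr0 [h%:A]mulr1.
have near_line w : M w -> \forall h \near (0 : R), M (h *: radial w j + w).
  move=> Mw; have c : {for 0, continuous (fun h : R => h *: radial w j + w)}.
    by apply: cvgD; [apply: cvgZr_tmp; exact: cvg_id | exact: cvg_cst].
  by apply: c; rewrite scale0r add0r; exact: (open_near oM Mw).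
rewrite !lineE; congr (_ * _); apply: near_eq_derive; near=> h.
have Mh : M (h *: radial z j + z) by near: h; exact: near_line.
have Mh' : M (h *: radial z' j + z') by near: h; exact: near_line.
rewrite !Pq//; congr q; apply/rowP => i.
have sE w : sqmod (h *: radial w j + w) 0 i = sqmod w 0 i * (1 + h * (i == j)%:R) ^+ 2.
  rewrite !mxE !eqxx /= eq_lshift eq_lrshift eq_rshift eq_rlshift !mulr0 !addr0 !add0r.
  by case: eqP => [->|_]; rewrite /= ?mulr1n ?mulr0n; ring.
by rewrite !sE zz'.
Unshelve. all: by end_near. Qed.

End SpecialMaps.

Section Consequences.
Context {R : realType}.
Variable n : nat.
Local Notation V := 'rV[R]_(n + n).
Local Notation zx z j := (z 0 (lshift n j)).
Local Notation zy z j := (z 0 (rshift n j)).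
Implicit Types (z w u v : V) (Phi Phid : V -> R) (q : 'rV[R]_n -> R) (Psi : V -> V)
  (psi : 'I_n -> V -> R) (U M Md : set V) (lambda : R).

Lemma sqmod_eq0 z j : sqmod z 0 j = 0 -> zx z j = 0 /\ zy z j = 0.
Proof.
rewrite mxE => /eqP; rewrite paddr_eq0 ?sqr_ge0// !sqrf_eq0.
by move=> /andP[/eqP -> /eqP ->].
Qed.

Lemma sqr_eq_sign (a b a0 b0 : R) : a ^+ 2 = b ^+ 2 -> 0 < a * a0 -> 0 < b * b0 ->
  b = (-1) ^+ (a0 * b0 < 0)%R * a.
Proof.
move=> /eqP; rewrite eqf_sqr => ab aa bb.
have pos : 0 < (a * b) * (a0 * b0) by rewrite mulrACA mulr_gt0.
have a_neq : a != 0 by apply/eqP => a0'; rewrite a0' mul0r ltxx in aa.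
case/orP: ab => /eqP E; subst a.
  have b2 : 0 < b * b by rewrite -expr2 exprn_even_gt0.
  by rewrite pmulr_rgt0// in pos; rewrite (lt_gtF pos) mul1r.
have b2 : 0 < b * b by rewrite -expr2 exprn_even_gt0//= -oppr_eq0.
rewrite mulNr mulNr oppr_gt0 pmulr_rlt0// in pos; first by rewrite pos mulN1r opprK.
Qed.

Lemma special_factor_sign U Ud Psi psi : open U -> open Ud -> connected U -> U 0 ->
  special_factors U Psi psi -> diffeomorphism_on U Ud Psi ->
  forall z, U z -> forall j, 0 < psi j z * psi j 0.
Proof.
move=> oU oUd cU U0 hs hd z Uz j; apply: (@connected_sign _ _ U) => //.
  exact: (hs j).1.
by move=> w Uw; apply: (special_factor_neq0 oU oUd hs hd).
Qed.

(** On [U] the square of each factor is a function of the moduli and its sign is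
constant; at points with [z_j = 0] one passes to the limit. *)
Lemma special_factor_invariant M U Ud Phi q Psi psi lambda :
  open M -> real_analytic_on M Phi -> (forall z, M z -> Phi z = q (sqmod z)) -> U `<=` M ->
  (\forall x \near (0 : 'rV[R]_n), real_analytic_at q x) ->
  open U -> open Ud -> connected U -> U 0 ->
  special_factors U Psi psi -> diffeomorphism_on U Ud Psi ->
  form_eq_on U (pullback Psi (@omega0 R n)) (scale_form lambda (kahler_form Phi)) ->
  forall z z', U z -> U z' -> sqmod z = sqmod z' -> forall j, psi j z = psi j z'.
Proof.
move=> oM hP Pq UM hq oU oUd cU U0 hs hd hform.
have mom := special_factor_moment oU cU U0 (fun z Uz => Pq z (UM z Uz))
  (fun z Uz => hP z (UM z Uz)) hq hs hform.
have sgn := special_factor_sign oU oUd cU U0 hs hd.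
have inv z z' j : U z -> U z' -> sqmod z = sqmod z' -> sqmod z 0 j != 0 -> psi j z = psi j z'.
  move=> Uz Uz' zz' zj.
  have sq : psi j z ^+ 2 = psi j z' ^+ 2.
    apply: (mulIf zj); rewrite (mom z Uz) [in RHS]zz' (mom z' Uz'); congr (_ * _).
    exact: (moment_invariant j oM hP Pq (UM z Uz) (UM z' Uz') zz').
  have := sqr_eq_sign sq (sgn z Uz j) (sgn z' Uz' j).
  rewrite ltNge -expr2 sqr_ge0 /= mul1r => //.
move=> z z' Uz Uz' zz' j.
have [zj|zj] := eqVneq (sqmod z 0 j) 0; last exact: inv.
have [zx0 zy0] := sqmod_eq0 zj; have [zx0' zy0'] : zx z' j = 0 /\ zy z' j = 0.
  by apply: sqmod_eq0; rewrite -zz'.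
pose e : V := delta_mx 0 (lshift n j).
have near_line w : U w -> \forall h \near (0 : R), U (h *: e + w).
  move=> Uw; have c : {for 0, continuous (fun h : R => h *: e + w)}.
    by apply: cvgD; [apply: cvgZr_tmp; exact: cvg_id | exact: cvg_cst].
  by apply: c; rewrite scale0r add0r; exact: (open_near oU Uw).
have cont w : U w -> {for 0, continuous (fun h : R => psi j (h *: e + w))}.
  move=> Uw; have c : {for 0, continuous (fun h : R => h *: e + w)}.
    by apply: cvgD; [apply: cvgZr_tmp; exact: cvg_id | exact: cvg_cst].
  apply: (continuous_comp c); rewrite /= scale0r add0r.
  by apply/differentiable_continuous/real_analytic_differentiable/(hs j).1.
have sqE w h i : zx w j = 0 -> zy w j = 0 ->
    sqmod (h *: e + w) 0 i = if i == j then h ^+ 2 else sqmod w 0 i.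
  move=> wx wy; rewrite !mxE !eqxx /= eq_lshift eq_rlshift !mulr0 !add0r.
  by case: eqP => [->|_]; rewrite ?wx ?wy /= ?mulr1n ?mulr0n; ring.
have c0 : psi j (0 *: e + z) = psi j z by rewrite scale0r add0r.
have c0' : psi j (0 *: e + z') = psi j z' by rewrite scale0r add0r.
apply/eqP; rewrite -subr_eq0 -normr_le0; apply/ler_addgt0Pl => d d0; rewrite addr0.
have d20 : 0 < d / 2 by rewrite divr_gt0.
(* Moving off the hyperplane [z_j = 0] in the same direction keeps the moduli equal. *)
have near_all : \forall h \near (0 : R), [/\ U (h *: e + z), U (h *: e + z'),
    `|psi j z - psi j (h *: e + z)| <= d / 2 & `|psi j z' - psi j (h *: e + z')| <= d / 2].
  have /cvgrPdist_le/(_ _ d20) nz := cont z Uz; have /cvgrPdist_le/(_ _ d20) nz' := cont z' Uz'.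
  rewrite scale0r add0r in nz; rewrite scale0r add0r in nz'.
  near=> h; split; near: h; [exact: near_line | exact: near_line | exact: nz | exact: nz'].
have /nbhs_ballP[r /= r0 hr] := near_all.
have /hr[U1 U2 d1 d2] : ball (0 : R) r (r / 2).
  rewrite -ball_normE /= sub0r normrN gtr0_norm ?divr_gt0//.
  by rewrite ltr_pdivrMr// ltr_pMr// ltr1n.
have E : psi j ((r / 2) *: e + z) = psi j ((r / 2) *: e + z').
  apply: inv => //.
    by apply/rowP => i; rewrite !sqE// zz'.
  by rewrite sqE// eqxx sqrf_eq0 gt_eqF// divr_gt0.
rewrite (_ : psi j z - psi j z' = (psi j z - psi j ((r / 2) *: e + z)) -
   (psi j z' - psi j ((r / 2) *: e + z'))); last by rewrite E; ring.
by rewrite (le_trans (ler_normB _ _))// [leRHS]splitr lerD.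
Unshelve. all: by end_near. Qed.

(** The squares of the factors agree where both are defined, and on each domain the
sign of a factor is its sign at the origin. *)
Lemma special_factor_unique M U1 Ud1 U2 Ud2 Phi q Psi1 Psi2 psi1 psi2 lambda :
  open M -> real_analytic_on M Phi -> (forall z, M z -> Phi z = q (sqmod z)) ->
  U1 `<=` M -> U2 `<=` M ->
  (\forall x \near (0 : 'rV[R]_n), real_analytic_at q x) ->
  open U1 -> open Ud1 -> connected U1 -> U1 0 ->
  open U2 -> open Ud2 -> connected U2 -> U2 0 ->
  special_factors U1 Psi1 psi1 -> diffeomorphism_on U1 Ud1 Psi1 ->
  special_factors U2 Psi2 psi2 -> diffeomorphism_on U2 Ud2 Psi2 ->
  form_eq_on U1 (pullback Psi1 (@omega0 R n)) (scale_form lambda (kahler_form Phi)) ->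
  form_eq_on U2 (pullback Psi2 (@omega0 R n)) (scale_form lambda (kahler_form Phi)) ->
  forall z, U1 z -> U2 z -> forall j,
    zcoord (Psi2 z) j = (-1) ^+ (psi1 j 0 * psi2 j 0 < 0)%R * zcoord (Psi1 z) j.
Proof.
move=> oM hP Pq UM1 UM2 hq oU1 oUd1 cU1 U10 oU2 oUd2 cU2 U20 hs1 hd1 hs2 hd2 f1 f2 z z1 z2 j.
have m1 := special_factor_moment oU1 cU1 U10 (fun z Uz => Pq z (UM1 z Uz))
  (fun z Uz => hP z (UM1 z Uz)) hq hs1 f1 z1 j.
have m2 := special_factor_moment oU2 cU2 U20 (fun z Uz => Pq z (UM2 z Uz))
  (fun z Uz => hP z (UM2 z Uz)) hq hs2 f2 z2 j.
rewrite ((hs1 j).2 z z1) ((hs2 j).2 z z2).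
have [zj|zj] := eqVneq (sqmod z 0 j) 0.
  by have [zx0 zy0] := sqmod_eq0 zj; rewrite /zcoord zx0 zy0 !mulr0.
have sq : psi1 j z ^+ 2 = psi2 j z ^+ 2 by apply: (mulIf zj); rewrite m1 m2.
have s1 := special_factor_sign oU1 oUd1 cU1 U10 hs1 hd1 z1 j.
have s2 := special_factor_sign oU2 oUd2 cU2 U20 hs2 hd2 z2 j.
by rewrite (sqr_eq_sign sq s1 s2) mulrA rmorphM rmorph_sign.
Qed.

End Consequences.

(** * The duality equations *)

Section Equations.
Context {R : realType}.
Variable n : nat.
Local Notation V := 'rV[R]_(n + n).
Local Notation zx z j := (z 0 (lshift n j)).
Local Notation zy z j := (z 0 (rshift n j)).
Implicit Types (z w u v : V) (x y : 'rV[R]_n) (Phi Phid : V -> R) (q : 'rV[R]_n -> R)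
  (Psi : V -> V) (psi : 'I_n -> V -> R) (U M Md : set V) (lambda : R).

(** The function associated to the local dual. *)
Definition dual_function q y : R := - q (- y).

Lemma real_analytic_comp_opp q y : real_analytic_at q (- y) ->
  real_analytic_at (fun x => q (- x)) y.
Proof.
have rowE x : \row_i (-1 * x 0 i) = - x by apply/rowP => i; rewrite !mxE mulN1r.
move=> hq; have := @real_analytic_comp _ _ _ q (fun i x => -1 * x 0 i) y
  (fun i => real_analyticZ (-1) (real_analytic_coord i y)).
by rewrite rowE => /(_ hq); congr real_analytic_at; apply/funext => x; rewrite rowE.
Qed.

Lemma real_analytic_dual q y : real_analytic_at q (- y) -> real_analytic_at (dual_function q) y.
Proof.
move=> /real_analytic_comp_opp /(real_analyticZ (-1)).
by congr real_analytic_at; apply/funext => x; rewrite mulN1r.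
Qed.

Lemma partial_dual q y k : real_analytic_at q (- y) ->
  partial k (dual_function q) y = partial k q (- y).
Proof.
move=> hq; have hN (i : 'I_n) : has_diff (fun x => (- x) 0 i) y (fun d => -1 * d 0 i).
  apply: has_diff_near (has_diffZ (-1) (has_diff_coord i y)).
  by near=> x; rewrite mxE mulN1r.
have h := has_diffZ (-1) (has_diff_comp hN (real_analytic_differentiable hq)).
rewrite (@partial_has_diff _ _ (dual_function q) y _ k (has_diff_near _ h)); last first.
  by near=> x; rewrite mulN1r.
rewrite (bigD1 k)//= big1 ?addr0 => [|i /negbTE ik]; rewrite !mxE !eqxx /=.
  by ring.
by rewrite ik mulr0 mul0r.
Unshelve. all: by end_near. Qed.

Definition duality_map lambda q x : 'rV[R]_n := \row_j (- lambda * partial j q x * x 0 j).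

Lemma duality_map_continuous lambda q x : real_analytic_at q x ->
  {for x, continuous (duality_map lambda q)}.
Proof.
move=> hq; apply: real_analytic_row_continuous => i.
have := real_analyticM (real_analyticZ (- lambda) (real_analytic_partial i hq))
  (real_analytic_coord i x).
by congr real_analytic_at; apply/funext => y; rewrite mxE.
Qed.

Lemma duality_map0 lambda q : duality_map lambda q 0 = 0.
Proof. by apply/rowP => j; rewrite !mxE mulr0. Qed.

Lemma sqmod_special Psi (c : 'I_n -> R) z : (forall j, zcoord (Psi z) j = (c j)%:C%C * zcoord z j) ->
  forall j, sqmod (Psi z) 0 j = c j ^+ 2 * sqmod z 0 j.
Proof. by move=> h j; rewrite !mxE; have /special_coord[-> ->] := h j; ring. Qed.

Lemma pullback_kahler U Psi psi Phid p lambda z u v :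
  open U -> special_factors U Psi psi -> U z ->
  (\forall w \near Psi z, Phid w = p (sqmod w)) -> real_analytic_at p (sqmod (Psi z)) ->
  pullback Psi (scale_form lambda (kahler_form Phid)) z u v =
  (lambda * omega_form (fun a w => partial a p (sqmod (Psi w)) * psi a w ^+ 2) z u v)%:C%C.
Proof.
move=> oU hs Uz Pp hp; have [h1 h2] := special_near oU hs Uz.
rewrite /pullback /scale_form (kahler_form_sqmod _ _ Pp hp) rmorphM; congr (_ * _%:C%C).
have [|_ _ ->] := @pullback_omega_form _ _ Psi psi (fun a w => partial a p (sqmod w)) z u v h1 h2.
  move=> a; apply/real_analytic_differentiable/real_analytic_comp_sqmod.
  exact: real_analytic_partial.
by [].
Qed.

Lemma special_differentiable U Psi psi z : open U -> special_factors U Psi psi -> U z ->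
  differentiable Psi z.
Proof.
move=> oU hs Uz; have [h1 h2] := special_near oU hs Uz.
have [|d _ _] := @pullback_omega_form _ _ Psi psi (fun _ _ => 1) z 0 0 h1 h2; last exact: d.
by move=> a; exact: (has_diff_cst _ _).1.
Qed.

Lemma special0 U Psi psi : special_factors U Psi psi -> U 0 -> Psi 0 = 0.
Proof.
move=> hs U0; apply/rowP => i; rewrite mxE; case: (split_ordP i) => j ->.
  by have /special_coord[-> _] := (hs j).2 0 U0; rewrite mxE mulr0.
by have /special_coord[_ ->] := (hs j).2 0 U0; rewrite mxE mulr0.
Qed.

(** With [psi_j^2 = lambda q_j], the condition that [Psi] pulls [lambda] times the
dual form back to [omega0] says that the [omega_form] of [lambda q_j(- |Psi|^2) psi_j^2 - 1] vanishes. *)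
Lemma duality_equations_sqmod U Phi Phid q Psi psi lambda :
  open U -> U 0 -> (forall z, U z -> Phi z = q (sqmod z)) ->
  (\forall x \near (0 : 'rV[R]_n), real_analytic_at q x) ->
  (\forall z \near (0 : V), Phid z = dual_function q (sqmod z)) ->
  special_factors U Psi psi ->
  form_eq_on U (pullback Psi (@omega0 R n)) (scale_form lambda (kahler_form Phi)) ->
  form_eq_on U (pullback Psi (scale_form lambda (kahler_form Phid))) (@omega0 R n) ->
  \forall z \near (0 : V), forall k, sqmod z 0 k != 0 ->
    lambda ^+ 2 * partial k q (sqmod z) *
      partial k q (duality_map lambda q (sqmod z)) = 1.
Proof.
move=> oU U0 Pq hq hPhid hs form1 form2.
have Psi0 := special0 hs U0.
have cPsi : {for 0, continuous Psi}.
  exact: differentiable_continuous (special_differentiable oU hs U0).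
have hqN : \forall x \near (0 : 'rV[R]_n), real_analytic_at q (- x).
  move/near_norm0P : hq => [r [r0 hr]]; apply/near_norm0P; exists r; split => // x.
  by move=> xr; apply: hr; rewrite normrN.
have near_all : \forall z \near (0 : V), [/\ U z, real_analytic_at q (- sqmod (Psi z)),
    \forall w \near Psi z, Phid w = dual_function q (sqmod w) &
    forall j, sqmod z 0 j != 0 -> psi j z ^+ 2 = lambda * partial j q (sqmod z)].
  have n2 : \forall z \near (0 : V), real_analytic_at q (- sqmod (Psi z)).
    have n2' : \forall w \near (0 : V), real_analytic_at q (- sqmod w).
      have := @sqmod_continuous R n 0 [set x | real_analytic_at q (- x)].
      by rewrite /= sqmod0; apply.
    by apply: (cPsi [set w | real_analytic_at q (- sqmod w)]); rewrite Psi0.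
  have n3 : \forall z \near (0 : V), \forall w \near Psi z, Phid w = dual_function q (sqmod w).
    apply: (cPsi [set z | \forall w \near z, Phid w = dual_function q (sqmod w)]).
    by rewrite Psi0; exact: (near_join hPhid).
  have n4 := special_factor_near0 oU U0 Pq hq hs form1.
  by near=> z; split; near: z; [exact: (open_near oU U0) | exact: n2 | exact: n3 | exact: n4].
move/near_norm0P : near_all => [r [r0 hr]]; apply/near_norm0P; exists r; split => // z zr k zk.
have [Uz qz _ psiz] := hr z zr.
pose g a w := partial a (dual_function q) (sqmod (Psi w)) * psi a w ^+ 2.
have dg w : `|w| < r -> forall a, differentiable (g a) w.
  move=> wr a; have [Uw qw _ _] := hr w wr.
  have dp : differentiable (fun w' => partial a (dual_function q) (sqmod (Psi w'))) w.
    apply: (@differentiable_comp _ _ _ _ Psi (fun w' => partial a (dual_function q) (sqmod w'))).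
      exact: (special_differentiable oU hs Uw).
    apply/real_analytic_differentiable/real_analytic_comp_sqmod/real_analytic_partial.
    exact: real_analytic_dual.
  exact: (has_diffM (has_diffE dp) (has_diffE (differentiable_sqr ((special_near oU hs Uw).2 a)))).1.
have dlg w (wr : `|w| < r) a := (has_diffZ lambda (has_diffE (dg w wr a))).1.
have d1 w (a : 'I_n) := (has_diff_cst (1 : R) w).1.
have f0 : lambda * g k z - 1 = 0.
  apply: (@omega_form_eq0 _ _ (fun a w => lambda * g a w - 1) r) zk => //.
    move=> w wr a.
    have := (has_diffD (has_diffE (dlg w wr a)) (has_diffZ (-1) (has_diffE (d1 w a)))).1.
    by congr (differentiable _ _); apply/funext => w'; rewrite mulN1r.
  move=> w wr u v; have [Uw qw Pw _] := hr w wr.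
  rewrite (@omega_formB _ _ (fun a w => lambda * g a w) (fun _ _ => 1) w u v
    (dlg w wr) (d1 w)) (omega_formZ _ _ _ (dg w wr)).
  have := form2 w Uw u v.
  rewrite (pullback_kahler lambda u v oU hs Uw Pw (real_analytic_dual qw)) omega0E.
  by move=> /complexI ->; rewrite subrr.
move/eqP : f0; rewrite subr_eq0 /g partial_dual// psiz//.
have -> : - sqmod (Psi z) = duality_map lambda q (sqmod z).
  apply/rowP => j; rewrite mxE (sqmod_special (fun j => (hs j).2 z Uz)) [RHS]mxE.
  have [->|zj] := eqVneq (sqmod z 0 j) 0; first by rewrite !mulr0 oppr0.
  by rewrite psiz//; ring.
by move=> /eqP <-; ring.
Unshelve. all: by end_near. Qed.

(** The points [|z|^2] only fill the orthant, but an identity between analytic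
functions that holds there holds near the origin. *)
Lemma orthant_identity (H : 'I_n -> 'rV[R]_n -> R) :
  (\forall x \near (0 : 'rV[R]_n), forall k, real_analytic_at (H k) x) ->
  (\forall z \near (0 : V), forall k, sqmod z 0 k != 0 -> H k (sqmod z) = 0) ->
  \forall x \near (0 : 'rV[R]_n), forall k, H k x = 0.
Proof.
move=> /near_norm0P[r [r0 hr]] /near_norm0P[s [s0 hs]].
apply/near_norm0P; exists r; split => // x xr k.
pose e := Num.min (r / 2) (s ^+ 2 / 4).
have e0 : 0 < e by rewrite lt_min !divr_gt0// exprn_gt0.
have er : e < r.
  by apply: (@le_lt_trans _ _ (r / 2)); [rewrite ge_min lexx | rewrite ltr_pdivrMr// ltr_pMr// ltr1n].
have es : e <= s ^+ 2 / 4 by rewrite ge_min lexx orbT.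
(* All points within [e / 2] of the diagonal point [b] have coordinates between
   [e / 2] and [3 e / 2], so they are [|z|^2] for some real [z] of norm below [s]. *)
pose b : 'rV[R]_n := \row_j e.
apply: (@real_analytic_ball_zero _ _ (H k) 0 b r); last by rewrite subr0.
- by move=> y; rewrite subr0 => yr; apply: hr.
- rewrite subr0; apply: le_lt_trans er; apply: norm_row_le; first exact: ltW.
  by move=> i; rewrite mxE gtr0_norm.
apply/near_rowP; exists (e / 2); split; first by rewrite divr_gt0.
move=> h he; set y := b + _.
have yb j : e / 2 <= y 0 j /\ y 0 j <= 3 / 2 * e.
  by have := he j; rewrite /y !mxE ler_norml => /andP[]; split; lra.
pose z : V := row_mx (\row_j Num.sqrt (y 0 j)) 0.
have zE : sqmod z = y.
  apply/rowP => j; rewrite mxE /z row_mxEl row_mxEr !mxE expr0n addr0 sqr_sqrtr ?mxE//.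
  by have := (yb j).1; rewrite /y !mxE; lra.
rewrite -zE; apply: hs; last first.
  by rewrite zE gt_eqF//; have := (yb k).1; lra.
apply: (@le_lt_trans _ _ (Num.sqrt (3 / 2 * e))); last first.
  rewrite -[ltRHS](ger0_norm (ltW s0)) -sqrtr_sqr ltr_sqrt ?exprn_gt0//.
  have : 0 < s ^+ 2 by rewrite exprn_gt0.
  lra.
apply: norm_row_le => [|i]; first exact: sqrtr_ge0.
case: (split_ordP i) => j ->; rewrite /z ?row_mxEl ?row_mxEr mxE ?normr0 ?sqrtr_ge0//.
by rewrite ger0_norm ?sqrtr_ge0// ler_wsqrtr// (yb j).2.
Qed.

Lemma duality_equations U Phi Phid q Psi psi lambda :
  open U -> U 0 -> (forall z, U z -> Phi z = q (sqmod z)) ->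
  (\forall x \near (0 : 'rV[R]_n), real_analytic_at q x) ->
  (\forall z \near (0 : V), Phid z = dual_function q (sqmod z)) ->
  special_factors U Psi psi ->
  form_eq_on U (pullback Psi (@omega0 R n)) (scale_form lambda (kahler_form Phi)) ->
  form_eq_on U (pullback Psi (scale_form lambda (kahler_form Phid))) (@omega0 R n) ->
  \forall x \near (0 : 'rV[R]_n), forall k,
    lambda ^+ 2 * partial k q x * partial k q (duality_map lambda q x) = 1.
Proof.
move=> oU U0 Pq hq hPhid hs form1 form2.
pose H k x := lambda ^+ 2 * partial k q x * partial k q (duality_map lambda q x) - 1.
suff : \forall x \near (0 : 'rV[R]_n), forall k, H k x = 0.
  by apply: filterS => x h k; have /eqP := h k; rewrite subr_eq0 => /eqP.
apply: orthant_identity.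
  have hq0 := nbhs_singleton hq.
  have nd : \forall x \near (0 : 'rV[R]_n), real_analytic_at q (duality_map lambda q x).
    have := @duality_map_continuous lambda q 0 hq0 [set x | real_analytic_at q x].
    by rewrite duality_map0; apply.
  near=> x => k; have qx : real_analytic_at q x by near: x.
  have qd : real_analytic_at q (duality_map lambda q x) by near: x.
  apply: real_analyticB; last exact: real_analytic_cst.
  apply: real_analyticM; first by apply/real_analyticZ/real_analytic_partial.
  have := @real_analytic_comp _ _ _ (partial k q) (fun j x => - lambda * partial j q x * x 0 j) x.
  apply; last exact: real_analytic_partial.
  move=> j; apply: real_analyticM; last exact: real_analytic_coord.
  by apply/real_analyticZ/real_analytic_partial.
apply: filterS (duality_equations_sqmod oU U0 Pq hq hPhid hs form1 form2) => z hz k zk.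
by rewrite /H hz// subrr.
Unshelve. all: by end_near. Qed.

End Equations.

(** * Existence *)

Section Existence.
Context {R : realType}.
Variable n : nat.
Local Notation V := 'rV[R]_(n + n).
Local Notation zx z j := (z 0 (lshift n j)).
Local Notation zy z j := (z 0 (rshift n j)).
Implicit Types (z w : V) (x y : 'rV[R]_n) (Phi Phid : V -> R) (q : 'rV[R]_n -> R)
  (c : 'I_n -> V -> R) (U M Md : set V) (lambda : R).

(** At the origin the Levi form is the diagonal matrix of the [q_k(0)]. *)
Lemma potential_partial_gt0 M Phi q k : M 0 -> strictly_psh_on M Phi ->
  (\forall z \near (0 : V), Phi z = q (sqmod z)) -> real_analytic_at q 0 ->
  0 < partial k q 0.
Proof.
move=> M0 psh Pq hq; pose e : V := delta_mx 0 (lshift n k).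
have ek j : zcoord e j = (j == k)%:R.
  rewrite /zcoord !mxE !eqxx /= eq_lshift eq_rlshift.
  by case: eqP.
have e0 : e != 0.
  apply/eqP => /rowP /(_ (lshift n k)); rewrite !mxE !eqxx /= => /eqP.
  by rewrite oner_eq0.
have := psh 0 M0 e e0; rewrite (bigD1 k)//= [X in _ + X]big1 ?addr0; last first.
  by move=> j /negbTE jk; rewrite big1// => l _; rewrite ek jk mulr0 mul0r.
rewrite (bigD1 k)//= big1 ?addr0; last first.
  by move=> j /negbTE jk; rewrite !ek jk conjC0 mulr0.
have hq' : real_analytic_at q (sqmod (0 : V)) by rewrite sqmod0.
rewrite !ek eqxx conjC1 !mulr1 (levi_sqmod k k Pq hq') sqmod0 eqxx.
rewrite (_ : (_ +i* _)%C = (partial k q 0)%:C%C) ?ltcR//.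
by congr (_ +i* _)%C; rewrite !mxE /= ?mulr1n; ring.
Qed.

Definition special_of c z : V := row_mx (\row_j (c j z * zx z j)) (\row_j (c j z * zy z j)).

Lemma special_of_coord c z j :
  zx (special_of c z) j = c j z * zx z j /\ zy (special_of c z) j = c j z * zy z j.
Proof. by rewrite row_mxEl row_mxEr !mxE. Qed.

Lemma special_of_zcoord c z j : zcoord (special_of c z) j = (c j z)%:C%C * zcoord z j.
Proof. by apply/special_coord; exact: special_of_coord. Qed.

Lemma special_of_analytic c z i : (forall j, real_analytic_at (c j) z) ->
  real_analytic_at (fun w => special_of c w 0 i) z.
Proof.
move=> hc; case: (split_ordP i) => j ->.
  have := real_analyticM (hc j) (real_analytic_coord (lshift n j) z).
  by congr real_analytic_at; apply/funext => w; rewrite (special_of_coord c w j).1.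
have := real_analyticM (hc j) (real_analytic_coord (rshift n j) z).
by congr real_analytic_at; apply/funext => w; rewrite (special_of_coord c w j).2.
Qed.

Lemma special_of_comp c c' z : (forall j, c' j (special_of c z) * c j z = 1) ->
  special_of c' (special_of c z) = z.
Proof.
move=> h; apply/rowP => i; case: (split_ordP i) => j ->.
  by rewrite (special_of_coord c' _ j).1 (special_of_coord c z j).1 mulrA h mul1r.
by rewrite (special_of_coord c' _ j).2 (special_of_coord c z j).2 mulrA h mul1r.
Qed.

(** A ball is the union of the segments that join its points to the origin. *)
Lemma norm_ball_connected (r : R) : connected [set z : V | `|z| < r].
Proof.
have [r0|r0] := ltP 0 r; last first.
  rewrite (_ : [set z | _] = set0); first exact: connected0.
  by apply/seteqP; split => z //= zr; have := le_lt_trans (normr_ge0 z) (lt_le_trans zr r0); rewrite ltxx.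
pose seg z := (fun t : R => t *: z) @` `[0, 1]%classic.
have -> : [set z : V | `|z| < r] = \bigcup_(z in [set z : V | `|z| < r]) seg z.
  apply/seteqP; split => z /= zr.
    by exists z => //; exists 1; rewrite ?scale1r//= in_itv /= ler01 lexx.
  case: zr => w /= wr [t /=]; rewrite in_itv /= => /andP[t0 t1] <-.
  by rewrite normrZ ger0_norm//; apply: le_lt_trans wr; apply: ler_piMl.
apply: bigcup_connected.
  by exists 0 => z _; exists 0; rewrite ?scale0r//= in_itv /= lexx ler01.
move=> z _; apply: connected_continuous_connected; first exact: segment_connected.
by apply: continuous_subspaceT => t; exact: scalel_continuous.
Qed.

Lemma near_open (T : topologicalType) (A : set T) :
  (forall t, A t -> \forall u \near t, A u) -> open A.
Proof. by move=> h; rewrite openE. Qed.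

(** The duality equations say that [x |-> duality_map x] is an involution near the
origin; taking square roots of the factors turns this into an explicit inverse,
so that no inverse function theorem is involved. *)
Lemma special_duality_exists M Phi Md Phid q lambda :
  0 < lambda -> open M -> M 0 -> open Md -> Md 0 ->
  (forall z, M z -> Phi z = q (sqmod z)) ->
  (\forall x \near (0 : 'rV[R]_n), real_analytic_at q x) ->
  (\forall z \near (0 : V), Phid z = dual_function q (sqmod z)) ->
  (forall k, 0 < partial k q 0) ->
  (\forall x \near (0 : 'rV[R]_n), forall k,
    lambda ^+ 2 * partial k q x * partial k q (duality_map lambda q x) = 1) ->
  exists U Ud Psi, special_symplectic_duality lambda M Phi Md Phid U Ud Psi.
Proof.
move=> l0 oM M0 oMd Md0 Pq hq hPhid qpos heq.
have hq0 := nbhs_singleton hq.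
have npos : \forall x \near (0 : 'rV[R]_n), forall k, 0 < lambda * partial k q x.
  suff npos k : \forall x \near (0 : 'rV[R]_n), 0 < lambda * partial k q x.
    exact: (@filter_forall _ _ (fun k => [set x | 0 < lambda * partial k q x]) _ _ npos).
  have := differentiable_continuous (real_analytic_differentiable
    (real_analyticZ lambda (real_analytic_partial k hq0))).
  have lq : 0 < lambda * partial k q 0 by rewrite mulr_gt0.
  by move=> /(_ _ (open_nbhs_nbhs (conj (@open_gt R 0) lq))).
have : \forall x \near (0 : 'rV[R]_n), [/\ real_analytic_at q x,
    forall k, 0 < lambda * partial k q x &
    forall k, lambda ^+ 2 * partial k q x * partial k q (duality_map lambda q x) = 1].
  by near=> x; split; near: x.
move=> /near_norm0P[r [r0 good]].
have goodN x : `|x| < r -> [/\ real_analytic_at q (- x),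
    forall k, 0 < lambda * partial k q (- x) &
    forall k, lambda ^+ 2 * partial k q (- x) * partial k q (duality_map lambda q (- x)) = 1].
  by move=> xr; apply: good; rewrite normrN.
pose psi j z := Num.sqrt (lambda * partial j q (sqmod z)).
pose chi j w := Num.sqrt (lambda * partial j q (- sqmod w)).
pose A : set V := [set z | `|sqmod z| < r].
have oA : open A.
  apply: near_open => z Az; apply: (@sqmod_continuous R n z [set x | `|x| < r]).
  apply/near_normP; exists (r - `|sqmod z|); split; first by rewrite subr_gt0.
  move=> x; rewrite ltrBrDr; apply: le_lt_trans; apply: le_trans (ler_normD _ _).
  by rewrite subrK.
have A0 : A 0 by rewrite /A /= sqmod0 normr0.
have psi_an z : A z -> forall j, real_analytic_at (psi j) z.
  move=> Az j; have [qz qzpos _] := good _ Az; apply: real_analytic_sqrt => //.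
  apply/real_analyticZ/real_analytic_comp_sqmod; exact: real_analytic_partial.
have chi_an z : A z -> forall j, real_analytic_at (chi j) z.
  move=> Az j; have [qz qzpos _] := goodN _ Az; apply: real_analytic_sqrt => //.
  apply: real_analyticZ.
  apply: (@real_analytic_comp_sqmod _ _ (fun x => partial j q (- x))).
  exact/real_analytic_comp_opp/real_analytic_partial.
have psi2 z j : A z -> psi j z ^+ 2 = lambda * partial j q (sqmod z).
  by move=> Az; have [_ pos _] := good _ Az; rewrite sqr_sqrtr// ltW.
have chi2 z j : A z -> chi j z ^+ 2 = lambda * partial j q (- sqmod z).
  by move=> Az; have [_ pos _] := goodN _ Az; rewrite sqr_sqrtr// ltW.
pose Psi := special_of psi; pose G := special_of chi.
have sqPsi z : A z -> - sqmod (Psi z) = duality_map lambda q (sqmod z).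
  move=> Az; apply/rowP => j; rewrite [LHS]mxE [RHS]mxE.
  by rewrite (sqmod_special (special_of_zcoord psi z)) psi2//; ring.
have sqG w : A w -> sqmod (G w) = duality_map lambda q (- sqmod w).
  move=> Aw; apply/rowP => j; rewrite [RHS]mxE [(- sqmod w) 0 j]mxE.
  by rewrite (sqmod_special (special_of_zcoord chi w)) chi2//; ring.
have GPsi z : A z -> G (Psi z) = z.
  move=> Az; have [_ pos eqn] := good _ Az; apply: special_of_comp => j.
  rewrite /chi -/Psi sqPsi// mulrC -sqrtrM ?ltW//.
  by rewrite (_ : _ * _ = 1) ?sqrtr1// -(eqn j); ring.
have PsiG w : A w -> Psi (G w) = w.
  move=> Aw; have [_ pos eqn] := goodN _ Aw; apply: special_of_comp => j.
  rewrite /psi -/G sqG// mulrC -sqrtrM ?ltW//.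
  by rewrite (_ : _ * _ = 1) ?sqrtr1// -(eqn j); ring.
have Psi_an z : A z -> forall i, real_analytic_at (fun w => Psi w 0 i) z.
  by move=> Az i; apply: special_of_analytic; exact: psi_an.
have G_an z : A z -> forall i, real_analytic_at (fun w => G w 0 i) z.
  by move=> Az i; apply: special_of_analytic; exact: chi_an.
have cPsi z : A z -> {for z, continuous Psi}.
  by move=> Az; apply: real_analytic_row_continuous; exact: Psi_an.
have cG z : A z -> {for z, continuous G}.
  by move=> Az; apply: real_analytic_row_continuous; exact: G_an.
have special_of0 c : special_of c 0 = 0.
  by apply/rowP => i; rewrite [RHS]mxE; case: (split_ordP i) => j ->;
    rewrite ?(special_of_coord c 0 j).1 ?(special_of_coord c 0 j).2 mxE mulr0.
have nU : \forall z \near (0 : V), [/\ A z, M z, A (Psi z), Md (Psi z) &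
    \forall w \near Psi z, Phid w = dual_function q (sqmod w)].
  have n3 : \forall z \near (0 : V), A (Psi z).
    by have := cPsi 0 A0 A; rewrite /Psi special_of0; apply; exact: (open_near oA A0).
  have n4 : \forall z \near (0 : V), Md (Psi z).
    by have := cPsi 0 A0 Md; rewrite /Psi special_of0; apply; exact: (open_near oMd Md0).
  have n5 : \forall z \near (0 : V), \forall w \near Psi z, Phid w = dual_function q (sqmod w).
    have := cPsi 0 A0 [set z | \forall w \near z, Phid w = dual_function q (sqmod w)].
    by rewrite /Psi special_of0; apply; exact: (near_join hPhid).
  near=> z; split; near: z; [exact: (open_near oA A0) | exact: (open_near oM M0) |
    exact: n3 | exact: n4 | exact: n5].
move/near_norm0P : nU => [s [s0 hU]].
pose U : set V := [set z | `|z| < s].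
have oU : open U.
  apply: near_open => z Uz; apply/near_normP; exists (s - `|z|); split; first by rewrite subr_gt0.
  move=> x; rewrite ltrBrDr; apply: le_lt_trans; apply: le_trans (ler_normD _ _).
  by rewrite subrK.
have U0 : U 0 by rewrite /U /= normr0.
pose Ud : set V := [set w | A w /\ U (G w)].
have oUd : open Ud.
  apply: near_open => w [Aw Uw].
  have n1 := cG w Aw U (open_near oU Uw).
  by near=> w'; split; near: w'; [exact: (open_near oA Aw) | exact: n1].
have Ud0 : Ud 0 by split => //; rewrite /G special_of0.
have PsiU z : U z -> Ud (Psi z).
  by move=> Uz; have [Az _ APz _ _] := hU z Uz; split => //; rewrite GPsi.
have GUd w : Ud w -> U (G w) /\ Psi (G w) = w by move=> [Aw Uw]; rewrite PsiG.
have cUd : connected Ud.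
  have -> : Ud = Psi @` U.
    by apply/seteqP; split => [w /GUd[Uw <-]|_ [z Uz <-]]; [exists (G w) | exact: PsiU].
  apply: connected_continuous_connected; first exact: norm_ball_connected.
  apply: continuous_in_subspaceT => z; rewrite inE => Uz.
  by apply: cPsi; have [] := hU z Uz.
have hs : special_factors U Psi psi.
  move=> j; split; first by move=> z Uz; apply: psi_an; have [] := hU z Uz.
  by move=> z _; exact: special_of_zcoord.
exists U, Ud, Psi; split; last first.
  split.
  - by split => //; split => //; [exact: norm_ball_connected | exists 0].
  - by split => //; split => //; exists 0.
  - exact: PsiU.
  - by move=> i z Uz; apply: Psi_an; have [] := hU z Uz.
  - by exists psi.
split.
- by split => // z Uz; have [] := hU z Uz.
- by split => // w /GUd[Uw <-]; have [] := hU _ Uw.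
- exists G; split.
  + by move=> z Uz; split; [exact: PsiU | apply: GPsi; have [] := hU z Uz].
  + exact: GUd.
  + by move=> i; apply: real_analytic_smooth => z Uz; apply: Psi_an; have [] := hU z Uz.
  + by move=> i; apply: real_analytic_smooth => w [Aw _]; exact: G_an.
- move=> z Uz u v; have [Az Mz _ _ _] := hU z Uz; have [qz _ _] := good _ Az.
  rewrite (pullback_omega0 u v oU hs Uz) /scale_form (@kahler_form_sqmod _ _ _ q)//; last first.
    by apply: filterS (open_near oM Mz).
  have dq a : differentiable (fun w => partial a q (sqmod w)) z.
    by apply/real_analytic_differentiable/real_analytic_comp_sqmod/real_analytic_partial.
  rewrite -rmorphM -(omega_formZ lambda u v dq); congr (_%:C%C).
  apply: eq_omega_form => a.
    by apply: filterS (open_near oA Az) => w Aw; exact: psi2.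
  by apply: differentiable_sqr; apply/real_analytic_differentiable/psi_an.
- move=> z Uz u v; have [Az Mz APz _ Pz] := hU z Uz; have [qPz _ _] := goodN _ APz.
  rewrite (pullback_kahler lambda u v oU hs Uz Pz (real_analytic_dual qPz)) omega0E.
  congr (_%:C%C); pose g a w := partial a (dual_function q) (sqmod (Psi w)) * psi a w ^+ 2.
  have gE a : \forall w \near z, lambda^-1 = g a w.
    apply: filterS (open_near oU Uz) => w Uw; have [Aw _ APw _ _] := hU w Uw.
    have [qPw _ _] := goodN _ APw; have [_ _ eqn] := good _ Aw.
    rewrite /g partial_dual// sqPsi// psi2//.
    apply: (mulfI (lt0r_neq0 l0)); rewrite divff ?lt0r_neq0// -(eqn a); ring.
  have dg a : differentiable (g a) z by exact: (has_diff_near (gE a) (has_diff_cst _ _)).1.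
  rewrite -(omega_formZ lambda u v dg); apply/esym/eq_omega_form => a.
    by apply: filterS (gE a) => w <-; rewrite divff// lt0r_neq0.
  exact: (has_diff_cst _ _).1.
Unshelve. all: by end_near. Qed.

End Existence.

Theorem theorem1p5 (R : realType) (n : nat)
    (M : set 'rV[R]_(n + n)) (Phi : 'rV[R]_(n + n) -> R)
    (Phit : 'rV[R]_n -> R)
    (Md : set 'rV[R]_(n + n)) (Phid : 'rV[R]_(n + n) -> R)
    (lambda : R)
    (hM : complex_domain M) (hM0 : M 0)
    (hPhi : kahler_potential M Phi)
    (hPhit : associated_function M Phi Phit)
    (hdual : local_dual Phi Md Phid)
    (hflat : nowhere_flat M Phi)
    (hlambda : 0 < lambda) :
  [/\ (exists (U Ud : set 'rV[R]_(n + n))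
              (Psi : 'rV[R]_(n + n) -> 'rV[R]_(n + n)),
         special_symplectic_duality lambda M Phi Md Phid U Ud Psi)
      <->
      (\forall x \near (0 : 'rV[R]_n), forall k : 'I_n,
         lambda ^+ 2 * partial k Phit x *
           partial k Phit (\row_(j < n) (- lambda * partial j Phit x * x 0 j))
         = 1),
      (* Flipping the sign of a component of Psi gives another special duality,
         so Psi can only be unique up to these signs. *)
      (forall (Md2 : set 'rV[R]_(n + n)) (Phid2 : 'rV[R]_(n + n) -> R)
              (U1 Ud1 U2 Ud2 : set 'rV[R]_(n + n))
              (Psi1 Psi2 : 'rV[R]_(n + n) -> 'rV[R]_(n + n)),
         local_dual Phi Md2 Phid2 ->
         special_symplectic_duality lambda M Phi Md Phid U1 Ud1 Psi1 ->
         special_symplectic_duality lambda M Phi Md2 Phid2 U2 Ud2 Psi2 ->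
         exists eps : 'I_n -> bool, forall z, U1 z -> U2 z -> forall j,
           zcoord (Psi2 z) j = (-1) ^+ (eps j) * zcoord (Psi1 z) j) &
      (forall (U Ud : set 'rV[R]_(n + n))
              (Psi : 'rV[R]_(n + n) -> 'rV[R]_(n + n)),
         special_symplectic_duality lambda M Phi Md Phid U Ud Psi ->
         rotation_invariant_map U Psi)].
Proof.
have [oM cM _] := hM; have [aPhi psh] := hPhi; have [Pq [W [oW W0 aW]]] := hPhit.
have [[oMd _ _] Md0 _ [a [exp_Phi exp_dual]]] := hdual.
have hq : \forall x \near (0 : 'rV[R]_n), real_analytic_at Phit x.
  by apply: filterS (open_near oW W0); exact: aW.
have Pq0 : \forall z \near (0 : 'rV[R]_(n + n)), Phi z = Phit (sqmod z).
  by apply: filterS (open_near oM hM0); exact: Pq.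
have hq0 := nbhs_singleton hq.
have hPhid : \forall z \near (0 : 'rV[R]_(n + n)), Phid z = dual_function Phit (sqmod z).
  exact: (local_dual_near0 exp_Phi exp_dual Pq0 hq0).
split.
- split.
    move=> [U [Ud [Psi [[[oU U0 UM] _ _ form1 form2] [_ _ _ _ [psi hs]]]]]].
    exact: (duality_equations oU U0 (fun z Uz => Pq z (UM z Uz)) hq hPhid hs form1 form2).
  move=> heq; apply: (special_duality_exists hlambda oM hM0 oMd Md0 Pq hq hPhid _ heq) => k.
  exact: (potential_partial_gt0 k hM0 psh Pq0 hq0).
- move=> Md2 Phid2 U1 Ud1 U2 Ud2 Psi1 Psi2 _.
  move=> [[[oU1 U10 UM1] [oUd1 _ _] d1 f1 _] [[[_ cU1 _] _] _ _ _ [psi1 hs1]]].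
  move=> [[[oU2 U20 UM2] [oUd2 _ _] d2 f2 _] [[[_ cU2 _] _] _ _ _ [psi2 hs2]]].
  (* The sign is flipped exactly when the two factors have opposite signs at 0. *)
  exists (fun j => psi1 j 0 * psi2 j 0 < 0).
  exact: (special_factor_unique oM aPhi Pq UM1 UM2 hq oU1 oUd1 cU1 U10 oU2 oUd2 cU2 U20
    hs1 d1 hs2 d2 f1 f2).
- move=> U Ud Psi [[[oU U0 UM] [oUd _ _] d f _] [[[_ cU _] _] _ _ _ [psi hs]]].
  have inv := special_factor_invariant oM aPhi Pq UM hq oU oUd cU U0 hs d f.
  exists psi, (fun j x => xget 0 [set y | exists z, [/\ U z, sqmod z = x & y = psi j z]]).
  split => // j z Uz; case: xgetP => [_ _ [z' [Uz' zz' ->]]|/(_ (psi j z))].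
    exact: inv.
  by case; exists z.
Qed.
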